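(* Let $f:D_1\to D_2$ be a finite étale morphism of open unit discs of degree $d$. Then $f$ is radial if and only if there exists a function $N:[0,1)\to\mathbb{N}$ such that for every rational point $y\in D_2(k)$ and every $\rho\in[0,1)$ we have $\#f^{-1}(y_\rho)=N(\rho)$ (preimages counted without multiplicity). Moreover, the profile $\mathbf{p}_f$ of $f$ is uniquely determined by the function $N$ (i.e. two radial finite étale morphisms of open unit discs with the same function $N$ have the same profile).
   Context: Throughout, $k$ is an algebraically closed field complete with respect to a non-Archimedean absolute value $|\cdot|$ extending the $p$-adic absolute value of $\mathbb{Q}_p$; $v=-\log|\cdot|$; $\mathbb{N}=\{1,2,\dots\}$. Curves are $k$-analytic curves in the sense of Berkovich. An open unit disc is a $k$-analytic curve $D$ with an isomorphism $T$ (a coordinate) onto $\{|T|<1\}\subset\mathbb{A}^1_k$. For $a\in D(k)$ and $s\in(0,1)$, $D(a,s)$ is the closed disc of radius $s$ in $D$ containing $a$, and $a_s=\zeta_{a,s}$ is its maximal point (the point given by the sup-norm on $D(a,s)$); also $a_0=\zeta_{a,0}=a$. Let $f:D_1\to D_2$ be a finite morphism of open unit discs and $a\in D_1(k)$. Choose a coordinate $T$ on $D_1$ with $T(a)=0$ and a coordinate $S$ on $D_2$ with $S(f(a))=0$, and write $f$ as $S=\sum_{i\ge1}c_iT^i$. The valuation polygon of $f$ at $a$ is $v_a(f,\lambda)=\inf_{i\ge1}\{v(c_i)+i\lambda\}$, $\lambda\in(0,\infty)$; it does not depend on the choice of $T,S$. The profile of $f$ at $a$ is the function $\mathbf{p}_{a,f}:[0,1]\to[0,1]$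 with $\mathbf{p}_{a,f}(0)=0$, $\mathbf{p}_{a,f}(1)=1$ and, for $\rho\in(0,1)$, $\mathbf{p}_{a,f}(\rho)=\rho'$ where $f(D(a,\rho))=D(f(a),\rho')$; equivalently $v_a(f,-\log\rho)=-\log\mathbf{p}_{a,f}(\rho)$. The morphism $f$ is radial if $v_a(f,\cdot)$ (equivalently $\mathbf{p}_{a,f}$) is the same for all $a\in D_1(k)$; this common function $\mathbf{p}_f$ is then called the profile of $f$. *)

(* Defs.v *)
(** The ground field [k] is a [closedFieldType] with an
    absolute value [av : k -> R], where [R : realType]. *)
From HB Require Import structures.
From mathcomp Require Import all_boot all_order all_algebra.
From mathcomp Require Import all_classical all_reals all_analysis.
Set Implicit Arguments.
Unset Strict Implicit.
Unset Printing Implicit Defensive.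
Import Order.TTheory GRing.Theory Num.Theory.
Import numFieldNormedType.Exports.
Local Open Scope classical_set_scope.
Local Open Scope ring_scope.

Definition av_cvg (R : realType) (k : closedFieldType) (av : k -> R)
    (u : nat -> k) (l : k) : Prop :=
  (fun n => av (u n - l)) @ \oo --> (0 : R).

(** Junk value [0] when [u] diverges. *)
Definition av_lim (R : realType) (k : closedFieldType) (av : k -> R)
    (u : nat -> k) : k :=
  xget 0 [set l | av_cvg av u l].

(** Since [av] is complete and restricts to the [p]-adic absolute value of the
    rationals, the closure of the prime field of [k] is [Q_p] with its usual
    absolute value. *)
Record complete_padic_av (R : realType) (k : closedFieldType) (p : nat)
    (av : k -> R) : Prop := {
  av_ge0 : forall x, 0 <= av x;
  av_eq0 : forall x, av x = 0 <-> x = 0;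
  avM : forall x y, av (x * y) = av x * av y;
  av_ultra : forall x y, av (x + y) <= Num.max (av x) (av y);
  av_padic : forall n : nat, (0 < n)%N -> av n%:R = p%:R ^- logn p n;
  av_complete : forall u : nat -> k,
    (forall eps : R, 0 < eps -> exists n0 : nat, forall m n : nat,
      (n0 <= m)%N -> (n0 <= n)%N -> av (u m - u n) < eps) ->
    exists l, av_cvg av u l
}.

(** ** The Berkovich open unit disc *)

(** Points of the analytic affine line: multiplicative seminorms on [k[T]]
    extending the absolute value of [k]. *)
Definition berk_line (R : realType) (k : closedFieldType) (av : k -> R) :
    set ({poly k} -> R) :=
  [set x | [/\ forall P, 0 <= x P,
               forall c, x c%:P = av c,
               forall P Q, x (P * Q) = x P * x Q &
               forall P Q, x (P + Q) <= Num.max (x P) (x Q)]].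

Definition berk_disc (R : realType) (k : closedFieldType) (av : k -> R) :
    set ({poly k} -> R) :=
  [set x | berk_line av x /\ x 'X < 1].

Definition berk_cdisc (R : realType) (k : closedFieldType) (av : k -> R)
    (a : k) (s : R) : set ({poly k} -> R) :=
  [set x | berk_line av x /\ x ('X - a%:P) <= s].

Definition zeta (R : realType) (k : closedFieldType) (av : k -> R)
    (a : k) (s : R) : {poly k} -> R :=
  fun P => sup [set x P | x in berk_cdisc av a s].

Definition kdisc (R : realType) (k : closedFieldType) (av : k -> R) : set k :=
  [set a | av a < 1].

Definition kcdisc (R : realType) (k : closedFieldType) (av : k -> R)
    (a : k) (s : R) : set k :=
  [set b | av (b - a) <= s].

(** ** Morphisms of open unit discs *)

(** A morphism is given by the pull-back of the coordinate of the target, an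
    analytic function [\sum_i f i * T ^ i] on the source disc. *)
Definition disc_fun (R : realType) (k : closedFieldType) (av : k -> R)
    (f : nat -> k) : Prop :=
  forall r : R, 0 < r < 1 -> (fun i => av (f i) * r ^+ i) @ \oo --> (0 : R).

(** [|P|] at the image of [x] is [|P o f|] at [x], and a point [x] of the disc
    extends to convergent power series by continuity. *)
Definition push (R : realType) (k : closedFieldType)
    (f : nat -> k) (x : {poly k} -> R) : {poly k} -> R :=
  fun P => lim ((fun n => x (P \Po \poly_(i < n) f i)) @ \oo).

Definition disc_morphism (R : realType) (k : closedFieldType) (av : k -> R)
    (f : nat -> k) : Prop :=
  disc_fun av f /\ forall x, berk_disc av x -> berk_disc av (push f x).

Definition feval (R : realType) (k : closedFieldType) (av : k -> R)
    (f : nat -> k) (a : k) : k :=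
  av_lim av (fun n => \sum_(i < n) f i * a ^+ i).

(** [f (a + U) = \sum_i taylor av f a i * U ^ i]. *)
Definition taylor (R : realType) (k : closedFieldType) (av : k -> R)
    (f : nat -> k) (a : k) (i : nat) : k :=
  av_lim av (fun n => \sum_(j < n) 'C(i + j, i)%:R * f (i + j)%N * a ^+ j).

(** ** Finite etale morphisms *)

(** The algebra of analytic functions on a Weierstrass domain of a closed disc
    is the completion of [k[T]] for the supremum norm.  As these domains are
    reduced and [k] is algebraically closed, its elements are identified with
    functions on the set [X] of rational points; only the values on [X] of
    [g : k -> k] are meaningful. *)
Definition affinoid_fun (R : realType) (k : closedFieldType) (av : k -> R)
    (X : set k) (g : k -> k) : Prop :=
  forall eps : R, 0 < eps ->
    exists P : {poly k}, forall x, X x -> av (g x - P.[x]) <= eps.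

(** For [phi : X -> Y], the algebra [B] of [X] is finite etale of rank [d] over
    the algebra [A] of [Y]: it is a free [A]-module with basis [e], and the
    trace form of [B] over [A] is perfect, i.e. has an invertible discriminant.
    Row [j] of [m i] holds the coordinates of [e i * e j], so that
    [m i *m m j] describes the multiplication by [e i * e j].
    Freeness is no restriction here: [Y] will be a closed disc, whose algebra
    is a principal ideal domain. *)
Definition finite_etale_algebra (R : realType) (k : closedFieldType)
    (av : k -> R) (X Y : set k) (phi : k -> k) (d : nat) : Prop :=
  exists (e : 'I_d -> k -> k) (m : 'I_d -> k -> 'M[k]_d),
  [/\ forall i, affinoid_fun av X (e i),
      forall g, affinoid_fun av X g ->
        exists2 c : 'I_d -> k -> k, forall i, affinoid_fun av Y (c i) &
          forall x, X x -> g x = \sum_i c i (phi x) * e i x,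
      forall c : 'I_d -> k -> k, (forall i, affinoid_fun av Y (c i)) ->
        (forall x, X x -> \sum_i c i (phi x) * e i x = 0) ->
        forall i y, Y y -> c i y = 0,
      (forall i j l, affinoid_fun av Y (fun y => m i y j l)) /\
        (forall i j x, X x ->
          e i x * e j x = \sum_l m i (phi x) j l * e l x) &
      exists2 u, affinoid_fun av Y u &
        forall y, Y y ->
          \det (\matrix_(i, j) \tr (m i y *m m j y)) * u y = 1].

(** The closed discs of radius [r < 1] around [0] form an admissible affinoid
    covering of the target.  The preimage of such a disc is defined by
    [|f| <= r]; it is affinoid exactly when it lies in a closed disc of radius
    [s < 1], of which it is then a Weierstrass domain. *)
Definition finite_etale (R : realType) (k : closedFieldType) (av : k -> R)
    (f : nat -> k) (d : nat) : Prop :=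
  disc_morphism av f /\
  forall r : R, 0 < r < 1 ->
    (exists2 s : R, 0 < s < 1 & forall x, berk_disc av x ->
      berk_cdisc av 0 r (push f x) -> berk_cdisc av 0 s x) /\
    finite_etale_algebra av
      (kdisc av `&` feval av f @^-1` kcdisc av 0 r)
      (kcdisc av 0 r) (feval av f) d.

(** ** Valuation polygons, profiles and fibres *)

Definition valuation (R : realType) (k : closedFieldType) (av : k -> R) (x : k) :
    \bar R :=
  if x == 0 then +oo%E else (- ln (av x))%:E.

(** Computed in the coordinates [T - a] and [S - f a]. *)
Definition val_polygon (R : realType) (k : closedFieldType) (av : k -> R)
    (f : nat -> k) (a : k) (lambda : R) : \bar R :=
  ereal_inf [set (valuation av (taylor av f a i) + (i%:R * lambda)%:E)%E
            | i in [set i : nat | (1 <= i)%N]].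

Definition radial (R : realType) (k : closedFieldType) (av : k -> R)
    (f : nat -> k) : Prop :=
  forall a b, kdisc av a -> kdisc av b ->
    forall lambda : R, 0 < lambda ->
      val_polygon av f a lambda = val_polygon av f b lambda.

(** The rational points of a closed disc determine its radius, because the
    value group of [k] is dense. *)
Definition profile (R : realType) (k : closedFieldType) (av : k -> R)
    (f : nat -> k) (a : k) (rho : R) : R :=
  if rho == 0 then 0 else if rho == 1 then 1 else
  xget 0 [set rho' | 0 <= rho' <= 1 /\
    feval av f @` kcdisc av a rho = kcdisc av (feval av f a) rho'].

(** [N] is only relevant on [[0, 1)], where its values are positive. *)
Definition fibre_count (R : realType) (k : closedFieldType) (av : k -> R)
    (f : nat -> k) (N : R -> nat) : Prop :=
  forall rho : R, 0 <= rho < 1 -> (0 < N rho)%N /\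
    forall y, kdisc av y ->
      ([set x | berk_disc av x /\ push f x = zeta av y rho] #= `I_(N rho))%card.

(* Main.v *)
Require Import Defs.
From mathcomp Require Import all_boot all_order all_algebra ring.
From mathcomp Require Import all_classical all_reals all_analysis.
Import Order.TTheory GRing.Theory Num.Theory.
Import numFieldNormedType.Exports.
Local Open Scope classical_set_scope.
Local Open Scope ring_scope.
Set Implicit Arguments.
Unset Strict Implicit.
Unset Printing Implicit Defensive.

(** Radiality is read off from a factorization of the morphism.

    By Weierstrass preparation, a finite morphism [f] of open unit discs has a
    degree [n >= 1] and, over every rational point [y], points [z y i], with
    [i < n], such that [|f - y|] equals [\prod_i |T - z y i|] at every
    Berkovich point of the source ([fibres]).  There is no leading constant:
    the image lies in the unit disc, and the preimage of a smaller disc stays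
    away from the boundary.  Hence the profile of [f] at [a] is
    [p_a(t) = \prod_i max(t, |a - z (f a) i|)], an increasing and piecewise
    monomial function, whose exponent just to the right of [t] is the number of
    points of the fibre of [a] at distance at most [t] from [a].  Taylor
    expansion identifies [p_a] with the valuation polygon ([val_polygonE]),
    and [p_a] computes the images of discs ([feval_image]).

    The points over [zeta y rho] are the [zeta (z y i) t_i] such that
    [t_i] has image [rho] under the profile at [z y i] ([push_eq_zeta]).  Two
    of them coincide when [|z y i - z y j| <= t_i], so that the fibre of
    [zeta y rho] counts the classes of the points [z y i] for this relation
    ([card_fibre]).

    If [f] is radial, the exponents of the profile are the sizes of these
    classes; they depend on [rho] only, and so does the number of classes,
    which is [n] divided by their common size.

    Conversely let the number of classes depend on [rho] only.  By the maximum
    principle there is a fibre, over a generic [y], at whose points the profile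
    is at least the profile at any other point ([generic_fibre]).  Compare it
    with another fibre, going down from the boundary, where every profile is
    [t ^ n].  At the first break point where the two could part, the profiles
    of the other fibre become smaller, hence have larger exponents, hence
    larger classes.  With the same number of classes and the same number [n] of
    points this is impossible ([class_count_step]).

    The same descent shows that [N] determines the profile, once [N 0 = n] is
    known, i.e. once the points [z y i] are distinct.  Here the etale
    hypothesis enters ([etale_fibre_inj]): the dual basis for the trace form
    yields a function of two points which is [1] on the diagonal and [0] at
    pairs of distinct points of a fibre.  By uniform continuity the points of a
    fibre are separated, locally uniformly in the fibre.  Near a double point
    this forces every point to be double, so that the derivative of [f]
    vanishes on a disc, which is impossible in characteristic zero. *)

(** * Ultrametric multiplicative seminorms *)

(** Both the absolute value of the ground field and the points of the
    Berkovich line are of this kind, so that isosceles triangles are treated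
    once for all. *)
Record ultra_mult (R : realType) (A : comNzRingType) (x : A -> R) : Prop := {
  um_ge0 : forall P, 0 <= x P;
  um0 : x 0 = 0;
  um1 : x 1 = 1;
  umM : forall P Q, x (P * Q) = x P * x Q;
  umD : forall P Q, x (P + Q) <= Num.max (x P) (x Q)
}.

Section UltraMult.
Variables (R : realType) (A : comNzRingType) (x : A -> R).
Hypothesis hx : ultra_mult x.

Lemma umN P : x (- P) = x P.
Proof.
have h : x (-1) = 1.
  apply/eqP; rewrite -(@eqrXn2 _ 2%N) ?(um_ge0 hx) //.
  by rewrite expr2 -(umM hx) mulrNN mulr1 (um1 hx) expr1n.
by rewrite -mulN1r (umM hx) h mul1r.
Qed.

Lemma umB P Q : x (P - Q) <= Num.max (x P) (x Q).
Proof. by rewrite -(umN Q); apply: umD. Qed.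

Lemma umBC P Q : x (P - Q) = x (Q - P).
Proof. by rewrite -umN opprB. Qed.

Lemma um_sum_le (I : Type) (r : seq I) (C : pred I) (F : I -> A) M :
  0 <= M -> (forall i, C i -> x (F i) <= M) -> x (\sum_(i <- r | C i) F i) <= M.
Proof.
move=> M0 h; elim/big_ind: _ => [|P Q hP hQ|i /h //]; first by rewrite (um0 hx).
by apply: (le_trans (umD hx _ _)); rewrite ge_max hP hQ.
Qed.

Lemma um_sum_lt (I : Type) (r : seq I) (C : pred I) (F : I -> A) M :
  0 < M -> (forall i, C i -> x (F i) < M) -> x (\sum_(i <- r | C i) F i) < M.
Proof.
move=> M0 h; elim/big_ind: _ => [|P Q hP hQ|i /h //]; first by rewrite (um0 hx).
by apply: (le_lt_trans (umD hx _ _)); rewrite gt_max hP hQ.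
Qed.

Lemma um_prod (I : Type) (r : seq I) (C : pred I) (F : I -> A) :
  x (\prod_(i <- r | C i) F i) = \prod_(i <- r | C i) x (F i).
Proof. by apply: (big_morph x (umM hx) (um1 hx)). Qed.

Lemma umX P n : x (P ^+ n) = x P ^+ n.
Proof. by elim: n => [|n IH]; rewrite ?expr0 ?(um1 hx) // !exprS (umM hx) IH. Qed.

Lemma um_iso P Q : x Q < x P -> x (P + Q) = x P.
Proof.
move=> h; apply/eqP; rewrite eq_le; apply/andP; split.
  by apply: (le_trans (umD hx _ _)); rewrite ge_max lexx ltW.
rewrite leNgt; apply/negP => h2.
have: x P <= Num.max (x (P + Q)) (x Q) by rewrite -{1}(addrK Q P); apply: umB.
by rewrite leNgt gt_max h2 h.
Qed.

Lemma um_isoB P Q : x Q < x P -> x (P - Q) = x P.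
Proof. by move=> h; apply: um_iso; rewrite umN. Qed.

(** The isosceles triangle principle in the form used for approximations: an
    error smaller than the value leaves the value unchanged. *)
Lemma um_close P Q : x (P - Q) < x Q -> x P = x Q.
Proof. by move=> h; rewrite -[in LHS](subrK Q P) addrC um_iso. Qed.

Lemma um_dist P Q : `|x P - x Q| <= x (P - Q).
Proof.
case: (ltgtP (x Q) (x P)) => [lt|lt|->]; last by rewrite subrr normr0 (um_ge0 hx).
- by rewrite (um_isoB lt) gtr0_norm ?subr_gt0 // lerBlDr lerDl (um_ge0 hx).
by rewrite distrC umBC (um_isoB lt) gtr0_norm ?subr_gt0 // lerBlDr lerDl (um_ge0 hx).
Qed.

End UltraMult.

(** * The ground field *)

Section AbsoluteValue.
Variables (R : realType) (k : closedFieldType) (p : nat) (av : k -> R).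
Hypothesis hav : complete_padic_av p av.

Lemma av0 : av 0 = 0. Proof. exact/(av_eq0 hav). Qed.

Lemma av_um : ultra_mult av.
Proof.
split; [exact: av_ge0 hav|exact: av0| |exact: avM hav|exact: av_ultra hav].
have h : av 1 != 0.
  by apply/eqP => /(av_eq0 hav) /eqP; rewrite oner_eq0.
by apply: (mulfI h); rewrite -(avM hav) !mulr1.
Qed.

Lemma av_neq0 a : a != 0 -> 0 < av a.
Proof.
move=> /eqP h; rewrite lt_neqAle (av_ge0 hav) andbT eq_sym.
by apply/eqP => /(av_eq0 hav).
Qed.

Lemma av_gt0 a : (0 < av a) = (a != 0).
Proof. by apply/idP/idP; [apply: contraTneq => ->; rewrite av0 ltxx|apply: av_neq0]. Qed.

Lemma avV a : av a^-1 = (av a)^-1.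
Proof.
have [->|h] := eqVneq a 0; first by rewrite invr0 av0 invr0.
by apply: (mulfI (lt0r_neq0 (av_neq0 h))); rewrite -(avM hav) !divff ?(um1 av_um) // gt_eqF // av_neq0.
Qed.

Lemma av_nat_le1 n : av n%:R <= 1.
Proof.
elim: n => [|n IH]; first by rewrite av0 ler01.
by rewrite mulrSr; apply: (le_trans (umD av_um _ _)); rewrite ge_max IH (um1 av_um) lexx.
Qed.

Hypothesis hp : prime p.

Lemma natr_k_neq0 n : (0 < n)%N -> n%:R != 0 :> k.
Proof.
move=> h; rewrite -av_gt0 (av_padic hav h) invr_gt0 exprn_gt0 ?ltr0n ?prime_gt0 //.
Qed.

Lemma av_p : av p%:R = p%:R^-1.
Proof.
have h : logn p p = 1%N by have := pfactorK 1 hp; rewrite expn1.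
by rewrite (av_padic hav) ?prime_gt0 // h expr1.
Qed.

Lemma av_p_gt0 : 0 < av p%:R. Proof. by rewrite av_gt0 natr_k_neq0 // prime_gt0. Qed.

Lemma av_p_lt1 : av p%:R < 1.
Proof. by rewrite av_p invf_lt1 ?ltr0n ?ltr1n ?prime_gt1 ?prime_gt0. Qed.

End AbsoluteValue.

(** * Gauss norms and points of the Berkovich line *)

Section GaussNorm.
Variables (R : realType) (k : closedFieldType) (p : nat) (av : k -> R).
Hypothesis hav : complete_padic_av p av.
Let hum := av_um hav.

Definition gauss0 (s : R) (P : {poly k}) : R :=
  \big[Num.max/0]_(i < size P) (av P`_i * s ^+ i).

(** In the coordinate [T - a] the sup-norm of the disc of radius [s] is the
    weighted maximum of the coefficients; [zetaE] identifies it with [zeta]. *)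
Definition gauss (a : k) (s : R) (P : {poly k}) : R :=
  gauss0 s (P \Po ('X + a%:P)).

Section Radius.
Variable s : R.
Hypothesis s0 : 0 <= s.

Lemma gauss0_ge0 (P : {poly k}) : 0 <= gauss0 s P.
Proof. exact: bigmax_ge_id. Qed.

Lemma gauss0_coef (P : {poly k}) i : av P`_i * s ^+ i <= gauss0 s P.
Proof.
have [h|h] := ltnP i (size P); first exact: (le_bigmax _ _ (Ordinal h)).
by rewrite nth_default // (av0 hav) mul0r gauss0_ge0.
Qed.

Lemma gauss0_le (P : {poly k}) M : 0 <= M -> (forall i, av P`_i * s ^+ i <= M) -> gauss0 s P <= M.
Proof. by move=> M0 h; apply: bigmax_le. Qed.

Lemma gauss0_lt (P : {poly k}) M : 0 < M -> (forall i, av P`_i * s ^+ i < M) -> gauss0 s P < M.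
Proof. by move=> M0 h; apply: bigmax_lt. Qed.

Lemma gauss0_att (P : {poly k}) : exists i, av P`_i * s ^+ i = gauss0 s P.
Proof.
have h0 i : 0 <= av P`_i * s ^+ i by rewrite mulr_ge0 ?(av_ge0 hav) ?exprn_ge0.
apply: contrapT => h.
have h' i : av P`_i * s ^+ i < gauss0 s P.
  by rewrite lt_neqAle gauss0_coef andbT; apply/eqP => e; apply: h; exists i.
by have := gauss0_lt (le_lt_trans (h0 0%N) (h' 0%N)) h'; rewrite ltxx.
Qed.

Lemma gauss0_att_min (P : {poly k}) : exists2 i, av P`_i * s ^+ i = gauss0 s P &
  forall j, (j < i)%N -> av P`_j * s ^+ j < gauss0 s P.
Proof.
have ex : exists i, av P`_i * s ^+ i == gauss0 s P.
  by have [i h] := gauss0_att P; exists i; apply/eqP.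
case: (ex_minnP ex) => i /eqP h1 h2; exists i => // j ji.
rewrite lt_neqAle gauss0_coef andbT; apply/negP => /h2; by rewrite leqNgt ji.
Qed.

Lemma gauss0D (P Q : {poly k}) : gauss0 s (P + Q) <= Num.max (gauss0 s P) (gauss0 s Q).
Proof.
apply: gauss0_le => [|i]; first by rewrite le_max gauss0_ge0.
rewrite coefD; apply: (@le_trans _ _ (Num.max (av P`_i) (av Q`_i) * s ^+ i)).
  by rewrite ler_wpM2r ?exprn_ge0 // (umD hum).
by rewrite maxr_pMl ?exprn_ge0 // ge_max !le_max !gauss0_coef orbT.
Qed.

Lemma gauss0C c : gauss0 s c%:P = av c.
Proof.
apply/eqP; rewrite eq_le; apply/andP; split; last first.
  by have := gauss0_coef c%:P 0; rewrite coefC eqxx expr0 mulr1.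
apply: gauss0_le => [|i]; first exact: av_ge0 hav _.
rewrite coefC; case: i => [|i] /=; first by rewrite expr0 mulr1.
by rewrite (av0 hav) mul0r (av_ge0 hav).
Qed.

(** Gauss lemma.  Let [i] and [j] be the least indices at which [P] and [Q]
    reach their norms; in the coefficient of index [i + j] of the product the
    term of index [(i, j)] strictly dominates all others. *)
Lemma gauss0M (P Q : {poly k}) : gauss0 s (P * Q) = gauss0 s P * gauss0 s Q.
Proof.
have hle : gauss0 s (P * Q) <= gauss0 s P * gauss0 s Q.
  apply: gauss0_le => [|i]; first by rewrite mulr_ge0 ?gauss0_ge0.
  have [e|ne] := eqVneq (s ^+ i) 0.
    by rewrite e mulr0 mulr_ge0 ?gauss0_ge0.
  have si : 0 < s ^+ i by rewrite lt_neqAle eq_sym ne exprn_ge0.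
  rewrite -ler_pdivlMr // coefM.
  apply: (um_sum_le hum); first by rewrite divr_ge0 ?mulr_ge0 ?gauss0_ge0 ?exprn_ge0.
  move=> j _; rewrite ler_pdivlMr // (umM hum).
  have -> : s ^+ i = s ^+ j * s ^+ (i - j) by rewrite -exprD subnKC // -ltnS.
  by rewrite mulrACA ler_pM ?mulr_ge0 ?(av_ge0 hav) ?exprn_ge0 ?gauss0_coef.
have [e|nP] := eqVneq (gauss0 s P) 0.
  by apply/eqP; rewrite e mul0r eq_le gauss0_ge0 andbT -(mul0r (gauss0 s Q)) -e.
have [e|nQ] := eqVneq (gauss0 s Q) 0.
  by apply/eqP; rewrite e mulr0 eq_le gauss0_ge0 andbT -(mulr0 (gauss0 s P)) -e.
have P0 : 0 < gauss0 s P by rewrite lt_neqAle eq_sym nP gauss0_ge0.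
have Q0 : 0 < gauss0 s Q by rewrite lt_neqAle eq_sym nQ gauss0_ge0.
apply/eqP; rewrite eq_le hle /=.
have [i hi hi'] := gauss0_att_min P.
have [j hj hj'] := gauss0_att_min Q.
apply: (le_trans _ (gauss0_coef (P * Q) (i + j))).
have si : 0 < s ^+ (i + j).
  rewrite lt_neqAle exprn_ge0 // andbT exprD eq_sym mulf_neq0 //.
    by apply: contra_neq nP => e; rewrite -hi e mulr0.
  by apply: contra_neq nQ => e; rewrite -hj e mulr0.
rewrite coefM (bigD1 (inord i : 'I_(i + j).+1)) //= inordK ?ltnS ?leq_addr //.
rewrite addKn.
have lead : av (P`_i * Q`_j) * s ^+ (i + j) = gauss0 s P * gauss0 s Q.
  by rewrite -hi -hj (umM hum) exprD mulrACA.
rewrite (um_iso hum) ?lead // -(ltr_pM2r si) lead -ltr_pdivlMr //.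
apply: (um_sum_lt hum); first by rewrite divr_gt0 ?mulr_gt0.
move=> l hl; rewrite ltr_pdivlMr // (umM hum).
have {hl} nl : (l : nat) <> i.
  by move=> e; case/eqP: hl; apply: val_inj; rewrite /= inordK ?ltnS ?leq_addr.
have -> : s ^+ (i + j) = s ^+ l * s ^+ (i + j - l) by rewrite -exprD subnKC // -ltnS.
rewrite mulrACA.
have h0 (T : {poly k}) m : 0 <= av T`_m * s ^+ m by rewrite mulr_ge0 ?(av_ge0 hav) ?exprn_ge0.
case: (ltngtP l i) => li; last first.
- by case: nl.
- have lj : (i + j - l < j)%N 
    by rewrite -(ltn_add2l l) subnKC ?ltn_add2r // -ltnS.
  apply: (@le_lt_trans _ _ (gauss0 s P * (av Q`_(i + j - l) * s ^+ (i + j - l)))).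
    by rewrite ler_wpM2r ?gauss0_coef.
  by rewrite ltr_pM2l // hj'.
- apply: (@le_lt_trans _ _ ((av P`_l * s ^+ l) * gauss0 s Q)).
    by rewrite ler_wpM2l ?gauss0_coef.
  by rewrite ltr_pM2r // hi'.
Qed.

Lemma gauss0_um : ultra_mult (gauss0 s).
Proof.
split; [exact: gauss0_ge0| | |exact: gauss0M|exact: gauss0D].
  by rewrite -polyC0 gauss0C (av0 hav).
by rewrite -polyC1 gauss0C (um1 hum).
Qed.

Lemma gauss_um a : ultra_mult (gauss a s).
Proof.
have h := gauss0_um; rewrite /gauss; split => [P||| P Q| P Q].
- exact: um_ge0 h _.
- by rewrite comp_poly0 (um0 h).
- by rewrite comp_polyC (um1 h).
- by rewrite comp_polyM (umM h).
- by rewrite comp_polyD; apply: umD.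
Qed.

Lemma gaussC a c : gauss a s c%:P = av c.
Proof. by rewrite /gauss comp_polyC gauss0C. Qed.

Lemma gauss_berk_line a : berk_line av (gauss a s).
Proof.
have h := gauss_um a; split; [exact: um_ge0 h|exact: gaussC|exact: umM h|exact: umD h].
Qed.

Lemma gauss_XsubC a b : gauss a s ('X - b%:P) = Num.max s (av (a - b)).
Proof.
rewrite /gauss comp_polyB comp_polyX comp_polyC -addrA -polyCB.
apply/eqP; rewrite eq_le; apply/andP; split.
  apply: gauss0_le => [|i]; first by rewrite le_max s0.
  rewrite coefD coefX coefC; case: i => [|[|i]] /=.
  - by rewrite add0r expr0 mulr1 le_max lexx orbT.
  - by rewrite addr0 (um1 hum) mul1r expr1 le_max lexx.
  - by rewrite addr0 (av0 hav) mul0r le_max s0.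
have := gauss0_coef ('X + (a - b)%:P) 0; have := gauss0_coef ('X + (a - b)%:P) 1.
rewrite !coefD !coefX !coefC /= addr0 add0r (um1 hum) mul1r expr1 expr0 mulr1.
by move=> h1 h2; rewrite ge_max h1 h2.
Qed.

End Radius.

Lemma gauss0E s P : gauss 0 s P = gauss0 s P.
Proof. by rewrite /gauss addr0 comp_polyXr. Qed.

Lemma gauss_eval a P : gauss a 0 P = av P.[a].
Proof.
have e : (P \Po ('X + a%:P))`_0 = P.[a] by rewrite -horner_coef0 horner_comp !hornerE.
apply/eqP; rewrite eq_le; apply/andP; split.
  apply: gauss0_le => // [|[|i]]; first exact: av_ge0 hav _.
    by rewrite expr0 mulr1 e.
  by rewrite expr0n mulr0 (av_ge0 hav).
by have := gauss0_coef 0 (P \Po ('X + a%:P)) 0; rewrite expr0 mulr1 e.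
Qed.

Lemma berk_um x : berk_line av x -> ultra_mult x.
Proof.
case=> h0 hc hM hD; split => //; first by rewrite -polyC0 hc (av0 hav).
by rewrite -polyC1 hc (um1 hum).
Qed.

Lemma berkC x c : berk_line av x -> x c%:P = av c.
Proof. by case. Qed.

(** The Gauss point is the maximal point of the closed disc: expand [P] in
    powers of [T - a]. *)
Lemma berk_le_gauss x a s P : berk_line av x -> 0 <= s -> x ('X - a%:P) <= s ->
  x P <= gauss a s P.
Proof.
move=> hx s0 h; have hu := berk_um hx.
set Q := P \Po ('X + a%:P).
have -> : P = Q \Po ('X - a%:P).
  by rewrite -comp_polyA comp_polyD comp_polyX comp_polyC subrK comp_polyXr.
rewrite comp_polyE; apply: (um_sum_le hu).
  by rewrite -comp_polyE -comp_polyA comp_polyD comp_polyX comp_polyC ?subrK ?comp_polyXr gauss0_ge0.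
move=> i _; rewrite -mul_polyC (umM hu) (berkC _ hx) (umX hu).
rewrite /gauss -comp_polyE -comp_polyA comp_polyB comp_polyX comp_polyC addrK comp_polyXr.
apply: le_trans (gauss0_coef s Q i).
by rewrite ler_wpM2l ?(av_ge0 hav) // lerXn2r ?nnegrE ?(um_ge0 hu).
Qed.

Lemma zetaE a s : 0 <= s -> zeta av a s = gauss a s.
Proof.
move=> s0; apply/funext => P; rewrite /zeta.
have hg : berk_cdisc av a s (gauss a s).
  split; first exact: gauss_berk_line.
  by rewrite gauss_XsubC // subrr (av0 hav) ge_max lexx s0.
apply/eqP; rewrite eq_le; apply/andP; split.
  apply: ge_sup; first by exists (gauss a s P), (gauss a s).
  by move=> _ [x [hx1 hx2] <-]; apply: berk_le_gauss.
apply: ub_le_sup; last by exists (gauss a s).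
by exists (gauss a s P) => _ [x [hx1 hx2] <-]; apply: berk_le_gauss.
Qed.

Lemma poly_split (P : {poly k}) : exists rs : seq k,
  P = lead_coef P *: \prod_(z <- rs) ('X - z%:P).
Proof. by have [rs ->] := closed_field_poly_normal P; exists rs; rewrite lead_coefZ (monicP (monic_prod_XsubC _ _ _)) mulr1. Qed.

Lemma berk_split x (P : {poly k}) (rs : seq k) c : berk_line av x ->
  P = c *: \prod_(z <- rs) ('X - z%:P) ->
  x P = av c * \prod_(z <- rs) x ('X - z%:P).
Proof.
move=> hx ->; have hu := berk_um hx.
by rewrite -mul_polyC (umM hu) (berkC _ hx) (um_prod hu).
Qed.

(** Polynomials split over [k]. *)
Lemma berk_ext x x' : berk_line av x -> berk_line av x' ->
  (forall b, x ('X - b%:P) = x' ('X - b%:P)) -> x = x'.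
Proof.
move=> hx hx' h; apply/funext => P; have [rs e] := poly_split P.
by rewrite (berk_split hx e) (berk_split hx' e); congr (_ * _); apply: eq_bigr.
Qed.

Lemma berk_subC x b c : berk_line av x ->
  x ('X - b%:P) <= Num.max (x ('X - c%:P)) (av (c - b)).
Proof.
move=> hx; have hu := berk_um hx; rewrite -(berkC _ hx).
apply: le_trans (umD hu _ _).
by rewrite polyCB addrA subrK.
Qed.

Lemma gauss_inj_radius a b (s t : R) : 0 <= s -> 0 <= t -> gauss a s = gauss b t ->
  s = t /\ av (a - b) <= s.
Proof.
move=> s0 t0 e.
have ha := congr1 (fun x => x ('X - a%:P)) e; have hb := congr1 (fun x => x ('X - b%:P)) e.
move: ha hb; rewrite /= !gauss_XsubC // !subrr (av0 hav) !(max_l s0) !(max_l t0).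
move=> ha hb; split; last by rewrite ha (umBC hum) le_max lexx orbT.
have h1 : t <= s by rewrite ha le_max lexx.
have h2 : s <= t by rewrite -hb le_max lexx.
by apply/eqP; rewrite eq_le h1 h2.
Qed.

Lemma gauss_eq a b (s : R) : 0 <= s -> av (a - b) <= s -> gauss a s = gauss b s.
Proof.
move=> s0 h; apply: berk_ext; try exact: gauss_berk_line.
move=> c; rewrite !gauss_XsubC //; apply/eqP; rewrite eq_le !ge_max !le_max !lexx /=.
apply/andP; split.
  have -> : a - c = (a - b) + (b - c) by rewrite addrA subrK.
  by rewrite -le_max; apply: le_trans (umD hum _ _) _; rewrite ge_max !le_max lexx h orbT.
have -> : b - c = (b - a) + (a - c) by rewrite addrA subrK.
by rewrite -le_max; apply: le_trans (umD hum _ _) _; rewrite ge_max !le_max lexx (umBC hum) h orbT.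
Qed.

End GaussNorm.

(** * Weierstrass preparation *)

Lemma cvg_eps (R : realType) (v : nat -> R) (l : R) :
  (v @ \oo --> l) <->
  (forall eps, 0 < eps -> exists N, forall n, (N <= n)%N -> `|v n - l| < eps).
Proof.
split=> [/cvgrPdist_lt h eps /h [N _ hN]|h].
  by exists N => n Nn; rewrite distrC; apply: hN.
apply/cvgrPdist_lt => eps /h [N hN]; exists N => // n /= Nn.
by rewrite distrC; apply: hN.
Qed.

Lemma cvg0_eps (R : realType) (v : nat -> R) : (forall n, 0 <= v n) ->
  (v @ \oo --> (0 : R)) <->
  (forall eps, 0 < eps -> exists N, forall n, (N <= n)%N -> v n < eps).
Proof.
move=> v0; rewrite cvg_eps; split=> h eps /h [N hN]; exists N => n /hN;
  by rewrite subr0 ger0_norm.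
Qed.

Section Weierstrass.
Variables (R : realType) (k : closedFieldType) (p : nat) (av : k -> R).
Hypothesis hav : complete_padic_av p av.
Let hum := av_um hav.

Lemma av_cvgP (u : nat -> k) l : av_cvg av u l <->
  (forall eps, 0 < eps -> exists N, forall n, (N <= n)%N -> av (u n - l) < eps).
Proof. by apply: cvg0_eps => n; apply: av_ge0 hav _. Qed.

Variable s : R.
Hypothesis s0 : 0 < s.
Let sge0 : 0 <= s := ltW s0.
Let g := gauss0 av s.
Let hg : ultra_mult g := gauss0_um hav sge0.

Lemma gauss0_gt0 (P : {poly k}) : P != 0 -> 0 < g P.
Proof.
move=> P0; apply: (@lt_le_trans _ _ (av (lead_coef P) * s ^+ (size P).-1)).
  by rewrite mulr_gt0 ?exprn_gt0 // (av_gt0 hav) lead_coef_eq0.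
exact: (gauss0_coef hav s _ _).
Qed.

Lemma gauss0Z c (P : {poly k}) : g (c *: P) = av c * g P.
Proof. by rewrite -mul_polyC (umM hg) /g (gauss0C hav). Qed.

Lemma gauss0_Xn n : g 'X^n = s ^+ n.
Proof.
rewrite (umX hg) -[in LHS](subr0 'X) -polyC0 /g -gauss0E (gauss_XsubC hav) //.
by rewrite subr0 (av0 hav) max_l.
Qed.

(** The norm condition says that all the roots lie in the closed disc of
    radius [s]. *)
Definition distinguished (Q : {poly k}) := Q \is monic /\ g Q = s ^+ (size Q).-1.

(** Euclidean division does not increase the norm: each step subtracts a
    multiple of [Q] whose norm is that of the leading term of the dividend,
    because the leading term of [Q] is dominant. *)
Lemma gauss0_modp (Q A : {poly k}) : distinguished Q -> g (A %% Q) <= g A.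
Proof.
move=> [Qm gQ]; have Q0 : Q != 0 by apply: monic_neq0.
have [n] := ubnP (size A); elim: n A => // n IH A szA.
have [lt|le] := ltnP (size A) (size Q); first by rewrite modp_small.
have A0 : A != 0.
  by rewrite -size_poly_gt0 (leq_trans _ le) // size_poly_gt0.
pose T := lead_coef A *: 'X^(size A - size Q) * Q.
have szT : size T = size A.
  rewrite /T -scalerAl size_scale ?lead_coef_eq0 // size_monicM ?monicXn //.
  by rewrite size_polyXn addSn /= subnK.
have lT : lead_coef T = lead_coef A.
  by rewrite /T -scalerAl lead_coefZ lead_coefM lead_coefXn (monicP Qm) !mulr1.
have gT : g T <= g A.
  rewrite (umM hg) gauss0Z gauss0_Xn gQ -mulrA -exprD.
  have -> : (size A - size Q + (size Q).-1 = (size A).-1)%N.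
    have := le; have : (0 < size Q)%N by rewrite size_poly_gt0.
    by case: (size Q) => // q _ qA; rewrite subnS /= -subn1 addnBAC ?subn_gt0 // subnK ?subn1 // ltnW.
  exact: (gauss0_coef hav s _ _).
have -> : A %% Q = (A - T) %% Q by rewrite modpD modpN /T modp_mull oppr0 addr0.
apply: le_trans (_ : g (A - T) <= _); last first.
  by apply: le_trans (umB hg _ _) _; rewrite ge_max lexx gT.
apply: IH; rewrite ltnS in szA; apply: leq_trans szA.
have szA0 : (0 < size A)%N by rewrite size_poly_gt0.
rewrite -(prednK szA0) ltnS; apply/leq_sizeP => j.
rewrite leq_eqVlt => /orP[/eqP <-|].
  by rewrite coefB -[X in _ - T`_(X.-1)]szT -/(lead_coef T) lT subrr.
rewrite (prednK szA0) => lj; rewrite coefB !nth_default ?subr0 // ?szT //.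
Qed.

(** Such polynomials have absolute value [1] at every point of the closed
    disc of radius [s]. *)
Definition unit_like (V : {poly k}) := g (V - 1) < 1.

Lemma unit_like_norm V : unit_like V -> g V = 1.
Proof. by move=> h; rewrite -(um1 hg); apply: (um_close hg); rewrite (um1 hg). Qed.

(** Modulo [Q], the factor [V] only causes a perturbation smaller than [C W]. *)
Lemma gauss0_modp_unit C (W V Q : {poly k}) : distinguished Q ->
  (size W < size Q)%N -> unit_like V -> g ((C *: W * V) %% Q) = av C * g W.
Proof.
move=> hQ szW hV.
have [->|W0] := eqVneq W 0.
  by rewrite scaler0 mul0r mod0p (um0 hg) mulr0.
have [->|C0] := eqVneq C 0.
  by rewrite scale0r mul0r mod0p (um0 hg) (av0 hav) mul0r.
have -> : C *: W * V = C *: W + C *: W * (V - 1) by rewrite mulrBr mulr1 addrC subrK.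
rewrite modpD (modp_small (p := C *: W)) ?size_scale //.
rewrite (um_iso hg) ?gauss0Z //.
apply: le_lt_trans (gauss0_modp _ hQ) _.
rewrite (umM hg) gauss0Z -[X in _ < X]mulr1 ltr_pM2l //.
by rewrite mulr_gt0 ?(av_gt0 hav) ?gauss0_gt0.
Qed.

Section Approx.
Variables (C C' : k) (Q Q' V V' : {poly k}).
Hypotheses (hQ : distinguished Q)
  (hQ' : distinguished Q') (hV : unit_like V) (hV' : unit_like V').
Let A := C *: Q * V.
Let A' := C' *: Q' * V'.
Hypothesis hlt : g (A - A') < g A.

Let gA : g A = av C * g Q.
Proof. by rewrite (umM hg) gauss0Z (unit_like_norm hV) mulr1. Qed.

(** If [Q'] had larger degree than [Q], reducing [A] modulo [Q'] would keep its
    norm, whereas [A] is close to [A'], a multiple of [Q']. *)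
Lemma approx_size_aux : (size Q' <= size Q)%N.
Proof.
rewrite leqNgt; apply/negP => lt.
have := gauss0_modp_unit C hQ' lt hV.
have -> : (C *: Q * V) %% Q' = (A - A') %% Q'.
  by rewrite modpD modpN /A' -(scalerAl C') (mulrC Q') scalerAl modp_mull oppr0 addr0.
rewrite -gA => e; have := gauss0_modp (A - A') hQ'; rewrite e => h.
by have := le_lt_trans h hlt; rewrite ltxx.
Qed.

Lemma approx_dist : size Q = size Q' -> av C * g (Q - Q') <= g (A - A').
Proof.
move=> sz; have [Qm _] := hQ; have [Qm' _] := hQ'.
have szp : (0 < size Q)%N by rewrite size_poly_gt0 monic_neq0.
have lt : (size (Q - Q')%R < size Q')%N.
  rewrite -sz -(prednK szp) ltnS; apply/leq_sizeP => j.
  rewrite leq_eqVlt => /orP[/eqP <-|].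
    by rewrite coefB -/(lead_coef Q) sz -/(lead_coef Q') (monicP Qm) (monicP Qm') subrr.
  by rewrite (prednK szp) => lj; rewrite coefB !nth_default ?subr0 // -sz.
rewrite -(gauss0_modp_unit C hQ' lt hV).
apply: le_trans (gauss0_modp (A - A') hQ').
rewrite le_eqVlt; apply/orP; left; apply/eqP; congr (g _).
rewrite modpD modpN /A' -(scalerAl C') (mulrC Q') scalerAl modp_mull oppr0 addr0.
rewrite scalerBr mulrBl modpD modpN -(scalerAl _ Q') (mulrC Q') scalerAl modp_mull.
by rewrite oppr0 addr0.
Qed.

End Approx.

(** Continuity of the roots, in the form needed to pass to the limit: the
    factor carrying the roots in the closed disc depends continuously on the
    polynomial. *)
Lemma approx (C C' : k) (Q Q' V V' : {poly k}) :
  distinguished Q -> distinguished Q' ->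
  unit_like V -> unit_like V' ->
  g (C *: Q * V - C' *: Q' * V') < g (C *: Q * V) ->
  [/\ size Q = size Q', av C = av C' &
      av C * g (Q - Q') <= g (C *: Q * V - C' *: Q' * V')].
Proof.
move=> hQ hQ' hV hV' hlt.
have e : g (C' *: Q' * V') = g (C *: Q * V).
  by apply: (um_close hg); rewrite (umBC hg).
have sz : size Q = size Q'.
  apply/eqP; rewrite eqn_leq (approx_size_aux hQ' hV hlt) andbT.
  by apply: (@approx_size_aux C' C Q' Q V' V hQ hV'); rewrite (umBC hg) e; exact: hlt.
split=> //; last exact: approx_dist.
move: e; rewrite !(umM hg) !gauss0Z (unit_like_norm hV) (unit_like_norm hV') !mulr1 hQ.2 hQ'.2 sz.
by move/mulIf => -> //; rewrite expf_neq0 // gt_eqF.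
Qed.

Lemma unit_like_prod (rs : seq k) : (forall z, z \in rs -> s < av z) ->
  unit_like (\prod_(z <- rs) (1 - z^-1 *: 'X)).
Proof.
elim: rs => [|z rs IH] h; rewrite /unit_like ?big_nil ?subrr ?(um0 hg) ?ltr01 //.
rewrite big_cons; set V := \prod_(j <- rs) _.
have hV : unit_like V by apply: IH => y yrs; apply: h; rewrite inE yrs orbT.
have -> : (1 - z^-1 *: 'X) * V - 1 = (V - 1) - (z^-1 *: 'X) * V.
  by rewrite mulrBl mul1r addrAC.
apply: le_lt_trans (umB hg _ _) _; rewrite gt_max; apply/andP; split; first exact: hV.
have hz : s < av z by apply: h; rewrite mem_head.
rewrite (umM hg) (unit_like_norm hV) mulr1 gauss0Z -['X]expr1 gauss0_Xn expr1 (avV hav).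
by rewrite mulrC ltr_pdivrMr ?mul1r // (lt_trans s0).
Qed.

Lemma distinguished_prod (rs : seq k) : (forall z, z \in rs -> av z <= s) ->
  distinguished (\prod_(z <- rs) ('X - z%:P)).
Proof.
move=> h; split; first exact: monic_prod_XsubC.
rewrite size_prod_XsubC /= (um_prod hg) (eq_big_seq (fun _ => s)) => [|z /h zs].
  by rewrite big_const_seq count_predT iter_mulr mulr1.
by rewrite /g -gauss0E (gauss_XsubC hav) // sub0r (umN hum) max_l.
Qed.

(** [Q] collects the roots in the closed disc of radius [s]; a root [z] outside
    contributes [- z * (1 - T / z)]. *)
Lemma small_roots (P : {poly k}) : P != 0 -> exists C Q V,
  [/\ C != 0, distinguished Q, unit_like V & P = C *: Q * V].
Proof.
move=> P0; have [rs e] := poly_split P.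
pose small := [seq z <- rs | av z <= s]; pose large := [seq z <- rs | ~~ (av z <= s)].
exists (lead_coef P * \prod_(z <- large) (- z)).
exists (\prod_(z <- small) ('X - z%:P)), (\prod_(z <- large) (1 - z^-1 *: 'X)).
have large0 z : z \in large -> s < av z by rewrite mem_filter -ltNge => /andP[].
have large_neq0 z : z \in large -> z != 0.
  by move=> /large0 h; rewrite -(av_gt0 hav) (lt_trans s0).
split.
- rewrite mulf_neq0 ?lead_coef_eq0 // prodf_seq_neq0; apply/allP => z /large_neq0.
  by rewrite oppr_eq0.
- by apply: distinguished_prod => z; rewrite mem_filter => /andP[].
- exact: unit_like_prod.
rewrite {1}e (bigID (fun z => av z <= s)) /= -big_filter -/small -[X in _ * X]big_filter -/large.
rewrite -scalerA -scalerAl; congr (_ *: _).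
rewrite -scalerAl scalerAr; congr (_ * _).
rewrite -mul_polyC rmorph_prod /= -big_split /=; apply: eq_big_seq => z /large_neq0 z0.
by rewrite mul_polyC scalerBr scalerA mulNr divff // scaleN1r opprK alg_polyC polyCN addrC.
Qed.

Lemma poly_limit (Q : nat -> {poly k}) (N : nat) :
  (forall m, size (Q m) <= N)%N ->
  (forall eps, 0 < eps -> exists M, forall m n, (M <= m)%N -> (M <= n)%N ->
     g (Q m - Q n) < eps) ->
  exists L : {poly k}, (size L <= N)%N /\
   forall eps, 0 < eps -> exists M, forall m, (M <= m)%N -> g (Q m - L) < eps.
Proof.
move=> szQ cQ.
have /choice[l hl] : forall i, exists l, av_cvg av (fun m => (Q m)`_i) l.
  move=> i; apply: (av_complete hav) => eps eps0.
  have si : 0 < s ^+ i by rewrite exprn_gt0.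
  have [M hM] := cQ (eps * s ^+ i) (mulr_gt0 eps0 si).
  exists M => m n Mm Mn; rewrite -(ltr_pM2r si).
  by apply: le_lt_trans (hM m n Mm Mn); rewrite -coefB; apply: (gauss0_coef hav).
exists (\poly_(i < N) l i); split; first exact: size_poly.
move=> eps eps0; have e20 : 0 < eps / 2 by rewrite divr_gt0.
have e2 : eps / 2 < eps by rewrite ltr_pdivrMr // ltr_pMr // ltr1n.
have [M hM] := cQ _ e20; exists M => m Mm.
apply: le_lt_trans e2; apply: gauss0_le => [|i]; first exact: ltW.
rewrite coefB coef_poly; have [iN|Ni] := ltnP i N; last first.
  by rewrite nth_default ?(leq_trans (szQ m)) // subr0 (av0 hav) mul0r ltW.
have si : 0 < s ^+ i by rewrite exprn_gt0.
have [M' hM'] := (av_cvgP _ _).1 (hl i) _ (divr_gt0 e20 si).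
pose n := maxn M M'.
have -> : (Q m)`_i - l i = ((Q m)`_i - (Q n)`_i) + ((Q n)`_i - l i).
  by rewrite addrA subrK.
apply: le_trans (ler_wpM2r (ltW si) (umD hum _ _)) _.
rewrite maxr_pMl ?(ltW si) // ge_max; apply/andP; split.
  rewrite -coefB; apply: le_trans (gauss0_coef hav _ _ _) (ltW _).
  by apply: hM => //; rewrite leq_maxl.
by rewrite -ler_pdivlMr // ltW // hM' // leq_maxr.
Qed.

Lemma prod_max_le (I : eqType) (F : I -> R) (rs : seq I) :
  (forall z, z \in rs -> 0 <= F z) ->
  \prod_(z <- rs) Num.max s (F z) = s ^+ size rs -> forall z, z \in rs -> F z <= s.
Proof.
elim: rs => // a rs IH F0; rewrite big_cons /= exprS => e.
have F0' z : z \in rs -> 0 <= F z by move=> zrs; apply: F0; rewrite inE zrs orbT.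
have ge : s ^+ size rs <= \prod_(z <- rs) Num.max s (F z).
  have -> : s ^+ size rs = \prod_(z <- rs) s.
    by rewrite big_const_seq count_predT iter_mulr mulr1.
  by apply: ler_prod => i _; rewrite sge0 le_max lexx.
have sn : 0 < s ^+ size rs by rewrite exprn_gt0.
have Fa : F a <= s.
  rewrite leNgt; apply/negP => lt; move: e; apply/eqP; rewrite gt_eqF //.
  apply: (@lt_le_trans _ _ (F a * s ^+ size rs)); first by rewrite ltr_pM2r.
  by apply: ler_pM; rewrite ?F0 ?mem_head ?(ltW sn) ?le_max ?lexx ?orbT.
move=> z; rewrite inE => /orP[/eqP -> //|]; apply: IH => //.
by move: e; rewrite max_l // => /mulfI; apply; rewrite gt_eqF.
Qed.

Lemma partial_cauchy (h : nat -> k) :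
  (fun i => av (h i) * s ^+ i) @ \oo --> (0 : R) ->
  forall eps, 0 < eps -> exists M, forall m n, (M <= m)%N -> (M <= n)%N ->
    g (\poly_(i < m) h i - \poly_(i < n) h i) < eps.
Proof.
move=> hcvg eps eps0.
have h0 i : 0 <= av (h i) * s ^+ i by rewrite mulr_ge0 ?(av_ge0 hav) ?exprn_ge0.
have [M hM] := (cvg0_eps h0).1 hcvg _ eps0.
exists M => m n Mm Mn; apply: gauss0_lt => // i.
rewrite coefB !coef_poly; case: (leqP M i) => Mi.
  case: ifP => _; case: ifP => _; rewrite ?subrr ?subr0 ?sub0r ?(umN hum);
    by rewrite ?hM // (av0 hav) mul0r.
by rewrite !(leq_trans Mi) // subrr (av0 hav) mul0r.
Qed.

(** Split off from the partial sums the factors with roots in the closed disc.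
    By [approx] they eventually have the same degree and form a Cauchy
    sequence; the limit is a polynomial, which splits because [k] is
    algebraically closed.  Its roots are the zeros of the series. *)
Theorem weierstrass (h : nat -> k) :
  (fun i => av (h i) * s ^+ i) @ \oo --> (0 : R) -> (exists i, h i != 0) ->
  exists c (rs : seq k), [/\ 0 < c, forall z, z \in rs -> av z <= s &
    forall x, berk_cdisc av 0 s x ->
      (fun m => x (\poly_(i < m) h i)) @ \oo -->
      (c * \prod_(z <- rs) x ('X - z%:P) : R)].
Proof.
move=> hcvg [i0 hi0]; pose P m := \poly_(i < m) h i.
(* [M0] bounds the norms of the partial sums below, so that two of them are
   close relative to their size *)
have PC := partial_cauchy hcvg.
pose M0 := av (h i0) * s ^+ i0.
have M00 : 0 < M0 by rewrite mulr_gt0 ?exprn_gt0 // (av_gt0 hav).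
have Pge m : (i0 < m)%N -> M0 <= g (P m).
  move=> im; apply: le_trans (gauss0_coef hav s (P m) i0).
  by rewrite coef_poly im.
have [M1 hM1] := PC _ M00; pose m0 := maxn i0.+1 M1.
have P0 m : P (m0 + m)%N != 0.
  apply/eqP => e; suff /Pge : (i0 < m0 + m)%N by rewrite e (um0 hg) leNgt M00.
  by rewrite (leq_trans (leq_maxl i0.+1 M1)) // leq_addr.
have /choice[D hD] : forall m, exists D : k * {poly k} * {poly k},
    [/\ D.1.1 != 0, distinguished D.1.2, unit_like D.2 &
        P (m0 + m)%N = D.1.1 *: D.1.2 * D.2].
  by move=> m; have [C [Q [V hD]]] := small_roots (P0 m); exists (C, Q, V).
pose Q m := (D m).1.2; pose c := av (D 0%N).1.1.
have le0 m : (i0 < m0 + m)%N.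
  by rewrite (leq_trans (leq_maxl i0.+1 M1)) // leq_addr.
have le1 m : (M1 <= m0 + m)%N.
  by rewrite (leq_trans (leq_maxr i0.+1 M1)) // leq_addr.
have cmp m n : [/\ size (Q m) = size (Q n), av (D m).1.1 = av (D n).1.1 &
    av (D m).1.1 * g (Q m - Q n) <= g (P (m0 + m)%N - P (m0 + n)%N)].
  have [Cm Qm Vm em] := hD m; have [Cn Qn Vn en] := hD n.
  rewrite em en; apply: approx => //.
  by rewrite -em -en (lt_le_trans (hM1 _ _ _ _)) // Pge.
have cE m : av (D m).1.1 = c by have [] := cmp m 0%N.
have c0 : 0 < c by rewrite (av_gt0 hav); case: (hD 0%N).
pose N := size (Q 0%N).
have szQ m : size (Q m) = N by have [] := cmp m 0%N.
have QC eps : 0 < eps -> exists M, forall m n, (M <= m)%N -> (M <= n)%N ->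
    g (Q m - Q n) < eps.
  move=> eps0; have [M hM] := PC _ (mulr_gt0 c0 eps0); exists M => m n Mm Mn.
  have [_ _] := cmp m n; rewrite cE => le.
  rewrite -(ltr_pM2l c0); apply: le_lt_trans le _.
  by apply: hM; rewrite (leq_trans _ (leq_addl _ _)).
have [|L [szL hL]] := @poly_limit Q N _ QC; first by move=> m; rewrite szQ.
have gQ m : g (Q m) = s ^+ N.-1 by have [_ [_ ->]] := hD m; rewrite -/(Q m) szQ.
(* a norm equal to the power of [s] forces the roots into the disc *)
have gL : g L = s ^+ N.-1.
  have [M hM] := hL _ (exprn_gt0 N.-1 s0); have := hM M (leqnn M).
  by rewrite -(gQ M) (umBC hg) => /(um_close hg).
have N0 : (0 < N)%N.
  have [_ [mon _] _ _] := hD 0%N; rewrite /N size_poly_gt0; exact: monic_neq0.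
have lL : lead_coef L = 1 /\ size L = N.
  have lN : L`_N.-1 = 1.
    apply/eqP; rewrite -subr_eq0 -[_ == 0]negbK -(av_gt0 hav); apply/negP => lt.
    have si : 0 < s ^+ N.-1 by rewrite exprn_gt0.
    have [M hM] := hL _ (mulr_gt0 lt si); have := hM M (leqnn M).
    rewrite ltNge => /negP; apply; apply: le_trans (gauss0_coef hav s _ N.-1).
    rewrite coefB; have [_ [/monicP mon _] _ _] := hD M.
    by move: mon; rewrite /lead_coef -/(Q M) szQ => ->; rewrite (umBC hum).
  suff e : size L = N by rewrite /lead_coef e lN.
  apply/eqP; rewrite eqn_leq szL -(prednK N0) ltnNge; apply/negP => hsz.
  by move: lN; rewrite nth_default // => /esym/eqP; rewrite oner_eq0.
have [rs eL] := poly_split L; rewrite lL.1 scale1r in eL.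
have szrs : size rs = N.-1 by rewrite -lL.2 eL size_prod_XsubC.
exists c, rs; split=> //.
  apply: prod_max_le => [z _|]; first exact: av_ge0 hav _.
  rewrite szrs -gL eL (um_prod hg); apply: eq_bigr => z _.
  by rewrite /g -gauss0E (gauss_XsubC hav) // sub0r (umN hum).
move=> x [xl xs]; have hx := berk_um hav xl.
rewrite -(um_prod hx) -eL; apply/cvg_eps => eps eps0.
have [M hM] := hL _ (divr_gt0 eps0 c0).
have xg T : x T <= g T by rewrite /g -gauss0E; apply: (berk_le_gauss hav).
exists (m0 + M)%N => m hm.
have [n mE] : exists n, m = (m0 + n)%N.
  by exists (m - m0)%N; rewrite subnKC // (leq_trans _ hm) // leq_addr.
have Mn : (M <= n)%N by rewrite -(leq_add2l m0) -mE.
rewrite -/(P m).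
have [_ _ Vn ->] : [/\ (D n).1.1 != 0, distinguished (Q n), unit_like (D n).2 &
  P m = (D n).1.1 *: (D n).1.2 * (D n).2] by rewrite mE; apply: hD.
rewrite (umM hx) -mul_polyC (umM hx) (berkC _ xl) cE.
rewrite (_ : x (D n).2 = 1) ?mulr1; last first.
  by rewrite -(um1 hx); apply: (um_close hx); rewrite (um1 hx); apply: le_lt_trans (xg _) Vn.
rewrite -mulrBr normrM (gtr0_norm c0) mulrC -ltr_pdivlMr //.
by apply: le_lt_trans (um_dist hx _ _) _; apply: le_lt_trans (xg _) (hM n Mn).
Qed.

End Weierstrass.

(** * Piecewise monomial functions *)

Section MaxProd.
Variable R : realType.
Implicit Types (cs : seq R) (t u C : R).

Definition maxprod cs t : R := \prod_(c <- cs) Num.max t c.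
(** Together with [ncount] it describes [maxprod] as a monomial on an interval
    without break points, see [maxprod_gap]. *)
Definition tailprod cs t : R := \prod_(c <- cs | t < c) c.
Definition ncount cs t : nat := count (fun c => c <= t) cs.
Definition gap cs t u := forall c, c \in cs -> c <= t \/ u <= c.

Lemma tailprod_gt0 cs t : 0 <= t -> 0 < tailprod cs t.
Proof. by move=> t0; apply: prodr_gt0 => c /(le_lt_trans t0). Qed.

Lemma maxprod_gap cs t u v : gap cs t u -> t <= v -> v <= u ->
  maxprod cs v = tailprod cs t * v ^+ ncount cs t.
Proof.
move=> + tv vu; rewrite /maxprod /tailprod /ncount.
elim: cs => [|c cs IH] h; first by rewrite !big_nil mul1r expr0.
rewrite !big_cons /= IH => [|d hd]; last by apply: h; rewrite inE hd orbT.
have [tc|ct] := ltP t c.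
  rewrite add0n mulrA max_r //.
  by have [|uc] := h c (mem_head _ _); [rewrite leNgt tc|apply: le_trans vu uc].
by rewrite add1n exprS mulrCA max_l // (le_trans ct).
Qed.

(** The last clause makes the induction of [break_point_ind] progress. *)
Lemma next_break cs t v : t < v ->
  exists u, [/\ t < u <= v, gap cs t u & u = v \/ u \in cs].
Proof.
elim: cs v => [|c cs IH] v tv; first by exists v; rewrite ?tv ?lexx; split=> //; left.
have [u [/andP[tu uv] hu hv]] := IH v tv.
have [ct|tc] := leP c t.
  exists u; rewrite tu; split=> // [d|].
    by rewrite inE => /orP[/eqP ->|/hu //]; left.
  by case: hv => [|h]; [left|right; rewrite inE h orbT].
exists (Num.min u c); split; first by rewrite lt_min tu tc ge_min uv.
  move=> d; rewrite inE => /orP[/eqP ->|/hu [h|h]]; [right|left|right] => //.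
    by rewrite ge_min lexx orbT.
  by rewrite ge_min h.
case: leP => _; last by right; rewrite mem_head.
by case: hv => [|h]; [left|right; rewrite inE h orbT].
Qed.

Lemma gap_exists cs t v : t < v -> exists2 u, t < u <= v & gap cs t u.
Proof. by move=> tv; have [u [h1 h2 _]] := next_break cs tv; exists u. Qed.

(** Downward induction along the finitely many break points: the number of
    those above the current radius increases at each step. *)
Lemma break_point_ind cs (Q : R -> Prop) u0 v : Q v ->
  (forall t s, u0 <= t -> t < s -> s <= v -> gap cs t s -> Q s -> Q t) ->
  forall u, u0 <= u -> u <= v -> Q u.
Proof.
move=> Qv step u; have [m] := ubnP (count (fun c => u < c) cs).
elim: m u => // m IH u hm u0u; rewrite le_eqVlt => /orP[/eqP -> //|uv].
have [s [/andP[us sv] hg hs]] := next_break cs uv.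
apply: (step u s) => //; case: hs => [-> //|scs].
apply: IH => //; last exact: le_trans u0u (ltW us).
rewrite ltnS in hm; apply: leq_trans hm.
have -> : count (fun c => s < c) cs = count (fun c => (u < c) && (s < c)) cs.
  by apply: eq_count => c /=; case: (ltP s c) => h; rewrite ?andbF // (lt_trans us).
elim: cs scs {hg step} => //= c cs IH; rewrite inE => /orP[/eqP <-|/IH h].
  rewrite us ltxx /= add0n add1n ltnS.
  by apply: sub_count => d /= /andP[].
rewrite -addnS leq_add //; by case: (u < c); case: (s < c).
Qed.

(** The exponent to the right of [t] is determined by the function: two
    monomials agreeing at two points have the same exponent. *)
Lemma ncount_eq cs cs' C C' t v : 0 <= t -> t < v -> 0 < C -> 0 < C' ->
  (forall u, t <= u <= v -> C * maxprod cs u = C' * maxprod cs' u) ->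
  ncount cs t = ncount cs' t.
Proof.
move=> t0 tv C0 C'0 h.
have [u1 /andP[tu1 u1v] g1] := gap_exists cs tv.
have [u /andP[tu uu1] g2] := gap_exists cs' tu1.
pose w := (t + u) / 2.
have tw : t < w by rewrite midf_lt.
have wu : w < u by rewrite midf_lt.
have uv : u <= v := le_trans uu1 u1v.
have g1' : gap cs t u by move=> c /g1[]; [left|right; apply: le_trans uu1 _].
have w0 : 0 < w := le_lt_trans t0 tw.
have e x : t <= x -> x <= u -> C * tailprod cs t * x ^+ ncount cs t =
    C' * tailprod cs' t * x ^+ ncount cs' t.
  move=> tx xu; have := h x; rewrite tx (le_trans xu) // => /(_ isT).
  by rewrite (maxprod_gap g1' tx xu) (maxprod_gap g2 tx xu) !mulrA.
have K0 : 0 < C * tailprod cs t by rewrite mulr_gt0 ?tailprod_gt0.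
have K0' : 0 < C' * tailprod cs' t by rewrite mulr_gt0 ?tailprod_gt0.
have eu := e u (ltW tu) (lexx u); have ew := e w (ltW tw) (ltW wu).
clearbody w.
have [q0 q1] : 0 < u / w /\ u / w != 1.
  split; first by rewrite divr_gt0 // (lt_trans w0).
  by rewrite gt_eqF // ltr_pdivlMr // mul1r.
apply: (ieexprIn q0 q1) => /=; rewrite !expr_div_n.
move: eu ew; set K := C * tailprod cs t; set K' := C' * tailprod cs' t => eu ew.
apply/eqP; rewrite eqr_div ?expf_neq0 ?(gt_eqF w0) //; apply/eqP.
apply: (mulfI (mulf_neq0 (lt0r_neq0 K0) (lt0r_neq0 K0'))).
by rewrite mulrACA eu -ew mulrACA (mulrC (C' * _)).
Qed.

Lemma maxprod_ge0 cs t : 0 <= t -> 0 <= maxprod cs t.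
Proof. by move=> t0; apply: prodr_ge0 => c _; rewrite le_max t0. Qed.

Lemma pow_near1 (n : nat) (t s : R) : 0 <= s -> t < 1 -> s < 1 ->
  exists2 u, s < u < 1 & t < u ^+ n.
Proof.
move=> s0.
wlog t0 : t / 0 <= t => [H t1 s1|].
  have [|||u su tu] := H (Num.max t 0); rewrite ?le_max ?lexx ?orbT ?gt_max ?t1 ?ltr01 //.
  by exists u => //; apply: le_lt_trans tu; rewrite le_max lexx.
elim: n t t0 => [|n IH] t t0 t1 s1.
  by exists ((s + 1) / 2); rewrite ?midf_lt.
pose t' := (t + 1) / 2; have tt' : t < t' by rewrite midf_lt.
have t'1 : t' < 1 by rewrite midf_lt.
have t'0 : 0 < t' := le_lt_trans t0 tt'.
have [u /andP[su u1] tu] := IH t' (ltW t'0) t'1 s1.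
have tq : t / t' < 1 by rewrite ltr_pdivrMr // mul1r.
pose v := Num.max u ((t / t' + 1) / 2).
have uv : u <= v by rewrite le_max lexx.
have tv : t / t' < v by rewrite lt_max midf_lt // orbT.
exists v; first by rewrite (lt_le_trans su) //= gt_max u1 midf_lt.
have u0 : 0 <= u := ltW (le_lt_trans s0 su).
have t'v : t' < v ^+ n.
  by apply: lt_le_trans tu _; rewrite lerXn2r // nnegrE (le_trans u0).
rewrite exprS -(divfK (lt0r_neq0 t'0) t).
by apply: ltr_pM => //; [apply: divr_ge0 => //; apply: ltW|apply: ltW].
Qed.

Lemma maxprod_continuous cs : continuous (maxprod cs).
Proof.
elim: cs => [|c cs IH] x.
  rewrite (_ : maxprod [::] = fun => 1); first exact: cvg_cst.
  by apply/funext => t; rewrite /maxprod big_nil.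
rewrite (_ : maxprod (c :: cs) = (fun t => Num.max t c) \* maxprod cs); last first.
  by apply/funext => t; rewrite /maxprod big_cons.
apply: continuousM; last exact: IH.
by apply: continuous_max; [exact: cvg_id|exact: cvg_cst].
Qed.

Lemma maxprod_le1 cs t : (forall c, c \in cs -> 0 <= c <= 1) -> 0 <= t <= 1 ->
  0 <= maxprod cs t <= 1.
Proof.
move=> hc /andP[t0 t1]; rewrite maxprod_ge0 //= /maxprod.
elim: cs hc => [|c cs IH] hc; first by rewrite big_nil.
have hc' d : d \in cs -> 0 <= d <= 1 by move=> h; apply: hc; rewrite inE h orbT.
have /andP[_ c1] := hc c (mem_head _ _).
rewrite big_cons; apply: mulr_ile1; rewrite ?le_max ?t0 ?maxprod_ge0 ?ge_max ?t1 ?IH //.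
Qed.

Lemma maxprod_mono cs t u : 0 <= t -> t <= u -> maxprod cs t <= maxprod cs u.
Proof.
move=> t0 tu; apply: ler_prod => c _; rewrite le_max t0 /=.
by rewrite ge_max !le_max tu lexx orbT.
Qed.

Lemma maxprod_gt0 cs t : 0 < t -> 0 < maxprod cs t.
Proof. by move=> t0; apply: prodr_gt0 => c _; rewrite lt_max t0. Qed.

End MaxProd.

(** * Power series at the points of the disc *)

Section Morphism.
Variables (R : realType) (k : closedFieldType) (p : nat) (av : k -> R).
Hypothesis hav : complete_padic_av p av.
Let hum := av_um hav.

Definition partial (f : nat -> k) (n : nat) : {poly k} := \poly_(i < n) f i.

Lemma push_XsubC f (x : {poly k} -> R) y :
  push f x ('X - y%:P) = lim ((fun n => x (partial f n - y%:P)) @ \oo).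
Proof.
rewrite /push; congr (lim (_ @ \oo)); apply/funext => n.
by rewrite comp_polyB comp_polyX comp_polyC.
Qed.

Lemma partial_subC f y n : (0 < n)%N ->
  partial f n - y%:P = partial (fun i => if i == 0%N then f 0%N - y else f i) n.
Proof.
move=> n0; apply/polyP => i; rewrite coefB coefC !coef_poly.
by case: i => [|i] /=; rewrite ?n0 // subr0.
Qed.

Section Source.
Variable f : nat -> k.
Hypothesis hf : disc_fun av f.
Hypothesis nonconst : exists2 i, (0 < i)%N & f i != 0.

Lemma push_factor_cdisc y (s : R) : 0 < s < 1 -> exists (c : R) (rs : seq k),
  [/\ 0 < c, forall z, z \in rs -> av z <= s &
   forall x, berk_cdisc av 0 s x ->
    ((fun n => x (partial f n - y%:P)) @ \oo --> push f x ('X - y%:P)) /\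
    push f x ('X - y%:P) = c * \prod_(z <- rs) x ('X - z%:P)].
Proof.
move=> s01; pose h i := if i == 0%N then f 0%N - y else f i.
have [s0 _] := andP s01.
have h0 i : 0 <= av (h i) * s ^+ i.
  by rewrite mulr_ge0 ?(av_ge0 hav) // exprn_ge0 // ltW.
have hc : (fun i => av (h i) * s ^+ i) @ \oo --> (0 : R).
  apply/(cvg0_eps h0) => eps eps0.
  have f0 i : 0 <= av (f i) * s ^+ i.
    by rewrite mulr_ge0 ?(av_ge0 hav) // exprn_ge0 // ltW.
  have [N hN] := (cvg0_eps f0).1 (hf s01) _ eps0.
  by exists N.+1 => -[|n] // Nn; apply: hN; apply: ltnW.
have hn : exists i, h i != 0 by have [[//|i] _ fi] := nonconst; exists i.+1.
have [c [rs [c0 hrs hx]]] := weierstrass hav s0 hc hn.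
exists c, rs; split=> // x xs; have := hx x xs; set l := c * _ => hl.
have hl' : (fun n => x (partial f n - y%:P)) @ \oo --> l.
  apply/cvg_eps => eps eps0; have [N hN] := (cvg_eps _ _).1 hl _ eps0.
  by exists N.+1 => -[|n] // Nn; rewrite partial_subC //; apply: hN; apply: ltnW.
have e : push f x ('X - y%:P) = l by rewrite push_XsubC; apply: cvg_lim.
by rewrite e.
Qed.

Lemma berk_discP x : berk_disc av x -> exists2 s : R, 0 < s < 1 & berk_cdisc av 0 s x.
Proof.
move=> [xl x1]; exists ((x 'X + 1) / 2); last first.
  by split=> //; rewrite subr0 midf_le // ltW.
have x0 : 0 <= x 'X by apply: (um_ge0 (berk_um hav xl)).
by rewrite divr_gt0 ?ltr_wpDl //= midf_lt.
Qed.

Lemma push_cvg x y : berk_disc av x ->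
  (fun n => x (partial f n - y%:P)) @ \oo --> push f x ('X - y%:P).
Proof.
by move=> /berk_discP[s s01 xs]; have [c [rs [_ _ /(_ x xs)[]]]] := push_factor_cdisc y s01.
Qed.

Lemma gauss_berk_cdisc a (s t : R) : 0 <= t -> av a <= s -> t <= s ->
  berk_cdisc av 0 s (gauss av a t).
Proof.
move=> t0 a1 t1; split; first exact: (gauss_berk_line hav).
by rewrite (gauss_XsubC hav) // subr0 ge_max t1 a1.
Qed.

Lemma gauss_berk_disc a (t : R) : 0 <= t -> av a < 1 -> t < 1 -> berk_disc av (gauss av a t).
Proof.
move=> t0 a1 t1; split; first exact: (gauss_berk_line hav).
by rewrite -['X]subr0 -polyC0 (gauss_XsubC hav) // subr0 gt_max t1 a1.
Qed.

Lemma av_limP (u : nat -> k) : (exists l, av_cvg av u l) -> av_cvg av u (av_lim av u).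
Proof. by move=> [l hl]; apply: (xgetPex 0 (P := [set l | av_cvg av u l])); exists l. Qed.

(** In a complete ultrametric field a series converges as soon as its terms
    tend to zero. *)
Lemma av_series (u : nat -> k) :
  (forall eps, 0 < eps -> exists N, forall n, (N <= n)%N -> av (u n) < eps) ->
  exists l, av_cvg av (fun n => \sum_(i < n) u i) l.
Proof.
move=> h; apply: (av_complete hav) => eps eps0; have [N hN] := h _ eps0.
exists N; suff H m n : (N <= n)%N -> (n <= m)%N ->
    av (\sum_(i < m) u i - \sum_(i < n) u i) < eps.
  move=> m n Nm Nn; have [nm|/ltnW mn] := leqP n m; first exact: H.
  by rewrite (umBC hum); apply: H.
move=> Nn nm; rewrite -!(big_mkord xpredT u) (big_cat_nat (leq0n n) nm) /= addrAC subrr add0r.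
rewrite big_nat_cond; apply: (um_sum_lt hum) => // i /andP[/andP[ni _] _].
by apply: hN; apply: leq_trans ni.
Qed.

Lemma partial_eval n a : (partial f n).[a] = \sum_(i < n) f i * a ^+ i.
Proof. by rewrite horner_poly. Qed.

Lemma disc_fun_terms a j : av a < 1 -> forall eps, 0 < eps ->
  exists N, forall n, (N <= n)%N -> av (f (j + n)%N) * av a ^+ n < eps.
Proof.
move=> a1 eps eps0; pose r := (av a + 1) / 2.
have a0 : 0 <= av a := av_ge0 hav a.
have ar : av a < r by rewrite midf_lt.
have r0 : 0 < r := le_lt_trans a0 ar.
have r01 : 0 < r < 1 by rewrite r0 midf_lt.
have f0 i : 0 <= av (f i) * r ^+ i.
  by rewrite mulr_ge0 ?(av_ge0 hav) // exprn_ge0 // ltW.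
have [N hN] := (cvg0_eps f0).1 (hf r01) _ (mulr_gt0 eps0 (exprn_gt0 j r0)).
exists N => n Nn; rewrite -(ltr_pM2r (exprn_gt0 j r0)).
apply: le_lt_trans (hN (j + n)%N (leq_trans Nn (leq_addl _ _))).
rewrite exprD -mulrA ler_wpM2l ?(av_ge0 hav) // mulrC ler_wpM2l ?exprn_ge0 ?(ltW r0) //.
by rewrite lerXn2r ?nnegrE ?(ltW r0) ?(ltW ar).
Qed.

Lemma feval_cvg a : av a < 1 ->
  av_cvg av (fun n => \sum_(i < n) f i * a ^+ i) (feval av f a).
Proof.
move=> a1; apply: av_limP; apply: (@av_series (fun i => f i * a ^+ i)) => eps eps0.
have [N hN] := disc_fun_terms 0 a1 eps0; exists N => n /hN.
by rewrite (umM hum) (umX hum).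
Qed.

Lemma push_gauss0 a y : av a < 1 -> push f (gauss av a 0) ('X - y%:P) = av (feval av f a - y).
Proof.
move=> a1; have h := push_cvg (y := y) (gauss_berk_disc (lexx 0) a1 ltr01).
apply: (cvg_unique (@Rhausdorff R) h).
apply/cvg_eps => eps eps0; have [N hN] := (av_cvgP hav _ _).1 (feval_cvg a1) _ eps0.
exists N => n /hN h1; rewrite (gauss_eval hav) hornerD hornerN hornerC partial_eval.
apply: le_lt_trans (um_dist hum _ _) _.
by rewrite opprB addrA subrK.
Qed.

End Source.
End Morphism.

(** * Finite morphisms and their fibres *)

Section Finite.
Variables (R : realType) (k : closedFieldType) (p : nat) (av : k -> R).
Hypothesis hav : complete_padic_av p av.
Let hum := av_um hav.

(** What the etale hypothesis says beyond its algebraic part.  The inclusion of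
    the preimage in a smaller disc makes the number of zeros of [f - y] finite
    and independent of [y]. *)
Definition finite_morphism (f : nat -> k) := disc_morphism av f /\
  forall r : R, 0 < r < 1 -> exists2 s : R, 0 < s < 1 & forall x, berk_disc av x ->
      berk_cdisc av 0 r (push f x) -> berk_cdisc av 0 s x.

Lemma finite_etale_morphism f d : finite_etale av f d -> finite_morphism f.
Proof. by move=> [hf h]; split=> // r /h[]. Qed.

Lemma maxprod_dist (I : Type) (r : seq I) (F : I -> k) a s : 0 <= s ->
  \prod_(i <- r) gauss av a s ('X - (F i)%:P) = maxprod [seq av (a - F i) | i <- r] s.
Proof. by move=> s0; rewrite /maxprod big_map; apply: eq_bigr => i _; rewrite (gauss_XsubC hav). Qed.

(** The multiplicity of [a] is the exponent near [0] of the function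
    [t |-> |P|] along the Gauss points centred at [a], see [ncount_eq]. *)
Lemma factor_unique (s c c' : R) (rs rs' : seq k) : 0 < s -> 0 < c -> 0 < c' ->
  (forall z, z \in rs -> av z <= s) -> (forall z, z \in rs' -> av z <= s) ->
  (forall x, berk_cdisc av 0 s x -> c * \prod_(z <- rs) x ('X - z%:P) =
     c' * \prod_(z <- rs') x ('X - z%:P)) -> perm_eq rs rs' /\ c = c'.
Proof.
move=> s0 c0 c'0 hrs hrs' h.
have pe : perm_eq rs rs'.
  apply/allP => a _ /=; apply/eqP.
  have cnt (qs : seq k) : count_mem a qs = ncount [seq av (a - z) | z <- qs] 0.
    rewrite /ncount count_map; apply: eq_count => z /=.
    by rewrite -[_ <= 0]negbK -ltNge (av_gt0 hav) negbK subr_eq0 eq_sym.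
  have [alphas|sa] := leP (av a) s; last first.
    by rewrite !(count_memPn _) //; apply/negP; [move=> /hrs'|move=> /hrs]; rewrite leNgt sa.
  rewrite !cnt; apply: (@ncount_eq _ _ _ c c' 0 s) => // u /andP[u0 us].
  by rewrite -!maxprod_dist // h //; apply: (gauss_berk_cdisc hav).
split=> //; have g0 : berk_cdisc av 0 s (gauss av 0 s).
  by apply: (gauss_berk_cdisc hav); rewrite ?(av0 hav) // ltW.
have := h _ g0; rewrite (perm_big _ pe) /= => /mulIf; apply.
rewrite prodf_seq_neq0; apply/allP => z _ /=.
by rewrite (gauss_XsubC hav) ?ltW // gt_eqF // lt_max s0.
Qed.

Section Source.
Variable f : nat -> k.
Hypothesis ff : finite_morphism f.
Let hm : disc_morphism av f := ff.1.
Let hf : disc_fun av f := hm.1.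

Lemma push_disc x : berk_disc av x -> berk_disc av (push f x).
Proof. exact: hm.2. Qed.

Lemma push_um x : berk_disc av x -> ultra_mult (push f x).
Proof. by move=> /push_disc[/(berk_um hav)]. Qed.

Lemma push_lt1 x y : berk_disc av x -> av y < 1 -> push f x ('X - y%:P) < 1.
Proof.
move=> /push_disc[xl x1] y1; apply: le_lt_trans (umB (berk_um hav xl) _ _) _.
by rewrite gt_max x1 (berkC _ xl).
Qed.

Lemma bounded_preimage (c : R) y : c < 1 -> av y < 1 -> exists2 s : R, 0 < s < 1 &
  forall x, berk_disc av x -> push f x ('X - y%:P) <= c -> x 'X <= s.
Proof.
move=> c1 y1; pose r := Num.max (1 / 2) (Num.max c (av y)).
have r01 : 0 < r < 1.
  rewrite !gt_max !lt_max c1 y1 divr_gt0 // andbT /=.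
  by rewrite ltr_pdivrMr // mul1r ltr1n.
have [s s01 hs] := ff.2 r r01; exists s => // x hx le.
have [] := hs x hx; last by rewrite subr0.
have [pl p1] := push_disc hx; split=> //.
apply: le_trans (berk_subC hav 0 y pl) _.
by rewrite subr0 ge_max !le_max le lexx !orbT.
Qed.

Lemma finite_nonconstant : exists2 i, (0 < i)%N & f i != 0.
Proof.
apply: contrapT => h.
have f0 i : (0 < i)%N -> f i = 0.
  by move=> i0; apply/eqP/negPn/negP => fi; apply: h; exists i.
have e x : berk_disc av x -> push f x ('X - 0%:P) = av (f 0%N).
  move=> [xl _]; rewrite push_XsubC; apply: (cvg_lim (@Rhausdorff R)).
  apply/cvg_eps => eps eps0; exists 1%N => n n1.
  rewrite (_ : partial f n - 0%:P = (f 0%N)%:P) ?(berkC _ xl) ?subrr ?normr0 //.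
  rewrite subr0; apply/polyP => -[|i]; rewrite coef_poly coefC ?n1 //=.
  by rewrite f0 // if_same.
have g0 t : 0 <= t < 1 -> berk_disc av (gauss av 0 t).
  by move=> /andP[t0 t1]; apply: (gauss_berk_disc hav) => //; rewrite (av0 hav) ltr01.
have h0 : berk_disc av (gauss av 0 0) by apply: g0; rewrite lexx ltr01.
have c1 : av (f 0%N) < 1 by rewrite -(e _ h0) push_lt1 // (av0 hav) ltr01.
have [|s /andP[s0 s1] hs] := bounded_preimage c1 (y := 0); first by rewrite (av0 hav) ltr01.
have t01 : 0 <= (s + 1) / 2 < 1 by rewrite divr_ge0 ?midf_lt // addr_ge0 // ltW.
have [t0 _] := andP t01.
have := hs _ (g0 _ t01); rewrite (e _ (g0 _ t01)) => /(_ (lexx _)).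
rewrite -['X]subr0 -polyC0 (gauss_XsubC hav) // subr0 (av0 hav) max_l //.
by rewrite leNgt midf_lt.
Qed.

Lemma push_gauss0_eq0 (z y : k) : av z < 1 ->
  push f (gauss av z 0) ('X - y%:P) = av (feval av f z - y).
Proof. exact: (push_gauss0 hav hf finite_nonconstant). Qed.

(** On each closed disc this is [weierstrass].  All the zeros lie in a fixed
    disc, so that the factorizations on larger and larger discs agree by
    [factor_unique]. *)
Lemma push_factor y : av y < 1 -> exists (c : R) (rs : seq k),
  [/\ 0 < c, (forall z, z \in rs -> av z < 1) &
      forall x, berk_disc av x -> push f x ('X - y%:P) = c * \prod_(z <- rs) x ('X - z%:P)].
Proof.
move=> y1; have [s s01 hs] := bounded_preimage ltr01 y1; have [s0 s1] := andP s01.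
(* zeros in larger discs already lie in the disc of radius [s] *)
have small (t c : R) rs : 0 < t < 1 -> (forall z, z \in rs -> av z <= t) ->
    (forall x, berk_cdisc av 0 t x ->
       push f x ('X - y%:P) = c * \prod_(z <- rs) x ('X - z%:P)) ->
    forall z, z \in rs -> av z <= s.
  move=> /andP[t0 t1] hrs hx z zrs.
  have zd : berk_disc av (gauss av z 0).
    by apply: (gauss_berk_disc hav) => //; apply: le_lt_trans t1; apply: hrs.
  have := hs _ zd; rewrite hx; last first.
    by apply: (gauss_berk_cdisc hav) => //; [apply: hrs|apply: ltW].
  rewrite (big_rem z) //= (gauss_XsubC hav) // subrr (av0 hav) maxxx mul0r mulr0 lexx.
  rewrite -['X]subr0 -polyC0 (gauss_XsubC hav) // subr0 => /(_ isT).
  by rewrite ge_max => /andP[].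
have [c [rs [c0 hrs hx]]] := push_factor_cdisc hav hf finite_nonconstant y s01.
exists c, rs; split=> // [z /hrs h|x xd]; first exact: le_lt_trans h s1.
have [t /andP[t0 t1] xt] := berk_discP hav xd.
pose u := Num.max s t.
have u01 : 0 < u < 1 by rewrite lt_max s0 gt_max s1.
have [c' [rs' [c'0 hrs' hx']]] := push_factor_cdisc hav hf finite_nonconstant y u01.
have hsu (x' : {poly k} -> R) : berk_cdisc av 0 s x' -> berk_cdisc av 0 u x'.
  by case=> xl h; split=> //; rewrite le_max h.
have hs' := small u c' rs' u01 hrs' (fun x h => (hx' x h).2).
have [pe ce] : perm_eq rs rs' /\ c = c'.
  apply: (factor_unique s0) => // x' xs'.
  by rewrite -(hx _ xs').2 (hx' _ (hsu _ xs')).2.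
rewrite (perm_big _ pe) ce /=; apply: (hx' _ _).2.
by case: xt => xl h; split=> //; rewrite le_max h orbT.
Qed.

Lemma gauss_disc a (t : R) : av a < 1 -> 0 <= t -> t < 1 -> berk_disc av (gauss av a t).
Proof. by move=> a1 t0 t1; apply: (gauss_berk_disc hav). Qed.

Lemma av0_lt1 : av 0 < 1. Proof. by rewrite (av0 hav) ltr01. Qed.

(** Beyond all the roots, the Gauss points see only the degree and the leading
    constant. *)
Lemma factor_boundary c (rs : seq k) y : (forall z, z \in rs -> av z < 1) ->
  (forall x, berk_disc av x -> push f x ('X - y%:P) = c * \prod_(z <- rs) x ('X - z%:P)) ->
  exists2 s : R, 0 <= s < 1 & forall t : R, s <= t -> t < 1 ->
    push f (gauss av 0 t) ('X - y%:P) = c * t ^+ size rs.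
Proof.
move=> hrs hx; exists (\big[Num.max/0]_(z <- rs) av z).
  by rewrite bigmax_ge_id big_seq /=; apply: bigmax_lt => //; rewrite ltr01.
move=> t st t1; have t0 : 0 <= t by apply: le_trans st; apply: bigmax_ge_id.
rewrite (hx _ (gauss_disc av0_lt1 t0 t1)); congr (_ * _).
rewrite (eq_big_seq (fun _ => t)) => [|z zrs].
  by rewrite big_const_seq count_predT iter_mulr mulr1.
rewrite (gauss_XsubC hav) // sub0r (umN hum) max_l //.
by apply: le_trans st; apply: (le_bigmax_seq _ _ xpredT _ zrs isT).
Qed.

(** A constant larger than [1] would push Gauss points close to the boundary
    out of the target disc; with a constant smaller than [1], the preimage of a
    closed disc would contain all of them. *)
Lemma factor_lead c (rs : seq k) y : av y < 1 -> 0 < c ->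
  (forall z, z \in rs -> av z < 1) ->
  (forall x, berk_disc av x -> push f x ('X - y%:P) = c * \prod_(z <- rs) x ('X - z%:P)) ->
  c = 1.
Proof.
move=> y1 c0 hrs hx; have [s /andP[s0 s1] hs] := factor_boundary hrs hx.
apply/eqP; rewrite eq_le; apply/andP; split; rewrite leNgt; apply/negP => lt.
  have [|t /andP[st t1] ht] := pow_near1 (size rs) s0 _ s1 (t := c^-1).
    by rewrite invf_lt1.
  have t0 : 0 <= t := le_trans s0 (ltW st).
  have := push_lt1 (gauss_disc av0_lt1 t0 t1) y1.
  rewrite hs ?(ltW st) // ltNge => /negP; apply.
  by rewrite -ler_pdivrMl // mulr1 ltW.
have [u /andP[u0 u1] hu] := bounded_preimage lt y1.
pose t := (Num.max s u + 1) / 2.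
have m1 : Num.max s u < 1 by rewrite gt_max s1.
have mt : Num.max s u < t by rewrite midf_lt.
have t1 : t < 1 by rewrite midf_lt.
have [st ut] : s < t /\ u < t by move: mt; rewrite gt_max => /andP[].
have t0 : 0 <= t := le_trans s0 (ltW st).
have := hu _ (gauss_disc av0_lt1 t0 t1); rewrite hs ?(ltW st) //.
have -> : c * t ^+ size rs <= c by rewrite ger_pMr // exprn_ile1 // ltW.
rewrite -['X]subr0 -polyC0 (gauss_XsubC hav) // subrr (av0 hav) max_l // => /(_ isT).
by rewrite leNgt ut.
Qed.

(** The number of zeros does not depend on [y]: at a Gauss point close enough to
    the boundary, [|f|] exceeds [|y|] and therefore equals [|f - y|]. *)
Theorem fibres : exists n (z : k -> 'I_n -> k), (0 < n)%N /\
  forall y, av y < 1 -> (forall i, av (z y i) < 1) /\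
    forall x, berk_disc av x -> push f x ('X - y%:P) = \prod_i x ('X - (z y i)%:P).
Proof.
have fac y : av y < 1 -> exists rs : seq k, (forall z, z \in rs -> av z < 1) /\
    forall x, berk_disc av x -> push f x ('X - y%:P) = \prod_(z <- rs) x ('X - z%:P).
  move=> y1; have [c [rs [c0 hrs hx]]] := push_factor y1; exists rs; split=> // x xd.
  by rewrite hx // (factor_lead y1 c0 hrs hx) mul1r.
have hx1 (y : k) rs :
    (forall x, berk_disc av x -> push f x ('X - y%:P) = \prod_(z <- rs) x ('X - z%:P)) ->
    (forall x, berk_disc av x -> push f x ('X - y%:P) = 1 * \prod_(z <- rs) x ('X - z%:P)).
  by move=> h x xd; rewrite mul1r h.
have [rs0 [hrs0 hx0]] := fac 0 av0_lt1.
have [s0 /andP[s00 s01] hs0] := factor_boundary hrs0 (hx1 _ _ hx0).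
exists (size rs0).
have szE y rs : av y < 1 -> (forall z, z \in rs -> av z < 1) ->
    (forall x, berk_disc av x -> push f x ('X - y%:P) = \prod_(z <- rs) x ('X - z%:P)) ->
    size rs = size rs0.
  move=> y1 hrs hx; have [s /andP[sp s1] hs] := factor_boundary hrs (hx1 _ _ hx).
  have mp : 0 <= Num.max s s0 by rewrite le_max sp.
  have m1 : Num.max s s0 < 1 by rewrite gt_max s1.
  have [t /andP[mt t1] yt] := pow_near1 (size rs0) mp y1 m1.
  have [st s0t] : s < t /\ s0 < t by move: mt; rewrite gt_max => /andP[].
  have t0 : 0 < t := le_lt_trans sp st.
  have td := gauss_disc av0_lt1 (ltW t0) t1.
  have := hs t (ltW st) t1; have := hs0 t (ltW s0t) t1; rewrite !mul1r => e0 e.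
  apply: (@ieexprIn _ t) => //; first by rewrite lt_eqF.
  rewrite -e -e0; have pu := push_um td.
  rewrite (_ : 'X - y%:P = ('X - 0%:P) - y%:P); last by rewrite subr0.
  have [pl _] := push_disc td; have := um_isoB pu (P := 'X - 0%:P) (Q := y%:P).
  by rewrite e0 (berkC _ pl) => ->.
have /choice[z hz] : forall y, exists z : 'I_(size rs0) -> k, av y < 1 ->
    (forall i, av (z i) < 1) /\
    forall x, berk_disc av x -> push f x ('X - y%:P) = \prod_i x ('X - (z i)%:P).
  move=> y; have [y1|_] := ltP (av y) 1; last by exists (fun _ => 0).
  have [rs [hrs hx]] := fac y y1; have sz := szE y rs y1 hrs hx.
  exists (fun i => nth 0 rs i) => _; split=> [i|x xd].
    by apply: hrs; rewrite mem_nth // sz.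
  by rewrite hx // (big_nth 0) big_mkord sz.
exists z; split=> //.
rewrite lt0n; apply/eqP => /size0nil e.
have d0 := gauss_disc av0_lt1 (lexx 0) ltr01.
have := push_lt1 d0 av0_lt1; rewrite hx0 // e big_nil.
by rewrite ltxx.
Qed.

End Source.
End Finite.

(** * Profiles *)

Section Fibred.
Variables (R : realType) (k : closedFieldType) (p : nat) (av : k -> R).
Hypothesis hav : complete_padic_av p av.
Let hum := av_um hav.
Variable f : nat -> k.
Hypothesis ff : finite_morphism av f.
Variables (n : nat) (z : k -> 'I_n -> k).

(** The points over [y], repeated according to their multiplicities. *)
Definition fibre_family := forall y, av y < 1 -> (forall i, av (z y i) < 1) /\
  forall x, berk_disc av x -> push f x ('X - y%:P) = \prod_i x ('X - (z y i)%:P).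

Hypothesis hz : fibre_family.
Hypothesis n0 : (0 < n)%N.

Let fe a := feval av f a.

Definition dists a y : seq R := [seq av (a - z y i) | i <- index_enum 'I_n].

(** The profile of [f] at [a]: [profileE] and [val_polygonE] relate it to
    [profile] and [val_polygon]. *)
Definition prof a t := maxprod (dists a (feval av f a)) t.

Lemma fibre_disc y i : av y < 1 -> av (z y i) < 1. Proof. by move=> /hz[]. Qed.

Lemma push_fibre x y : berk_disc av x -> av y < 1 ->
  push f x ('X - y%:P) = \prod_i x ('X - (z y i)%:P).
Proof. by move=> xd /hz[_]; apply. Qed.

Lemma feval_dist a y : av a < 1 -> av y < 1 -> av (fe a - y) = \prod_i av (a - z y i).
Proof.
move=> a1 y1; rewrite -(push_gauss0_eq0 hav ff) // push_fibre //; last exact: (gauss_disc hav).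
by apply: eq_bigr => i _; rewrite (gauss_XsubC hav) // max_r // (av_ge0 hav).
Qed.

Lemma feval_disc a : av a < 1 -> av (fe a) < 1.
Proof.
move=> a1; rewrite -[fe a]subr0 -(push_gauss0_eq0 hav ff) //.
by apply: (push_lt1 hav ff) => //; [exact: (gauss_disc hav)|rewrite (av0 hav) ltr01].
Qed.

Lemma av_eq0_sub a b : av (a - b) = 0 -> a = b.
Proof. by move=> /(av_eq0 hav)/eqP; rewrite subr_eq0 => /eqP. Qed.

Lemma feval_fibre y i : av y < 1 -> fe (z y i) = y.
Proof.
move=> y1; apply: av_eq0_sub; rewrite feval_dist ?fibre_disc //.
by rewrite (bigD1 i) //= subrr (av0 hav) mul0r.
Qed.

Lemma fibreP a y : av a < 1 -> av y < 1 -> fe a = y -> exists i, a = z y i.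
Proof.
move=> a1 y1 e; have := feval_dist a1 y1; rewrite e subrr (av0 hav) => /esym/eqP.
rewrite prodf_seq_eq0 => /hasP[i _ /=] /eqP h; exists i; exact: av_eq0_sub.
Qed.

Lemma push_gauss_maxprod a (t : R) y : av a < 1 -> 0 <= t -> t < 1 -> av y < 1 ->
  push f (gauss av a t) ('X - y%:P) = maxprod (dists a y) t.
Proof.
move=> a1 t0 t1 y1; rewrite push_fibre //; last exact: (gauss_disc hav).
exact: (maxprod_dist hav).
Qed.

Lemma prof_self a : av a < 1 -> 0 \in dists a (fe a).
Proof.
move=> a1; have [i ai] := fibreP a1 (feval_disc a1) erefl.
by apply/mapP; exists i; rewrite ?mem_index_enum // -ai subrr (av0 hav).
Qed.

(** The point [a] belongs to its own fibre and contributes the factor [t]; this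
    makes the profile strictly increasing. *)
Lemma prof_split a : av a < 1 -> exists2 cs : seq R, forall c, c \in cs -> 0 <= c < 1 &
  forall t : R, 0 <= t -> prof a t = t * maxprod cs t.
Proof.
move=> a1; exists (rem 0 (dists a (fe a))) => [c /mem_rem /mapP[i _ ->]|t t0].
  rewrite (av_ge0 hav) /=; apply: le_lt_trans (umB hum _ _) _.
  by rewrite gt_max a1 fibre_disc // feval_disc.
rewrite /prof /maxprod (perm_big _ (perm_to_rem (prof_self a1))) big_cons /=.
by rewrite max_l.
Qed.

Lemma prof_ge0 a (t : R) : 0 <= t -> 0 <= prof a t.
Proof. exact: maxprod_ge0. Qed.

Lemma prof0 a : av a < 1 -> prof a 0 = 0.
Proof. by move=> a1; have [cs _ ->] := prof_split a1; rewrite ?mul0r. Qed.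

Lemma prof_le a (t : R) : av a < 1 -> 0 <= t -> t <= 1 -> prof a t <= t.
Proof.
move=> a1 t0 t1; have [cs hcs ->] := prof_split a1 => //; apply: ler_piMr => //.
have : 0 <= maxprod cs t <= 1; last by case/andP.
by apply: maxprod_le1 => [c /hcs /andP[-> /ltW]//|]; rewrite t0.
Qed.

Lemma prof_lt a (t u : R) : av a < 1 -> 0 <= t -> t < u -> prof a t < prof a u.
Proof.
move=> a1 t0 tu; have u0 : 0 < u := le_lt_trans t0 tu.
have [cs _ h] := prof_split a1; rewrite !h ?(ltW u0) //.
apply: (@le_lt_trans _ _ (t * maxprod cs u)).
  by rewrite ler_wpM2l // maxprod_mono // ltW.
by rewrite ltr_pM2r // maxprod_gt0.
Qed.

Lemma prof_le_mono a (t u : R) : av a < 1 -> 0 <= t -> t <= u -> prof a t <= prof a u.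
Proof. by move=> a1 t0 tu; apply: maxprod_mono. Qed.

Lemma prof_inj a (t u : R) : av a < 1 -> 0 <= t -> 0 <= u -> prof a t = prof a u -> t = u.
Proof.
move=> a1 t0 u0 e; case: (ltgtP t u) => // h.
  by have := prof_lt a1 t0 h; rewrite e ltxx.
by have := prof_lt a1 u0 h; rewrite e ltxx.
Qed.

Lemma prof_lt1 a (t : R) : av a < 1 -> 0 <= t -> t < 1 -> prof a t < 1.
Proof. by move=> a1 t0 t1; apply: (le_lt_trans _ t1); apply: prof_le => //; apply: ltW. Qed.

Lemma prof1 a : av a < 1 -> prof a 1 = 1.
Proof.
move=> a1; have [cs hcs ->] := prof_split a1; rewrite ?ler01 // mul1r /maxprod.
by rewrite big_seq big1 // => c /hcs /andP[_ /ltW]; apply: max_l.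
Qed.

Lemma prof_surj a (r : R) : av a < 1 -> 0 <= r < 1 -> exists2 t : R, 0 <= t < 1 & prof a t = r.
Proof.
move=> a1 /andP[r0 r1].
have [||t] := @IVT _ (prof a) 0 1 r ler01.
- by apply: continuous_subspaceT; apply: maxprod_continuous.
- by rewrite prof0 // prof1 // ge_min r0 /= le_max (ltW r1) orbT.
rewrite in_itv /= => /andP[t0 t1] e; exists t => //; rewrite t0 lt_neqAle t1 andbT.
by apply: contraTneq r1 => e1; rewrite -e e1 prof1 // ltxx.
Qed.

(** The only delicate case is [|f a - y| = prof a t], where the value at
    [T - y] could a priori drop; it is bounded below by the value at the
    rational point [a]. *)
Lemma push_gauss a (t : R) : av a < 1 -> 0 <= t -> t < 1 ->
  push f (gauss av a t) = gauss av (fe a) (prof a t).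
Proof.
move=> a1 t0 t1; have td := gauss_disc hav a1 t0 t1.
have [pl p1] := push_disc ff td; have pu := berk_um hav pl.
have p0 : 0 <= prof a t := prof_ge0 a t0.
apply: (berk_ext hav pl); first exact: (gauss_berk_line hav).
move=> y; rewrite (gauss_XsubC hav) //.
have ep : push f (gauss av a t) ('X - (fe a)%:P) = prof a t.
  by rewrite push_gauss_maxprod // feval_disc.
have -> : 'X - y%:P = ('X - (fe a)%:P) + (fe a - y)%:P by rewrite polyCB addrA subrK.
have ec := berkC (fe a - y) pl.
case: (ltgtP (prof a t) (av (fe a - y))) => h.
- by rewrite addrC (um_iso pu) ?ec ?ep.
- by rewrite (um_iso pu) ?ec ?ep.
have y1 : av y < 1.
  rewrite -(subrK (fe a) y); apply: le_lt_trans (umD hum _ _) _.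
  by rewrite (umBC hum) -h gt_max prof_lt1 // feval_disc.
apply/eqP; rewrite eq_le; apply/andP; split.
  by apply: le_trans (umD pu _ _) _; rewrite ep ec h maxxx.
rewrite polyCB addrA subrK h push_gauss_maxprod // feval_dist // /maxprod big_map.
by apply: ler_prod => i _; rewrite (av_ge0 hav) le_max lexx orbT.
Qed.

(** The profile at radius [t] only depends on the disc of radius [t], i.e. on
    its Gauss point. *)
Lemma prof_near a b (t : R) : av a < 1 -> av b < 1 -> 0 <= t -> t < 1 -> av (a - b) <= t ->
  prof a t = prof b t /\ av (fe a - fe b) <= prof a t.
Proof.
move=> a1 b1 t0 t1 ab; apply: (gauss_inj_radius hav); rewrite ?prof_ge0 //.
by rewrite -!push_gauss // (gauss_eq hav t0 ab).
Qed.

Lemma feval_lip a b : av a < 1 -> av b < 1 -> av (fe a - fe b) <= av (a - b).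
Proof.
move=> a1 b1; have ab1 : av (a - b) < 1.
  by apply: le_lt_trans (umB hum _ _) _; rewrite gt_max a1.
have ab0 := av_ge0 hav (a - b).
have [_ h] := prof_near a1 b1 ab0 ab1 (lexx _).
by apply: le_trans h _; apply: prof_le => //; apply: ltW.
Qed.

Lemma push_gauss_fibre y i (t : R) : av y < 1 -> 0 <= t -> t < 1 ->
  push f (gauss av (z y i) t) = gauss av y (prof (z y i) t).
Proof.
by move=> y1 t0 t1; rewrite push_gauss ?fibre_disc // feval_fibre.
Qed.

(** Let [z y m] be a point of the fibre closest to [x], and [t] its distance.
    All the factors [|T - z y j|] take the same value at [x] and at the Gauss
    point of the disc around [z y m] of radius [t], so that [t] is mapped to
    [r].  If [x] were a different point, it would lie in a strictly smaller
    disc around some [b], whose image would be a disc of radius less than [r]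
    around [f b]; but [zeta y r] lies in no such disc. *)
Lemma push_eq_zeta x y (r : R) : berk_disc av x -> av y < 1 -> 0 <= r < 1 ->
  push f x = gauss av y r -> exists i (t : R), [/\ 0 <= t < 1, prof (z y i) t = r &
    x = gauss av (z y i) t].
Proof.
move=> xd y1 /andP[r0 r1] e; have [xl x1] := xd; have xu := berk_um hav xl.
pose m := [arg min_(i < Ordinal n0) x ('X - (z y i)%:P)]%O.
pose t := x ('X - (z y m)%:P).
have tmin j : t <= x ('X - (z y j)%:P).
  by rewrite /t /m; case: Order.TotalTheory.arg_minP => // i _ h; apply: h.
have t0 : 0 <= t := um_ge0 xu _.
have zm1 : av (z y m) < 1 by apply: fibre_disc.
have t1 : t < 1.
  apply: le_lt_trans (umB xu _ _) _; rewrite gt_max x1 (berkC _ xl) //.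
have pr : prof (z y m) t = r.
  rewrite /prof -/(fe _) (feval_fibre m y1) -push_gauss_maxprod //.
  have <- : push f x ('X - y%:P) = r.
    by rewrite e (gauss_XsubC hav) // subrr (av0 hav) max_l.
  rewrite !push_fibre //; last exact: (gauss_disc hav).
  apply: eq_bigr => j _; rewrite (gauss_XsubC hav) //.
  have le := berk_subC hav (z y j) (z y m) xl.
  rewrite -/t in le; apply/eqP; rewrite eq_le le andbT ge_max tmin /=.
  have -> : z y m - z y j = (z y m - z y j) + 0 by rewrite addr0.
  rewrite addr0 -(berkC _ xl) polyCB.
  have -> : (z y m)%:P - (z y j)%:P = ('X - (z y j)%:P) - ('X - (z y m)%:P).
    by rewrite opprB [RHS]addrC addrA subrK.
  by apply: le_trans (umB xu _ _) _; rewrite ge_max lexx tmin.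
exists m, t; split=> //; first by rewrite t0.
apply: (berk_ext hav xl); first exact: (gauss_berk_line hav).
move=> b; rewrite (gauss_XsubC hav) //.
have eb : 'X - b%:P = ('X - (z y m)%:P) + (z y m - b)%:P by rewrite polyCB addrA subrK.
have ec := berkC (z y m - b) xl.
case: (ltgtP t (av (z y m - b))) => h.
- by rewrite eb addrC (um_iso xu) ?ec.
- by rewrite eb (um_iso xu) ?ec.
apply/eqP; rewrite eq_le; apply/andP; split.
  by rewrite eb; apply: le_trans (umD xu _ _) _; rewrite ec -h maxxx.
rewrite leNgt; apply/negP => lt; set u := x _ in lt.
have u0 : 0 <= u := um_ge0 xu _.
have u1 : u < 1 := lt_trans lt t1.
have b1 : av b < 1.
  rewrite -(berkC _ xl) (_ : b%:P = 'X - ('X - b%:P)); last by rewrite opprB addrC subrK.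
  by apply: le_lt_trans (umB xu _ _) _; rewrite gt_max x1.
have : push f x ('X - (fe b)%:P) <= prof b u.
  rewrite push_fibre ?feval_disc // /prof -push_gauss_maxprod ?feval_disc //.
  rewrite push_fibre ?feval_disc //; last exact: (gauss_disc hav).
  apply: ler_prod => i _; rewrite (um_ge0 xu) (gauss_XsubC hav) //=.
  exact: (berk_subC hav).
have hle : av (z y m - b) <= t by rewrite -h.
have [eb' _] := prof_near zm1 b1 t0 t1 hle.
move=> h1; have := le_lt_trans h1 (prof_lt b1 u0 lt); rewrite -eb' pr.
by rewrite e (gauss_XsubC hav) // gt_max ltxx.
Qed.

End Fibred.

(** * Taylor coefficients and valuation polygons *)

Section Taylor.
Variables (R : realType) (k : closedFieldType) (p : nat) (av : k -> R).
Hypothesis hav : complete_padic_av p av.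
Let hum := av_um hav.

Lemma coef_comp_XaddC (P : {poly k}) a i : (P \Po ('X + a%:P))`_i = P^`N(i).[a].
Proof.
rewrite /comp_poly addrC nderiv_taylor; last exact: mulrC.
rewrite size_map_polyC.
rewrite (eq_bigr (fun i : 'I_(size P) => (P^`N(i).[a])%:P * 'X^i)); last first.
  by move=> j _; rewrite nderivn_map horner_map.
under eq_bigr do rewrite mul_polyC.
rewrite -(poly_def (size P) (fun i => P^`N(i).[a])) coef_poly.
case: ltnP => // le; rewrite (_ : P^`N(i) = 0) ?horner0 //.
by apply/polyP => j; rewrite coef_nderivn nth_default ?coef0 ?mul0rn // (leq_trans le) ?leq_addr.
Qed.

Section Source.
Variable f : nat -> k.
Hypothesis ff : finite_morphism av f.
Let hf : disc_fun av f := ff.1.1.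

(** The Taylor coefficients are the limits of those of the partial sums. *)
Lemma taylor_cvg a i : av a < 1 ->
  av_cvg av (fun n => (partial f n)^`N(i).[a]) (taylor av f a i).
Proof.
move=> a1; pose u j : k := 'C(i + j, i)%:R * f (i + j)%N * a ^+ j.
have [l hl] : exists l, av_cvg av (fun n => \sum_(j < n) u j) l.
  apply: (av_series hav) => eps eps0; have [N hN] := disc_fun_terms hav hf i a1 eps0.
  exists N => n /hN; apply: le_lt_trans; rewrite /u !(umM hum) (umX hum).
  rewrite ler_wpM2r ?exprn_ge0 ?(av_ge0 hav) // ler_piMl ?(av_ge0 hav) //.
  exact: av_nat_le1 hav _.
have := av_limP (ex_intro _ l hl); rewrite -/(taylor av f a i) => h.
apply/(av_cvgP hav) => eps eps0; have [N hN] := (av_cvgP hav _ _).1 h _ eps0.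
exists (i + N)%N => n iN; have -> : n = (i + (n - i))%N.
  by rewrite subnKC // (leq_trans _ iN) // leq_addr.
have := hN (n - i)%N; rewrite leq_subRL ?(leq_trans _ iN) ?leq_addr // => /(_ isT).
congr (av (_ - _) < _).
rewrite (@horner_coef_wide _ (n - i)); last first.
  apply/leq_sizeP => j hj; rewrite coef_nderivn coef_poly ltn_add2l ltnNge hj /=.
  by rewrite mul0rn.
apply: eq_bigr => j _; rewrite coef_nderivn coef_poly ltn_add2l ltn_ord.
by rewrite /u mulr_natl.
Qed.

Lemma gauss_partial_cauchy (s : R) : 0 < s < 1 -> forall eps : R, 0 < eps ->
  exists M, forall m n, (M <= m)%N -> (M <= n)%N ->
  forall a (t : R), av a <= s -> 0 <= t -> t <= s -> gauss av a t (partial f m - partial f n) < eps.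
Proof.
move=> s01 eps eps0; have [s0 s1] := andP s01.
have [M hM] := partial_cauchy hav s0 (hf s01) eps0.
exists M => m n Mm Mn a t ha t0 ts; apply: le_lt_trans (hM m n Mm Mn).
rewrite -gauss0E; apply: (berk_le_gauss hav); first exact: (gauss_berk_line hav).
  exact: ltW.
by rewrite (gauss_XsubC hav) // subr0 ge_max ts.
Qed.

Variables (n : nat) (z : k -> 'I_n -> k).
Hypothesis hz : fibre_family av f z.
Let fe a := feval av f a.

(** As long as the profile stays above [r], it is computed exactly by a
    partial sum which approximates [f] within [r], uniformly in the centre and
    in the radius. *)
Lemma prof_partial (s r : R) : 0 < s < 1 -> 0 < r -> exists M, forall m, (M <= m)%N ->
  forall a (t : R), av a <= s -> 0 <= t -> t <= s -> r <= prof av f z a t ->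
  gauss av a t (partial f m - ((partial f m).[a])%:P) = prof av f z a t.
Proof.
move=> s01 r0; have [s0 s1] := andP s01.
have r20 : 0 < r / 2 by rewrite divr_gt0.
have r2r : r / 2 < r by rewrite ltr_pdivrMr // ltr_pMr // ltr1n.
have [M hM] := gauss_partial_cauchy s01 r20; exists M => m Mm a t ha t0 ts hr.
have a1 : av a < 1 := le_lt_trans ha s1.
have t1 : t < 1 := le_lt_trans ts s1.
have near (u eps : R) : 0 <= u -> u <= s -> 0 < eps -> exists m',
    gauss av a u (partial f m - partial f m') < r / 2 /\
    `|gauss av a u (partial f m' - (fe a)%:P) - push f (gauss av a u) ('X - (fe a)%:P)| < eps.
  move=> u0 us eps0; have ud := gauss_disc hav a1 u0 (le_lt_trans us s1).
  have c := push_cvg hav hf (finite_nonconstant hav ff) (y := fe a) ud.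
  have [N hN] := (cvg_eps _ _).1 c _ eps0.
  exists (maxn M N); split; last by apply: hN; rewrite leq_maxr.
  by apply: hM; rewrite ?leq_maxl.
have fe1 : av (fe a) < 1 := feval_disc hav ff a1.
have gu := gauss_um hav t0 a.
have split m' : partial f m - (fe a)%:P =
    (partial f m - partial f m') + (partial f m' - (fe a)%:P) by rewrite addrA subrK.
have e1 : gauss av a t (partial f m - (fe a)%:P) = prof av f z a t.
  apply/eqP; rewrite -subr_eq0 -normr_le0 leNgt; apply/negP => lt.
  set d := `|_| in lt.
  have e0 : 0 < Num.min (r / 2) d by rewrite lt_min r20.
  have [m' [h1]] := near t _ t0 ts e0.
  rewrite (push_gauss_maxprod hav hz) // -/(prof av f z a t) lt_min => /andP[h2 h3].
  (* the value at [P_m'] is larger than the distance from [P_m] to [P_m'], hence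
     is the value at [P_m] *)
  have h4 : r / 2 < gauss av a t (partial f m' - (fe a)%:P).
    move: h2; rewrite ltr_distl => /andP[h2 _]; apply: le_lt_trans h2.
    by rewrite lerBrDr -splitr.
  have eG : gauss av a t (partial f m - (fe a)%:P) = gauss av a t (partial f m' - (fe a)%:P).
    by rewrite (split m') addrC (um_iso gu) // (lt_trans h1).
  by move: h3; rewrite -eG -/d ltxx.
have e2 : av ((partial f m).[a] - fe a) < r.
  have [m' [h1 h2]] := near 0 _ (lexx 0) (ltW s0) r0.
  move: h2; rewrite (push_gauss0_eq0 hav ff) // subrr (av0 hav) subr0.
  rewrite ger0_norm ?(um_ge0 (gauss_um hav (lexx 0) a)) // => h2.
  have -> : (partial f m).[a] - fe a = (partial f m - (fe a)%:P).[a].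
    by rewrite hornerD hornerN hornerC.
  rewrite -(gauss_eval hav) (split m').
  apply: le_lt_trans (umD (gauss_um hav (lexx 0) a) _ _) _.
  by rewrite gt_max h2 (lt_trans h1).
have -> : partial f m - ((partial f m).[a])%:P =
  (partial f m - (fe a)%:P) - ((partial f m).[a] - fe a)%:P.
  by rewrite polyCB opprB addrA subrK.
by rewrite (um_isoB gu) // e1 (gaussC hav) (lt_le_trans e2).
Qed.

Lemma coef_gauss_sub (P : {poly k}) a i :
  ((P - (P.[a])%:P) \Po ('X + a%:P))`_i = if i == 0%N then 0 else P^`N(i).[a].
Proof.
rewrite comp_polyB comp_polyC coefB coef_comp_XaddC coefC.
by case: eqP => [->|_]; rewrite ?subr0 // nderivn0 subrr.
Qed.

(** The maximum over the Taylor coefficients is reached, since it is for the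
    partial sums and a coefficient of maximal size is already stable there. *)
Lemma prof_taylor a (t : R) : av a < 1 -> 0 < t -> t < 1 ->
  (forall i, (0 < i)%N -> av (taylor av f a i) * t ^+ i <= prof av f z a t) /\
  exists2 i, (0 < i)%N & av (taylor av f a i) * t ^+ i = prof av f z a t.
Proof.
move=> a1 t0 t1; pose s := Num.max (av a) t; pose r := prof av f z a t.
have tge0 := ltW t0.
have s01 : 0 < s < 1 by rewrite lt_max t0 orbT gt_max a1.
have [ha hts] : av a <= s /\ t <= s by rewrite !le_max !lexx orbT.
have r0 : 0 < r by apply: maxprod_gt0.
have [M hM] := prof_partial s01 r0.
have [M' hM'] := gauss_partial_cauchy s01 r0.
have T m i : (M <= m)%N -> (0 < i)%N -> av ((partial f m)^`N(i).[a]) * t ^+ i <= r.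
  move=> Mm i0; rewrite /r -(hM m Mm a t) //.
  have := gauss0_coef hav t ((partial f m - (partial f m).[a]%:P) \Po ('X + a%:P)) i.
  by rewrite coef_gauss_sub eqn0Ngt i0.
have ti i : 0 < t ^+ i by rewrite exprn_gt0.
split=> [i i0|].
  rewrite leNgt; apply/negP => lt.
  have T0 : 0 < av (taylor av f a i).
    by rewrite -(pmulr_lgt0 _ (ti i)) (lt_trans r0).
  have [N hN] := (av_cvgP hav _ _).1 (taylor_cvg i a1) _ T0.
  have := T (maxn M N) i (leq_maxl _ _) i0.
  by rewrite (um_close hum (hN _ (leq_maxr _ _))) leNgt lt.
(* at [m] the maximum is reached at an index [i > 0], and later partial sums
   change the coefficient by less than its size *)
pose m := maxn M M'.
have [i hi] := gauss0_att hav tge0 ((partial f m - (partial f m).[a]%:P) \Po ('X + a%:P)).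
move: hi; rewrite -/(gauss av a t _) hM ?leq_maxl // -/r coef_gauss_sub.
case: eqP => [_|/eqP]; first by rewrite (av0 hav) mul0r => e; move: r0; rewrite -e ltxx.
rewrite -lt0n => i0 hi; exists i => //.
have T0 : 0 < av ((partial f m)^`N(i).[a]) by rewrite -(pmulr_lgt0 _ (ti i)) hi.
have [N hN] := (av_cvgP hav _ _).1 (taylor_cvg i a1) _ T0.
pose m' := maxn m N.
have close : av ((partial f m')^`N(i).[a] - (partial f m)^`N(i).[a]) < av ((partial f m)^`N(i).[a]).
  rewrite -(ltr_pM2r (ti i)) hi.
  have := hM' m' m _ _ a t ha tge0 hts.
  rewrite /m' (leq_trans (leq_maxr M M')) ?leq_maxl // leq_maxr => /(_ isT isT).
  apply: le_lt_trans.
  have := gauss0_coef hav t ((partial f m' - partial f m) \Po ('X + a%:P)) i.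
  rewrite comp_polyB coefB !coef_comp_XaddC => h; rewrite /gauss comp_polyB; exact: h.
have e1 := um_close hum close.
have := hN m' (leq_maxr _ _); rewrite -e1 (umBC hum) => /(um_close hum) ->.
by rewrite e1 hi.
Qed.

Lemma valuation_term a i (l : R) :
  (valuation av (taylor av f a i) + (i%:R * l)%:E)%E =
  (if (taylor av f a i == 0)%R then +oo
   else (- ln (av (taylor av f a i) * expR (- l) ^+ i))%R%:E)%E.
Proof.
rewrite /valuation; case: eqP => [_|/eqP T0]; first by rewrite addye.
rewrite -EFinD lnM ?posrE ?exprn_gt0 ?expR_gt0 ?(av_gt0 hav) //.
by rewrite lnXn ?expR_gt0 // expRK opprD mulNrn opprK mulr_natl.
Qed.

Lemma val_polygonE a (l : R) : av a < 1 -> 0 < l ->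
  val_polygon av f a l = (- ln (prof av f z a (expR (- l))))%:E.
Proof.
move=> a1 l0; set t := expR (- l).
have t0 : 0 < t by apply: expR_gt0.
have t1 : t < 1 by rewrite -expR0 ltr_expR oppr_lt0.
have [hle [i i0 hi]] := prof_taylor a1 t0 t1.
have r0 : 0 < prof av f z a t by apply: maxprod_gt0.
apply/eqP; rewrite eq_le; apply/andP; split.
  apply: ereal_inf_lbound; exists i => //; rewrite valuation_term -/t hi.
  case: eqP => // e; move: r0; rewrite -hi e (av0 hav) mul0r ltxx //.
apply: le_ereal_inf_tmp => _ [j j1 <-]; rewrite valuation_term -/t.
case: eqP => [_|/eqP T0]; first by rewrite leey.
by rewrite lee_fin lerN2 ler_ln ?posrE ?mulr_gt0 ?exprn_gt0 ?(av_gt0 hav) ?hle.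
Qed.

End Source.
End Taylor.

(** * The diagonal of a finite etale algebra *)

(** Let the [m i] describe the multiplication of a commutative algebra with
    basis [e], and let [v] and [v'] be two characters.  For the dual basis [e']
    with respect to the trace form, the element [\sum_i e i (x) e' i] is the
    idempotent of the diagonal: multiplication by [a] on the left factor and on
    the right factor agree on it, and it is mapped to [1] by the product, since
    [a * \sum_i e i * e' i] has the same trace as [a]. *)
Lemma trace_form_diagonal (F : fieldType) (d : nat) (m : 'I_d -> 'M[F]_d)
    (c : 'I_d -> F) (v v' : 'I_d -> F) :
  let t := \matrix_(i, j) \tr (m i *m m j) in
  let dual i j := invmx t i j in
  (forall i j, m i *m m j = \sum_l m i j l *: m l) ->
  (forall i j, m i *m m j = m j *m m i) ->
  \sum_l c l *: m l = 1%:M ->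
  t \in unitmx ->
  (forall i j, v i * v j = \sum_l m i j l * v l) ->
  (forall i j, v' i * v' j = \sum_l m i j l * v' l) ->
  \sum_l c l * v l = 1 ->
  \sum_i \sum_j dual i j * v i * v j = 1 /\
  ((exists i, v i != v' i) -> \sum_i \sum_j dual i j * v i * v' j = 0).
Proof.
move=> t dual mulE mulmC one tU mv mv' cv.
pose tau := invmx t.
have mt a i j : (m a *m t) i j = \tr (m a *m m i *m m j).
  rewrite !mxE mulE mulmx_suml raddf_sum; apply: eq_bigr => l _.
  by rewrite !mxE -scalemxAl /= mxtraceZ.
have tsym : t^T = t.
  by apply/matrixP => i j; rewrite !mxE mxtrace_mulC.
have tausym : tau^T = tau by rewrite /tau trmx_inv tsym.
have mtC a : m a *m t = t *m (m a)^T.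
  rewrite -{2}tsym -trmx_mul; apply/matrixP => i j; rewrite [RHS]mxE !mt.
  by rewrite -!mulmxA (mulmC i).
have tauC a : tau *m m a = (m a)^T *m tau.
  by rewrite -[LHS](mulmxK tU) -[tau *m m a *m t]mulmxA mtC mulmxA mulVmx // mul1mx.
pose col_of (w : 'I_d -> F) : 'cV[F]_d := \col_i w i.
have ev w : (forall i j, w i * w j = \sum_l m i j l * w l) ->
    forall i, m i *m col_of w = w i *: col_of w.
  move=> h i; apply/matrixP => j k; rewrite !mxE h; apply: eq_bigr => l _.
  by rewrite !mxE.
have form w w' : \sum_i \sum_j dual i j * w i * w' j = ((col_of w)^T *m tau *m col_of w') 0 0.
  rewrite -mulmxA mxE; apply: eq_bigr => i _; rewrite !mxE mulr_sumr.
  by apply: eq_bigr => j _; rewrite !mxE mulrCA mulrA mulrAC.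
split; last first.
  move=> [a na]; rewrite form; set D := _ 0 0.
  have e : v a * D = v' a * D.
    have h : v a *: ((col_of v)^T *m tau *m col_of v') = v' a *: ((col_of v)^T *m tau *m col_of v').
      have l1 : v a *: (col_of v)^T = (col_of v)^T *m (m a)^T by rewrite -trmx_mul ev // linearZ.
      rewrite !scalemxAl l1 -[_ *m _ *m tau]mulmxA -tauC -!scalemxAl scalemxAr.
      by rewrite -(ev v' mv') !mulmxA.
    by move/matrixP/(_ 0 0): h; rewrite [LHS]mxE [RHS]mxE.
  by apply/eqP; move/eqP: e; rewrite -subr_eq0 -mulrBl mulf_eq0 subr_eq0 (negPf na).
pose w l := \sum_i \sum_j tau i j * m i j l.
have trE (q : 'I_d -> F) a : (t *m col_of q) a 0 = \tr (m a *m \sum_l q l *: m l).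
  rewrite mxE mulmx_sumr raddf_sum; apply: eq_bigr => l _.
  by rewrite !mxE -scalemxAr /= mxtraceZ mulrC.
have wm : \sum_l w l *: m l = \sum_i \sum_j tau i j *: (m i *m m j).
  under [RHS]eq_bigr => i _ do under eq_bigr => j _ do rewrite mulE scaler_sumr.
  under [LHS]eq_bigr => l _ do rewrite /w /= scaler_suml.
  rewrite exchange_big /=; apply: eq_bigr => i _.
  under eq_bigr do rewrite scaler_suml.
  rewrite exchange_big /=; apply: eq_bigr => j _.
  by apply: eq_bigr => l _; rewrite scalerA.
have wc : col_of w = col_of c.
  rewrite -[LHS](mulKmx tU) -[RHS](mulKmx tU); congr (_ *m _).
  apply/matrixP => a b; rewrite ord1 !trE one mulmx1 wm.
  rewrite mulmx_sumr raddf_sum.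
  rewrite (_ : m a = m a *m t *m tau^T); last by rewrite tausym mulmxK.
  rewrite /mxtrace; under [RHS]eq_bigr do rewrite mxE.
  rewrite [RHS](eq_bigr (fun i => \sum_j tau i j * \tr (m a *m m i *m m j))); last first.
    by move=> i _; apply: eq_bigr => j _; rewrite mt mxE mulrC.
  apply: eq_bigr => i _; rewrite mulmx_sumr -[X in X = _]/(\tr _) raddf_sum.
  apply: eq_bigr => j _; rewrite -scalemxAr /= mxtraceZ tausym.
  by rewrite mulmxK // mulmxA.
rewrite -cv (_ : \sum_i _ = \sum_l w l * v l).
  apply: eq_bigr => l _; congr (_ * _).
  by have := congr1 (fun M : 'cV[F]_d => M l 0) wc; rewrite !mxE.
under [RHS]eq_bigr => l _ do rewrite /w /= mulr_suml.
rewrite [RHS]exchange_big /=; apply: eq_bigr => i _.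
under [RHS]eq_bigr do rewrite mulr_suml.
rewrite [RHS]exchange_big /=; apply: eq_bigr => j _.
rewrite -mulrA mv mulr_sumr; by apply: eq_bigr => l _; rewrite mulrA.
Qed.

Section Affinoid.
Variables (R : realType) (k : closedFieldType) (p : nat) (av : k -> R).
Hypothesis hav : complete_padic_av p av.
Let hum := av_um hav.

Lemma horner_le (P : {poly k}) x : av x <= 1 -> av P.[x] <= gauss av 0 1 P.
Proof.
move=> x1; rewrite -(gauss_eval hav); apply: (berk_le_gauss hav) => //.
  exact: (gauss_berk_line hav).
by rewrite (gauss_XsubC hav) // subr0 ge_max ler01.
Qed.

(** The Lipschitz constant is the Gauss norm, since the non-constant terms of
    the expansion at [x'] are divisible by [x - x']. *)
Lemma horner_lip (P : {poly k}) x x' : av x <= 1 -> av x' <= 1 ->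
  av (P.[x] - P.[x']) <= gauss av 0 1 P * av (x - x').
Proof.
move=> x1 x'1; set t := av (x - x').
have t0 : 0 <= t := av_ge0 hav _.
have t1 : t <= 1 by apply: le_trans (umB hum _ _) _; rewrite ge_max x1.
have K0 : 0 <= gauss av 0 1 P := um_ge0 (gauss_um hav ler01 0) P.
have -> : P.[x] - P.[x'] = (P - (P.[x'])%:P).[x] by rewrite hornerD hornerN hornerC.
rewrite -(gauss_eval hav).
apply: (@le_trans _ _ (gauss av x' t (P - (P.[x'])%:P))).
  apply: (berk_le_gauss hav) => //; first exact: (gauss_berk_line hav).
  by rewrite (gauss_XsubC hav) // ge_max t0 lexx.
apply: gauss0_le => [|[|i]]; first exact: mulr_ge0.
  by rewrite coef_gauss_sub (av0 hav) mul0r mulr_ge0.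
rewrite coef_gauss_sub; apply: ler_pM; rewrite ?(av_ge0 hav) ?exprn_ge0 //.
  rewrite -(@gauss_eq _ _ _ _ hav x' 0) // ?subr0 //.
  have := gauss0_coef hav 1 (P \Po ('X + x'%:P)) i.+1.
  by rewrite coef_comp_XaddC expr1n mulr1.
by rewrite exprS; apply: ler_piMr => //; apply: exprn_ile1.
Qed.

Section Functions.
Variable X : set k.
Hypothesis X1 : forall x, X x -> av x <= 1.
Let aff := affinoid_fun av X.

Lemma aff_poly P : aff (fun x => P.[x]).
Proof. by move=> e e0; exists P => x _; rewrite subrr (av0 hav) ltW. Qed.

Lemma aff_ext g h : g =1 h -> aff g -> aff h.
Proof. by move=> /funext ->. Qed.

Lemma aff_cst c : aff (fun=> c).
Proof. by apply: (aff_ext _ (aff_poly c%:P)) => x; rewrite hornerC. Qed.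

Lemma aff_bounded g : aff g -> exists2 K, 0 < K & forall x, X x -> av (g x) <= K.
Proof.
move=> /(_ 1 ltr01)[P hP]; exists (Num.max 1 (gauss av 0 1 P)) => [|x Xx].
  by rewrite lt_max ltr01.
rewrite -(subrK P.[x] (g x)); apply: le_trans (umD hum _ _) _.
by rewrite ge_max !le_max hP //= horner_le ?orbT // X1.
Qed.

Lemma affD g h : aff g -> aff h -> aff (fun x => g x + h x).
Proof.
move=> hg hh e e0; have [P hP] := hg e e0; have [Q hQ] := hh e e0.
exists (P + Q) => x Xx; rewrite hornerD opprD addrACA.
by apply: le_trans (umD hum _ _) _; rewrite ge_max hP ?hQ.
Qed.

Lemma affM g h : aff g -> aff h -> aff (fun x => g x * h x).
Proof.
move=> hg hh e e0; have [K K0 hK] := aff_bounded hg.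
have [Q hQ] := hh (e / K) (divr_gt0 e0 K0).
pose L := Num.max 1 (gauss av 0 1 Q).
have L0 : 0 < L by rewrite lt_max ltr01.
have [P hP] := hg (e / L) (divr_gt0 e0 L0).
exists (P * Q) => x Xx; rewrite hornerM.
have -> : g x * h x - P.[x] * Q.[x] = g x * (h x - Q.[x]) + (g x - P.[x]) * Q.[x].
  by rewrite mulrBr mulrBl addrA subrK.
apply: le_trans (umD hum _ _) _; rewrite !(umM hum) ge_max; apply/andP; split.
  by rewrite -[e](divfK (lt0r_neq0 K0)) mulrC ler_pM ?(av_ge0 hav) ?hK ?hQ.
rewrite -[e](divfK (lt0r_neq0 L0)) ler_pM ?(av_ge0 hav) ?hP //.
by rewrite le_max horner_le ?orbT // X1.
Qed.

Lemma aff_sum (I : Type) (r : seq I) (C : pred I) (F : I -> k -> k) :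
  (forall i, aff (F i)) -> aff (fun x => \sum_(i <- r | C i) F i x).
Proof.
move=> h; elim: r => [|i r IH].
  by apply: (aff_ext _ (aff_cst 0)) => x; rewrite big_nil.
case: (boolP (C i)) => Ci; last by apply: (aff_ext _ IH) => x; rewrite big_cons (negPf Ci).
by apply: (aff_ext _ (affD (h i) IH)) => x; rewrite big_cons Ci.
Qed.

Lemma aff_prod (I : Type) (r : seq I) (C : pred I) (F : I -> k -> k) :
  (forall i, aff (F i)) -> aff (fun x => \prod_(i <- r | C i) F i x).
Proof.
move=> h; elim: r => [|i r IH].
  by apply: (aff_ext _ (aff_cst 1)) => x; rewrite big_nil.
case: (boolP (C i)) => Ci; last by apply: (aff_ext _ IH) => x; rewrite big_cons (negPf Ci).
by apply: (aff_ext _ (affM (h i) IH)) => x; rewrite big_cons Ci.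
Qed.

Lemma aff_det n (A : k -> 'M[k]_n) : (forall i j, aff (fun x => A x i j)) ->
  aff (fun x => \det (A x)).
Proof.
move=> h; apply: aff_sum => s; apply: affM; first exact: aff_cst.
by apply: aff_prod => i; apply: h.
Qed.

(** The inverse of the trace form consists of analytic functions, and is
    therefore bounded. *)
Lemma aff_adj n (A : k -> 'M[k]_n) i j : (forall i j, aff (fun x => A x i j)) ->
  aff (fun x => (\adj (A x)) i j).
Proof.
move=> h; apply: (@aff_ext (fun x => cofactor (A x) j i)) => [x|]; first by rewrite mxE.
apply: affM; first exact: aff_cst; apply: aff_det => a b.
by apply: (aff_ext _ (h (lift j a) (lift i b))) => x; rewrite !mxE.
Qed.

Definition affmx a b (A : k -> 'M[k]_(a, b)) := forall i j, aff (fun x => A x i j).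

Lemma affmx_mul a b c (A : k -> 'M[k]_(a, b)) (B : k -> 'M[k]_(b, c)) :
  affmx A -> affmx B -> affmx (fun x => A x *m B x).
Proof.
move=> hA hB i j.
apply: (@aff_ext (fun x => \sum_l A x i l * B x l j)) => [x|]; first by rewrite mxE.
by apply: aff_sum => l; apply: affM.
Qed.

Lemma affmx_cst a b (A : 'M[k]_(a, b)) : affmx (fun=> A).
Proof. by move=> i j; apply: aff_cst. Qed.

Lemma affmx_scale a b c (A : k -> 'M[k]_(a, b)) :
  aff c -> affmx A -> affmx (fun x => c x *: A x).
Proof.
move=> hc hA i j; apply: (@aff_ext (fun x => c x * A x i j)) => [x|]; first by rewrite mxE.
exact: affM.
Qed.

Lemma affmx_sub a b (A B : k -> 'M[k]_(a, b)) :
  affmx A -> affmx B -> affmx (fun x => A x - B x).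
Proof.
move=> hA hB i j; apply: (@aff_ext (fun x => A x i j + (-1) * B x i j)) => [x|].
  by rewrite !mxE mulN1r.
by apply: affD => //; apply: affM => //; apply: aff_cst.
Qed.

Lemma affmx_sum a b (I : Type) (r : seq I) (A : I -> k -> 'M[k]_(a, b)) :
  (forall l, affmx (A l)) -> affmx (fun x => \sum_(l <- r) A l x).
Proof.
move=> hA i j; apply: (@aff_ext (fun x => \sum_(l <- r) A l x i j)) => [x|].
  by rewrite summxE.
by apply: aff_sum => l; apply: hA.
Qed.

Lemma aff_ucont g : aff g -> forall e, 0 < e -> exists2 r, 0 < r &
  forall x x', X x -> X x' -> av (x - x') <= r -> av (g x - g x') <= e.
Proof.
move=> hg e e0; have [P hP] := hg e e0; pose L := Num.max 1 (gauss av 0 1 P).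
have L0 : 0 < L by rewrite lt_max ltr01.
exists (e / L) => [|x x' Xx Xx' hxx]; first exact: divr_gt0.
have -> : g x - g x' = (g x - P.[x]) - (g x' - P.[x']) + (P.[x] - P.[x']).
  by ring.
apply: le_trans (umD hum _ _) _; rewrite ge_max; apply/andP; split.
  by apply: le_trans (umB hum _ _) _; rewrite ge_max !hP.
apply: le_trans (horner_lip _ (X1 Xx) (X1 Xx')) _.
rewrite -[e](divfK (lt0r_neq0 L0)) mulrC ler_pM ?(av_ge0 hav) //.
  exact: um_ge0 (gauss_um hav ler01 0) P.
by rewrite le_max lexx orbT.
Qed.

End Functions.

Lemma fin_max (d : nat) (P : 'I_d -> R -> Prop) :
  (forall i K K', K <= K' -> P i K -> P i K') -> (forall i, exists K, P i K) ->
  exists2 K, 0 < K & forall i, P i K.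
Proof.
move=> mono /choice[K hK]; exists (1 + \sum_i `|K i|) => [|i].
  by rewrite ltr_wpDr // sumr_ge0.
apply: mono (hK i); rewrite (bigD1 i) //= addrCA.
by rewrite (le_trans (ler_norm _)) // lerDl addr_ge0 // sumr_ge0.
Qed.

Lemma fin_min (d : nat) (P : 'I_d -> R -> Prop) :
  (forall i r r', r' <= r -> P i r -> P i r') -> (forall i, exists2 r, 0 < r & P i r) ->
  exists2 r, 0 < r & forall i, P i r.
Proof.
move=> mono h; have /choice[r hr] : forall i, exists r, 0 < r /\ P i r.
  by move=> i; have [r] := h i; exists r.
exists (\big[Num.min/1]_i r i) => [|i].
  by apply: lt_bigmin => [|i _]; [exact: ltr01|case: (hr i)].
by apply: mono (hr i).2; apply: (bigmin_inf i).
Qed.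

(** The function of [trace_form_diagonal] takes the values [1] at [(x, x)] and
    [0] at [(x, x')], if [x] and [x'] are distinct points of a fibre.  As the
    functions [e i] are uniformly continuous and the coefficients are bounded,
    [x] and [x'] cannot be too close. *)
Theorem etale_separated (X Y : set k) (phi : k -> k) d :
  (forall x, X x -> av x <= 1) -> (forall y, Y y -> av y <= 1) ->
  (forall x, X x -> Y (phi x)) -> finite_etale_algebra av X Y phi d ->
  exists2 r, 0 < r & forall x x', X x -> X x' -> phi x = phi x' ->
    av (x - x') <= r -> x = x'.
Proof.
move=> X1 Y1 XY [e [m [he gen free [hm hmul] [u hu hdet]]]].
pose t y := \matrix_(i, j) \tr (m i y *m m j y).
pose dual y i j := u y * (\adj (t y)) i j.
pose ev x : 'cV[k]_d := \col_i e i x.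
have mev i x : X x -> m i (phi x) *m ev x = e i x *: ev x.
  move=> Xx; apply/matrixP => a b; rewrite !mxE hmul //; apply: eq_bigr => l _.
  by rewrite !mxE.
have mfree (A : k -> 'M[k]_d) : affmx Y A ->
    (forall x, X x -> A (phi x) *m ev x = 0) -> forall y, Y y -> A y = 0.
  move=> hA h y Yy; apply/matrixP => i j; rewrite mxE.
  apply: (free (fun j y => A y i j)) => // x Xx.
  have := congr1 (fun M : 'cV[k]_d => M i 0) (h x Xx); rewrite !mxE => h'.
  by rewrite -[RHS]h'; apply: eq_bigr => l _; rewrite mxE.
have mulE y i j : Y y -> m i y *m m j y = \sum_l m i y j l *: m l y.
  move=> Yy; apply/eqP; rewrite -subr_eq0; apply/eqP; move: y Yy.
  apply: mfree => [|x Xx].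
    apply: (affmx_sub Y1); first exact: (affmx_mul Y1).
    by apply: affmx_sum => l; apply: (affmx_scale Y1).
  rewrite mulmxBl -mulmxA mev // -scalemxAr mev // scalerA mulmx_suml.
  rewrite [e j x * _]mulrC hmul // scaler_suml -sumrB big1 // => l _.
  by rewrite -scalemxAl mev // scalerA subrr.
have mulC y i j : Y y -> m i y *m m j y = m j y *m m i y.
  move=> Yy; apply/eqP; rewrite -subr_eq0; apply/eqP; move: y Yy.
  apply: mfree => [|x Xx].
    by apply: (affmx_sub Y1); apply: (affmx_mul Y1).
  by rewrite mulmxBl -!mulmxA !mev // -!scalemxAr !mev // !scalerA mulrC subrr.
have [c hc ec] := gen _ (aff_cst X 1).
have one y : Y y -> \sum_l c l y *: m l y = 1%:M.
  move=> Yy; apply/eqP; rewrite -subr_eq0; apply/eqP; move: y Yy.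
  apply: mfree => [|x Xx].
    apply: (affmx_sub Y1); last exact: affmx_cst.
    by apply: affmx_sum => l; apply: (affmx_scale Y1).
  rewrite mulmxBl mul1mx mulmx_suml.
  under eq_bigr do rewrite -scalemxAl mev // scalerA.
  by rewrite -scaler_suml -ec // scale1r subrr.
have [b hb eb] := gen _ (aff_poly X 'X).
have tU y : Y y -> t y \in unitmx.
  by move=> Yy; apply/unitrPr; exists (u y); apply: hdet.
have tinv y i j : Y y -> invmx (t y) i j = dual y i j.
  move=> Yy; have dn : \det (t y) != 0 by have := tU y Yy; rewrite unitmxE unitfE.
  rewrite /invmx tU // mxE /dual; congr (_ * _).
  by apply: (mulfI dn); rewrite divff // hdet.
have diag x x' : X x -> X x' -> phi x = phi x' -> x != x' ->
    \sum_i \sum_j dual (phi x) i j * e i x * (e j x - e j x') = 1.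
  move=> Xx Xx' exx' nx; have Yy := XY x Xx.
  have [] := @trace_form_diagonal _ d (fun i => m i (phi x)) (fun i => c i (phi x))
    (fun i => e i x) (fun i => e i x') (fun i j => mulE _ i j Yy)
    (fun i j => mulC _ i j Yy) (one _ Yy) (tU _ Yy).
  - by move=> i j; rewrite hmul.
  - by move=> i j; rewrite exx' hmul.
  - by rewrite -ec.
  move=> d1 d2.
  have ne : exists i, e i x != e i x'.
    apply: contrapT => h; move/eqP: nx; apply.
    have ebx := eb x Xx; have ebx' := eb x' Xx'; rewrite !hornerX in ebx ebx'.
    rewrite ebx ebx' exx'; apply: eq_bigr => i _; congr (_ * _).
    by apply/eqP/negPn/negP => ne; apply: h; exists i.
  have := congr2 (fun a b => a - b) d1 (d2 ne); rewrite subr0 => <-.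
  rewrite -sumrB; apply: eq_bigr => i _; rewrite -sumrB; apply: eq_bigr => j _.
  by rewrite tinv // mulrBr.
have [K K0 hK] : exists2 K, 0 < K & forall i, (fun i K => forall j x, X x ->
    av (dual (phi x) i j * e i x) <= K) i K.
  apply: fin_max => [i K K' le h j x Xx|i]; first exact: le_trans (h j x Xx) le.
  suff [K _ hK] : exists2 K, 0 < K & forall j, (fun j K => forall x, X x ->
    av (dual (phi x) i j * e i x) <= K) j K by exists K.
  apply: fin_max => [j K K' le h x Xx|j]; first exact: le_trans (h x Xx) le.
  have hd : affinoid_fun av Y (fun y => dual y i j).
    apply: (affM Y1) => //; apply: (aff_adj Y1) => a b'.
    apply: (@aff_ext _ (fun y => \sum_l (m a y *m m b' y) l l)); first by move=> y; rewrite mxE.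
    by apply: aff_sum => l; apply: (affmx_mul Y1).
  have [K1 K10 hK1] := aff_bounded Y1 hd; have [K2 K20 hK2] := aff_bounded X1 (he i).
  by exists (K1 * K2) => x Xx; rewrite (umM hum) ler_pM ?(av_ge0 hav) ?hK1 ?hK2 //; apply: XY.
have e0 : 0 < K^-1 / 2 by rewrite divr_gt0 ?invr_gt0.
have [r r0 hr] : exists2 r, 0 < r & forall j, (fun j r => forall x x', X x -> X x' ->
    av (x - x') <= r -> av (e j x - e j x') <= K^-1 / 2) j r.
  apply: fin_min => [j r r' le h x x' Xx Xx' hx|j]; last exact: (aff_ucont X1 (he j) e0).
  by apply: h => //; apply: le_trans le.
exists r => // x x' Xx Xx' exx' close; apply/eqP/negPn/negP => nx.
have := um1 hum; rewrite -(diag x x') // => h.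
have : av (\sum_i \sum_j dual (phi x) i j * e i x * (e j x - e j x')) <= 2^-1.
  apply: (um_sum_le hum) => // i _; apply: (um_sum_le hum) => // j _.
  rewrite (umM hum) -[2^-1](mulVKf (lt0r_neq0 K0)) ler_pM ?(av_ge0 hav) ?hK ?hr //.
by rewrite h leNgt invf_lt1 ?ltr1n.
Qed.

End Affinoid.

(** * Fibres of etale morphisms *)

Lemma small_power (R : realType) (q e : R) : 0 <= q -> q < 1 -> 0 < e ->
  exists N, forall n, (N <= n)%N -> q ^+ n < e.
Proof.
move=> q0 q1 e0; have := @cvg_expr _ q; rewrite ger0_norm // => /(_ q1).
by move=> /(cvg0_eps (fun n => exprn_ge0 n q0))/(_ _ e0).
Qed.

Section Etale.
Variables (R : realType) (k : closedFieldType) (p : nat) (av : k -> R).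
Hypothesis hp : prime p.
Hypothesis hav : complete_padic_av p av.
Let hum := av_um hav.

(** Translates of large powers of [p]. *)
Lemma infinite_ball (x0 : k) (r : R) (s : seq k) : 0 < r ->
  exists2 x, av (x - x0) <= r & x \notin s.
Proof.
move=> r0; have q0 := av_p_gt0 hav hp; have q1 := av_p_lt1 hav hp.
have [N hN] := small_power (ltW q0) q1 r0.
apply: contrapT => h; pose x j : k := x0 + p%:R ^+ (N + j).
have sub : {subset map x (iota 0 (size s).+1) <= s}.
  move=> _ /mapP[j _ ->]; apply/negPn/negP => ns; apply: h; exists (x j) => //.
  by rewrite /x addrAC subrr add0r (umX hum) ltW // hN // leq_addr.
suff u : uniq (map x (iota 0 (size s).+1)).
  by have := uniq_leq_size u sub; rewrite size_map size_iota ltnn.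
rewrite map_inj_in_uniq ?iota_uniq // => i j _ _ /addrI e.
have := congr1 av e; rewrite !(umX hum) => /ieexprIn e'.
by apply/eqP; rewrite -(eqn_add2l N); apply/eqP; apply: e' => //; rewrite lt_eqF.
Qed.

Lemma ncount_card n (z : k -> 'I_n -> k) a y (t : R) :
  ncount (dists av z a y) t = #|[pred i | av (a - z y i) <= t]|.
Proof. by rewrite /ncount count_map -sum1_card -sum1_count. Qed.

Variables (f : nat -> k) (d : nat).
Hypothesis fet : finite_etale av f d.
Let ff : finite_morphism av f := finite_etale_morphism fet.
Let hf : disc_fun av f := ff.1.1.
Variables (n : nat) (z : k -> 'I_n -> k).
Hypothesis hz : fibre_family av f z.
Let fe a := feval av f a.

(** Multiplicities are conserved: for [x] close to a double point [x0] of the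
    fibre over [y0], the fibre of [x] has at least two points, counted with
    multiplicity, as close to [x0] as [x] is.  By [etale_separated] they all
    coincide with [x], which therefore is a double point.  Then the profile at
    [x] is at most [u ^ 2], and its linear coefficient vanishes. *)
Lemma double_point_spread y0 i j : av y0 < 1 -> i != j -> z y0 i = z y0 j ->
  exists2 r, 0 < r < 1 & forall x, av (x - z y0 i) <= r -> taylor av f x 1 = 0.
Proof.
move=> y01 ij eij; set x0 := z y0 i.
have x01 : av x0 < 1 := fibre_disc hz i y01.
have fx0 : fe x0 = y0 := feval_fibre hav ff hz i y01.
pose r := (av y0 + 1) / 2.
have y0r : av y0 < r by rewrite midf_lt.
have r1 : r < 1 by rewrite midf_lt.
have r0 : 0 < r := le_lt_trans (av_ge0 hav _) y0r.
have [_ fea] : (0 < r < 1) /\ finite_etale_algebra av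
    (kdisc av `&` fe @^-1` kcdisc av 0 r) (kcdisc av 0 r) fe d.
  by split; [rewrite r0|case: (fet.2 r _); rewrite ?r0].
have X1 x : (kdisc av `&` fe @^-1` kcdisc av 0 r) x -> av x <= 1 by case=> /ltW.
have Y1 y : kcdisc av 0 r y -> av y <= 1.
  by rewrite /kcdisc /= subr0 => h; apply: le_trans h (ltW r1).
have [e e0 he] := etale_separated hav X1 Y1 (fun x h => h.2) fea.
pose w := Num.min e r.
have [we wr] : w <= e /\ w <= r by rewrite !ge_min !lexx orbT.
have w0 : 0 < w by rewrite lt_min e0.
have w1 : w < 1 := le_lt_trans wr r1.
exists w; first by rewrite w0.
move=> x hx; have x1 : av x < 1.
  rewrite -(subrK x0 x); apply: le_lt_trans (umD hum _ _) _.
  by rewrite gt_max x01 (le_lt_trans hx).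
have fx1 : av (fe x) < 1 := feval_disc hav ff x1.
have inX : (kdisc av `&` fe @^-1` kcdisc av 0 r) x.
  split=> //=; rewrite /kcdisc /= subr0 -(subrK y0 (fe x)).
  apply: le_trans (umD hum _ _) _; rewrite ge_max (ltW y0r) andbT -fx0.
  by apply: le_trans (feval_lip hav ff hz x1 x01) _; apply: le_trans hx wr.
set t := av (x - x0); have t0 : 0 <= t := av_ge0 hav _.
have t1 : t < 1 := le_lt_trans hx w1.
have tv : t < (t + 1) / 2 by rewrite midf_lt.
have v1 : (t + 1) / 2 < 1 by rewrite midf_lt.
(* on the interval from [t] on, [|f - f x|] and [|f - y0|] agree at the Gauss
   points around [x0] *)
have cnt : ncount (dists av z x0 (fe x)) t = ncount (dists av z x0 y0) t.
  apply: (@ncount_eq _ _ _ 1 1 _ _ t0 tv) => // u /andP[tu uv].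
  have u0 : 0 <= u := le_trans t0 tu; have u1 : u < 1 := le_lt_trans uv v1.
  rewrite !mul1r -(push_gauss_maxprod hav hz) // (push_gauss hav ff hz) //.
  have xx0 : av (x0 - x) <= u by rewrite (umBC hum).
  have [_ h] := prof_near hav ff hz x01 x1 u0 u1 xx0.
  rewrite (gauss_XsubC hav) ?prof_ge0 // max_l //.
  by rewrite /prof -/(fe _) fx0.
have gt1 : (1 < ncount (dists av z x0 (fe x)) t)%N.
  rewrite cnt ncount_card; apply/card_gt1P; exists i, j.
  by rewrite !inE -eij -/x0 subrr (av0 hav).
move: gt1; rewrite ncount_card => /card_gt1P[i' [j' []]]; rewrite !inE => hi hj nij.
have dbl l : av (x0 - z (fe x) l) <= t -> z (fe x) l = x.
  move=> hl; have zx : av (z (fe x) l) < 1 := fibre_disc hz l fx1.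
  have fz : fe (z (fe x) l) = fe x := feval_fibre hav ff hz l fx1.
  apply: he => //; first by split=> //; rewrite /= fz; case: inX.
  rewrite (umBC hum) (_ : _ - _ = (x - x0) + (x0 - z (fe x) l)); last by rewrite addrA subrK.
  apply: le_trans (umD hum _ _) _; rewrite ge_max (le_trans hx we) /=.
  by apply: le_trans hl _; apply: le_trans hx we.
have small u : 0 < u -> u < 1 -> av (taylor av f x 1) <= u.
  move=> u0 u1; have [h _] := prof_taylor hav ff hz x1 u0 u1.
  have := h 1%N isT; rewrite expr1 => h1; rewrite -(ler_pM2r u0); apply: (le_trans h1).
  rewrite /prof /maxprod big_map (bigD1 i') //= (bigD1 j') 1?eq_sym //=.
  rewrite (dbl i' hi) (dbl j' hj) subrr (av0 hav) max_l ?(ltW u0) // mulrA.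
  apply: ler_piMr; first by rewrite mulr_ge0 // ltW.
  apply: prodr_ile1 => l _; rewrite le_max (ltW u0) ge_max (ltW u1) /=.
  apply: le_trans (umB hum _ _) _; rewrite ge_max (ltW x1) /=.
  exact: (ltW (fibre_disc hz l fx1)).
apply/eqP/negPn/negP => T0; have Tp : 0 < av (taylor av f x 1) by rewrite (av_gt0 hav).
pose u := Num.min (av (taylor av f x 1)) 1 / 2.
have m0 : 0 < Num.min (av (taylor av f x 1)) 1 by rewrite lt_min Tp ltr01.
have um : u < Num.min (av (taylor av f x 1)) 1 by rewrite ltr_pdivrMr // ltr_pMr // ltr1n.
have u0 : 0 < u by rewrite divr_gt0.
move: um; rewrite lt_min => /andP[h1 h2].
by have := small u u0 h2; rewrite leNgt h1.
Qed.

(** Otherwise the derivative of [f] vanishes on a disc by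
    [double_point_spread], whereas by [weierstrass] a nonzero power series has
    finitely many zeros there; the derivative is not zero, as the
    characteristic is zero and [f] is not constant. *)
Theorem etale_fibre_inj y : av y < 1 -> injective (z y).
Proof.
move=> y1 i j eij; apply/eqP/negPn/negP => ij.
have [r /andP[r0 r1] hr] := double_point_spread y1 ij eij.
set x0 := z y i in hr; have x01 : av x0 < 1 := fibre_disc hz i y1.
(* the coefficients of the derivative *)
pose h l : k := l.+1%:R * f l.+1; pose s := Num.max (av x0) r.
have s0 : 0 < s by rewrite lt_max r0 orbT.
have s1 : s < 1 by rewrite gt_max x01.
have hge (g : nat -> k) l : 0 <= av (g l) * s ^+ l.
  by rewrite mulr_ge0 ?(av_ge0 hav) // exprn_ge0 // ltW.
have s01 : 0 < s < 1 by rewrite s0.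
have hc : (fun l => av (h l) * s ^+ l) @ \oo --> (0 : R).
  apply/(cvg0_eps (hge h)) => e e0.
  have [N hN] := (cvg0_eps (hge f)).1 (hf s01) _ (mulr_gt0 e0 s0).
  exists N => l Nl; have := hN l.+1 (leqW Nl); rewrite exprSr mulrA ltr_pM2r //.
  apply: le_lt_trans; rewrite ler_wpM2r ?exprn_ge0 ?(ltW s0) // (umM hum).
  by apply: ler_piMl; [exact: av_ge0 hav _|exact: av_nat_le1 hav _].
have hn : exists l, h l != 0.
  have [[//|l] _ fl] := finite_nonconstant hav ff; exists l.
  by rewrite mulf_neq0 // (natr_k_neq0 hav hp).
have [c [rs [c0 hrs hx]]] := weierstrass hav s0 hc hn.
have [x hxr nx] := infinite_ball x0 rs r0.
have xs : av x <= s.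
  rewrite -(subrK x0 x); apply: le_trans (umD hum _ _) _.
  by rewrite ge_max !le_max lexx hxr orbT.
have x1 : av x < 1 := le_lt_trans xs s1.
have xd : berk_cdisc av 0 s (gauss av x 0) by apply: (gauss_berk_cdisc hav) => //; apply: ltW.
have l1 := hx _ xd.
have l2 : (fun m => gauss av x 0 (\poly_(l < m) h l)) @ \oo --> (0 : R).
  apply/cvg_eps => e e0.
  have [N hN] := (av_cvgP hav _ _).1 (taylor_cvg hav ff 1 x1) _ e0.
  exists N => m Nm; rewrite subr0 ger0_norm ?(um_ge0 (gauss_um hav (lexx 0) x)) //.
  have := hN m.+1 (leqW Nm); rewrite hr // subr0 (gauss_eval hav).
  rewrite (_ : (partial f m.+1)^`N(1) = \poly_(l < m) h l) //.
  apply/polyP => l; rewrite coef_nderivn !coef_poly add1n ltnS bin1 /h mulr_natl.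
  by case: ifP; rewrite ?mul0rn.
have : c * \prod_(z <- rs) gauss av x 0 ('X - z%:P) == 0.
  by apply/eqP; exact: (cvg_unique (@Rhausdorff R) l1 l2).
rewrite mulf_eq0 gt_eqF //=.
rewrite prodf_seq_eq0 => /hasP[a ars /=]; rewrite (gauss_XsubC hav) //.
rewrite max_r ?(av_ge0 hav) // => /eqP e0; have e := av_eq0_sub hav e0.
by move: nx; rewrite e ars.
Qed.

End Etale.

(** * Counting the points of a fibre *)

Lemma card_range_classes (I : finType) (T : Type) (g : I -> T) (h : I -> {set I}) :
  (forall i j, g i = g j <-> h i = h j) ->
  ([set g i | i in [set: I]] #= `I_#|[set h i | i : I]%SET|)%card.
Proof.
move=> gh; pose C := [set h i | i : I]%SET.
have hC i : h i \in C by apply: imset_f.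
have [phi hphi] : exists phi : T -> nat, forall i, phi (g i) = index (h i) (enum C).
  (* number the elements of the range by the position of their class *)
  have /choice[phi hphi] : forall a, exists m, forall i, g i = a -> m = index (h i) (enum C).
    move=> a; have [[i gi]|no] := pselect (exists i, g i = a); last first.
      by exists 0%N => i gi; case: no; exists i.
    by exists (index (h i) (enum C)) => j; rewrite -gi => /gh ->.
  by exists phi => i; apply: hphi.
have inj : {in [set g i | i in [set: I]] &, injective phi}.
  move=> _ _ /set_mem[i _ <-] /set_mem[j _ <-]; rewrite !hphi => e; apply/gh.
  have nth_h l : nth finset.set0 (enum C) (index (h l) (enum C)) = h l.
    by rewrite nth_index // mem_enum.
  by rewrite -(nth_h i) -(nth_h j) e.
rewrite card_eq_sym; apply: card_eq_trans (inj_card_eq inj).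
suff -> : [set phi x | x in [set g i | i in [set: I]]] = `I_#|C| by [].
rewrite cardE; apply/seteqP; split => [_ [_ [i _ <-] <-]|m /= mC].
  by rewrite hphi /= index_mem mem_enum.
have : nth finset.set0 (enum C) m \in C by rewrite -mem_enum mem_nth.
move=> /imsetP[i _ e]; exists (g i); first by exists i.
by rewrite hphi -e index_uniq // enum_uniq.
Qed.

Section Classes.
Variables (R : realType) (k : closedFieldType) (p : nat) (av : k -> R).
Hypothesis hav : complete_padic_av p av.
Let hum := av_um hav.

Section Points.
Variables (n : nat) (c : 'I_n -> k).

Definition ball_class (t : R) (i : 'I_n) : {set 'I_n} := [set j | av (c i - c j) <= t]%SET.
Definition nclasses (t : R) : nat := #|[set ball_class t i | i : 'I_n]%SET|.
Definition mutual_dists (i : 'I_n) : seq R := [seq av (c i - c j) | j <- index_enum 'I_n].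

Lemma ball_class_refl t i : 0 <= t -> i \in ball_class t i.
Proof. by move=> t0; rewrite inE subrr (av0 hav). Qed.

Lemma ball_class_eq t i j : 0 <= t -> (ball_class t i = ball_class t j) <-> av (c i - c j) <= t.
Proof.
move=> t0; split=> [e|ij].
  by have := ball_class_refl j t0; rewrite -e inE.
apply/setP => l; rewrite !inE; apply/idP/idP => h.
  rewrite (_ : _ - _ = (c i - c l) - (c i - c j)); last by ring.
  by apply: le_trans (umB hum _ _) _; rewrite ge_max h.
rewrite (_ : _ - _ = (c i - c j) + (c j - c l)); last by rewrite addrA subrK.
by apply: le_trans (umD hum _ _) _; rewrite ge_max h ij.
Qed.

Lemma card_ball_class t i : #|ball_class t i| = ncount (mutual_dists i) t.
Proof. by rewrite /ncount count_map -sum1_card -sum1_count; apply: eq_bigl => j; rewrite inE. Qed.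

Lemma classes_partition t : 0 <= t ->
  finset.partition [set ball_class t i | i : 'I_n]%SET [set: 'I_n]%SET.
Proof.
move=> t0; apply/and3P; split.
- rewrite finset.eqEsubset finset.subsetT /=; apply/fintype.subsetP => i _; apply/finset.bigcupP.
  by exists (ball_class t i); rewrite ?ball_class_refl // imset_f.
- apply/finset.trivIsetP => _ _ /imsetP[i _ ->] /imsetP[j _ ->]; apply: contraR => /pred0Pn[l].
  rewrite /= => /andP[]; rewrite [l \in _]inE => il; rewrite inE => jl.
  by apply/eqP; rewrite ((ball_class_eq i l t0).2 il) ((ball_class_eq j l t0).2 jl).
by apply/imsetP => -[i _ e]; have := ball_class_refl i t0; rewrite -e inE.
Qed.

Lemma sum_classes t : 0 <= t -> \sum_(B in [set ball_class t i | i : 'I_n]%SET) #|B| = n.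
Proof. by move=> t0; rewrite -(card_partition (classes_partition t0)) cardsT card_ord. Qed.

Lemma uniform_classes t m : 0 <= t -> (forall i, #|ball_class t i| = m) -> (nclasses t * m)%N = n.
Proof.
move=> t0 h; rewrite -[RHS](sum_classes t0) (eq_bigr (fun _ => m)).
  by rewrite sum_nat_const.
by move=> _ /imsetP[i _ ->].
Qed.

Lemma nclasses_gt0 t : (0 < n)%N -> (0 < nclasses t)%N.
Proof.
by move=> n0; apply/card_gt0P; exists (ball_class t (Ordinal n0)); apply: imset_f.
Qed.

End Points.

(** The sizes of the classes add up to [n] in both cases. *)
Lemma classes_rigid n (c c' : 'I_n -> k) (t : R) m : 0 <= t ->
  (forall i, #|ball_class c t i| = m) -> (forall i, m <= #|ball_class c' t i|)%N ->
  nclasses c t = nclasses c' t -> forall i, #|ball_class c' t i| = m.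
Proof.
move=> t0 h h' e i; apply/eqP; rewrite eqn_leq h' andbT leqNgt; apply/negP => lt.
have e2 := sum_classes c' t0.
have e1 : (\sum_(B in [set ball_class c' t i | i : 'I_n]%SET) m)%N = n.
  by rewrite sum_nat_const -/(nclasses c' t) -e (uniform_classes t0 h).
suff : (n < n)%N by rewrite ltnn.
rewrite -{1}e1 -[X in (_ < X)%N]e2.
rewrite (bigD1 (ball_class c' t i)) ?imset_f //= [X in (_ < X)%N](bigD1 (ball_class c' t i)) ?imset_f //=.
rewrite -addSn leq_add // leq_sum // => B /andP[/imsetP[j _ ->] _].
exact: h'.
Qed.

(** Of two monomials agreeing at [s], the smaller one on the left of [s] has the
    larger exponent. *)
Lemma monomial_step (t s : R) C C' (m m' : nat) : 0 < t -> t < s -> 0 < C -> 0 < C' ->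
  C * s ^+ m = C' * s ^+ m' -> C' * t ^+ m' <= C * t ^+ m -> (m <= m')%N.
Proof.
move=> t0 ts C0 C'0 es; rewrite leqNgt => le; apply/negP => lt; move: le.
have s0 : 0 < s := lt_trans t0 ts.
rewrite leNgt => /negP; apply.
have eC : C * s ^+ (m - m') = C'.
  apply: (mulIf (lt0r_neq0 (exprn_gt0 m' s0))).
  by rewrite -mulrA -exprD subnK // ltnW.
rewrite -eC -mulrA ltr_pM2l // -{1}(subnK (ltnW lt)) exprD ltr_pM2r ?exprn_gt0 //.
by rewrite ltr_pXn2r ?subn_gt0 ?nnegrE ?(ltW t0) ?(ltW s0).
Qed.

(** Between [t] and [s] all the functions are monomials, whose exponents are the
    sizes of the classes.  Those attached to [c'] are at most those attached to
    [c], hence have exponents at least as large; [classes_rigid] makes them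
    equal. *)
Theorem class_count_step n (c c' : 'I_n -> k) (t s r S : R) : (0 < n)%N -> 0 < t -> t < s ->
  (forall i, gap (mutual_dists c i) t s) -> (forall i, gap (mutual_dists c' i) t s) ->
  (forall i, maxprod (mutual_dists c i) s = S) -> (forall i, maxprod (mutual_dists c' i) s = S) ->
  (forall i, maxprod (mutual_dists c i) t = r) -> (forall i, maxprod (mutual_dists c' i) t <= r) ->
  nclasses c t = nclasses c' t -> forall i, maxprod (mutual_dists c' i) t = r.
Proof.
move=> n0 t0 ts g g' eS eS' er ler eN.
have tge0 := ltW t0; have tles := ltW ts.
pose i0 := Ordinal n0; pose m := ncount (mutual_dists c i0) t.
have K0 cs : 0 < tailprod cs t by apply: tailprod_gt0.
have at_s i := maxprod_gap (g i) tles (lexx s).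
have at_t i := maxprod_gap (g i) (lexx t) tles.
have at_s' i := maxprod_gap (g' i) tles (lexx s).
have at_t' i := maxprod_gap (g' i) (lexx t) tles.
have hm i : #|ball_class c t i| = m.
  rewrite card_ball_class; apply/eqP; rewrite eqn_leq; apply/andP; split.
    apply: (monomial_step t0 ts (K0 (mutual_dists c i)) (K0 (mutual_dists c i0))).
      by rewrite -!at_s !eS.
    by rewrite -!at_t !er.
  apply: (monomial_step t0 ts (K0 (mutual_dists c i0)) (K0 (mutual_dists c i))).
    by rewrite -!at_s !eS.
  by rewrite -!at_t !er.
have hm' i : (m <= #|ball_class c' t i|)%N.
  rewrite card_ball_class; apply: (monomial_step t0 ts (K0 (mutual_dists c i0)) (K0 (mutual_dists c' i))).
    by rewrite -at_s -at_s' eS eS'.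
  by rewrite -at_t -at_t' er.
have em i : ncount (mutual_dists c' i) t = m by rewrite -card_ball_class (classes_rigid tge0 hm hm' eN).
move=> i; rewrite at_t' em -(er i0) at_t -/m; congr (_ * _).
have sm : 0 < s ^+ m by rewrite exprn_gt0 // (lt_trans t0).
by apply: (mulIf (lt0r_neq0 sm)); rewrite -[in LHS](em i) -at_s' -at_s eS eS'.
Qed.

End Classes.

Section FibreCount.
Variables (R : realType) (k : closedFieldType) (p : nat) (av : k -> R).
Hypothesis hav : complete_padic_av p av.
Let hum := av_um hav.
Variable f : nat -> k.
Hypothesis ff : finite_morphism av f.
Variables (n : nat) (z : k -> 'I_n -> k).
Hypothesis hz : fibre_family av f z.
Hypothesis n0 : (0 < n)%N.

Lemma prof_fibre y i t : av y < 1 -> prof av f z (z y i) t = maxprod (mutual_dists av (z y) i) t.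
Proof. by move=> y1; rewrite /prof (feval_fibre hav ff hz). Qed.

(** Two points [z y i] and [z y j] are equivalent when they lie in the same
    component of the preimage of the disc of radius [r] around [y].  These
    components may have different radii; [t] separates the same points as each
    of them. *)
Theorem card_fibre y (r t : R) : av y < 1 -> 0 <= r < 1 -> 0 <= t ->
  (forall i, exists s, [/\ t <= s, s < 1, prof av f z (z y i) s = r &
     forall j, av (z y i - z y j) <= s -> av (z y i - z y j) <= t]) ->
  ([set x | berk_disc av x /\ push f x = zeta av y r] #= `I_(nclasses av (z y) t))%card.
Proof.
move=> y1 r01 t0 /choice[s hs]; have [r0 r1] := andP r01.
pose g i := gauss av (z y i) (s i).
have s0 i : 0 <= s i by have [h _ _ _] := hs i; apply: le_trans h.
have fibre_lt1 i : av (z y i) < 1 := fibre_disc hz i y1.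
have -> : [set x | berk_disc av x /\ push f x = zeta av y r] = [set g i | i in [set: 'I_n]].
  rewrite (zetaE hav) //; apply/seteqP; split=> [x [xd e]|_ [i _ <-]].
    have [i [u [/andP[u0 u1] eu ->]]] := push_eq_zeta hav ff hz n0 xd y1 r01 e.
    exists i => //; rewrite /g; congr (gauss av _ _).
    have [_ _ es _] := hs i.
    by apply: (prof_inj hav ff hz (fibre_lt1 i)) => //; rewrite eu es.
  have [ts s1 es _] := hs i; split; first exact: (gauss_disc hav).
  by rewrite /g (push_gauss_fibre hav ff hz) // es.
apply: card_range_classes => i j; rewrite (ball_class_eq hav) //.
have [ti si ei di] := hs i; split=> [e|h].
  by apply: di; have [] := gauss_inj_radius hav (s0 i) (s0 j) e.
have hi : av (z y i - z y j) <= s i := le_trans h ti.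
rewrite /g (gauss_eq hav (s0 i) hi); congr (gauss av _ _).
have [_ _ ej _] := hs j.
apply: (prof_inj hav ff hz (fibre_lt1 j)) => //.
by have [<- _] := prof_near hav ff hz (fibre_lt1 i) (fibre_lt1 j) (s0 i) si hi; rewrite ei ej.
Qed.

End FibreCount.

(** * Generic fibres *)

Lemma ler_prod_seq (R : realDomainType) (I : eqType) (s : seq I) (F G : I -> R) :
  (forall i, i \in s -> 0 <= F i <= G i) -> \prod_(i <- s) F i <= \prod_(i <- s) G i.
Proof.
by move=> h; rewrite [leLHS]big_seq [leRHS]big_seq; apply: ler_prod.
Qed.

Section Generic.
Variables (R : realType) (k : closedFieldType) (p : nat) (av : k -> R).
Hypothesis hp : prime p.
Hypothesis hav : complete_padic_av p av.
Let hum := av_um hav.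

(** Roots of [p] of large order. *)
Lemma value_near1 (t : R) : 0 <= t -> t < 1 -> exists b, t < av b < 1.
Proof.
move=> t0 t1; have q0 := av_p_gt0 hav hp; have q1 := av_p_lt1 hav hp.
have [N hN] := small_power t0 t1 q0.
have [b hb] : exists b : k, b ^+ N.+1 = p%:R.
  pose Q : {poly k} := 'X^(N.+1) - (p%:R)%:P.
  have /closed_rootP[b] : size Q != 1%N by rewrite size_XnsubC.
  by rewrite rootE !hornerE subr_eq0 => /eqP hb; exists b.
have eb : av b ^+ N.+1 = av p%:R by rewrite -(umX hum) hb.
have b0 := av_ge0 hav b.
exists b; apply/andP; split; rewrite ltNge; apply/negP => h.
  have := hN N.+1 (leqnSn N); rewrite ltNge -eb => /negP; apply.
  by rewrite lerXn2r.
by have := exprn_ege1 N.+1 h; rewrite eb leNgt q1.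
Qed.

(** Solve [\prod (Y - y') = c ^ N], where [y'] runs through the [N] given points.
    Every solution is at distance at most [|c|] from all of them, and the
    product of the distances is [|c| ^ N]. *)
Lemma generic_point (ys : seq k) w (c : k) : c != 0 -> ys != [::] ->
  (forall y, y \in ys -> av (y - w) <= av c) ->
  exists y, av (y - w) <= av c /\ forall y', y' \in ys -> av (y - y') = av c.
Proof.
move=> c0 ys0 hys; have cp : 0 < av c by rewrite (av_gt0 hav).
pose P := \prod_(a <- ys) ('X - a%:P) - (c ^+ size ys)%:P.
have /closed_rootP[y] : size P != 1%N.
  rewrite /P size_polyDl size_prod_XsubC; first by case: ys ys0 {hys P}.
  by rewrite size_polyN; apply: leq_ltn_trans (size_polyC_leq1 _) _; case: ys ys0 {hys P}.
rewrite rootE /P hornerD hornerN hornerC subr_eq0 horner_prod => /eqP ey.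
have e : \prod_(a <- ys) av (y - a) = av c ^+ size ys.
  rewrite -(umX hum) -ey (um_prod hum); apply: eq_bigr => a _.
  by rewrite hornerXsubC.
have yw : av (y - w) <= av c.
  rewrite leNgt; apply/negP => lt; move: e; apply/eqP; rewrite gt_eqF //.
  rewrite (eq_big_seq (fun _ => av (y - w))) => [|a /hys h].
    rewrite big_const_seq count_predT iter_mulr mulr1 ltr_pXn2r //.
    - by case: ys ys0 {hys ey P}.
    - by rewrite nnegrE ltW.
    - by rewrite nnegrE (av_ge0 hav).
  rewrite (_ : y - a = (y - w) - (a - w)); last by ring.
  by rewrite (um_isoB hum) // (le_lt_trans h).
have le y' : y' \in ys -> av (y - y') <= av c.
  move=> /hys h; rewrite (_ : y - y' = (y - w) - (y' - w)); last by ring.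
  by apply: le_trans (umB hum _ _) _; rewrite ge_max yw.
exists y; split=> // y' hy'; apply/eqP; rewrite eq_le le //= leNgt; apply/negP => lt.
move: e; apply/eqP; rewrite lt_eqF // (big_rem y') //=.
have sz : size ys = (size (rem y' ys)).+1 by rewrite size_rem // prednK // lt0n size_eq0.
rewrite sz exprS; apply: (@le_lt_trans _ _ (av (y - y') * av c ^+ size (rem y' ys))).
  rewrite ler_wpM2l ?(av_ge0 hav) //.
  have -> : av c ^+ size (rem y' ys) = \prod_(a <- rem y' ys) av c.
    by rewrite big_const_seq count_predT iter_mulr mulr1.
  by apply: ler_prod_seq => a /mem_rem ha; rewrite (av_ge0 hav) le.
by rewrite ltr_pM2r // exprn_gt0.
Qed.

Variable f : nat -> k.
Hypothesis ff : finite_morphism av f.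
Variables (n : nat) (z : k -> 'I_n -> k).
Hypothesis hz : fibre_family av f z.
Hypothesis n0 : (0 < n)%N.
Let fe a := feval av f a.

(** If [y] had no preimage in the disc of radius [t] around [a], then [|f - y|]
    would be constant on a slightly larger disc, of value at most [prof a t];
    but there [|f - f a|] reaches a value larger than [prof a t]. *)
Theorem feval_image a (t : R) : av a < 1 -> 0 <= t -> t < 1 ->
  feval av f @` kcdisc av a t = kcdisc av (feval av f a) (prof av f z a t).
Proof.
move=> a1 t0 t1; have fa1 : av (fe a) < 1 := feval_disc hav ff a1.
apply/seteqP; split=> [_ [b ba <-]|y ya].
  have b1 : av b < 1.
    rewrite -(subrK a b); apply: le_lt_trans (umD hum _ _) _.
    by rewrite gt_max a1 (le_lt_trans ba).
  rewrite /kcdisc /= (umBC hum).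
  have ab : av (a - b) <= t by rewrite (umBC hum).
  by have [] := prof_near hav ff hz a1 b1 t0 t1 ab.
have y1 : av y < 1.
  rewrite -(subrK (fe a) y); apply: le_lt_trans (umD hum _ _) _.
  by rewrite gt_max fa1 (le_lt_trans ya) // (prof_lt1 hav ff hz).
suff [i hi] : exists i, av (a - z y i) <= t.
  by exists (z y i); [rewrite /kcdisc /= (umBC hum)|exact: (feval_fibre hav ff hz)].
apply: contrapT => no.
have tv : t < (t + 1) / 2 by rewrite midf_lt.
have v1 : (t + 1) / 2 < 1 by rewrite midf_lt.
have [u /andP[tu uv] hu] := gap_exists (dists av z a y) tv.
have u0 : 0 <= u := ltW (le_lt_trans t0 tu).
have u1 : u < 1 := le_lt_trans uv v1.
have e1 := push_gauss_maxprod hav hz a1 u0 u1 y1.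
have e2 : maxprod (dists av z a y) u = av (fe a - y).
  rewrite (feval_dist hav ff hz a1 y1) /maxprod big_map; apply: eq_bigr => i _.
  apply: max_r; have [|h|//] := hu (av (a - z y i)); first by rewrite map_f // mem_index_enum.
  by case: no; exists i.
move: e1; rewrite e2 (push_gauss hav ff hz) // (gauss_XsubC hav) ?prof_ge0 // => e3.
have h1 : prof av f z a u <= av (fe a - y) by rewrite -e3 le_max lexx.
have h2 : av (fe a - y) <= prof av f z a t by rewrite (umBC hum).
have := prof_lt hav ff hz a1 t0 tu; rewrite ltNge => /negP; apply.
exact: le_trans h1 h2.
Qed.

Lemma prof_pow_le a (t : R) : 0 <= t -> t ^+ n <= prof av f z a t.
Proof.
move=> t0; rewrite /prof /maxprod big_map.
have -> : t ^+ n = \prod_(i < n) t by rewrite prodr_const card_ord.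
by apply: ler_prod => i _; rewrite t0 le_max lexx.
Qed.

(** The preimage of the disc of radius [s ^+ n] around [f 0] is the single disc
    of radius [s] around [0]. *)
Definition horizon (s : R) := [/\ 0 < s, s < 1 & forall i, av (z (fe 0) i) <= s].

Lemma horizon_prof s x : horizon s -> av x <= s -> prof av f z x s = s ^+ n.
Proof.
move=> [s0 s1 hs] xs; have z1 : av 0 < 1 by rewrite (av0 hav) ltr01.
have x1 := le_lt_trans xs s1.
have x0 : av (0 - x) <= s by rewrite sub0r (umN hum).
have [<- _] := prof_near hav ff hz z1 x1 (ltW s0) s1 x0.
rewrite /prof /maxprod big_map (eq_bigr (fun=> s)) ?prodr_const ?card_ord // => i _.
by rewrite sub0r (umN hum) max_l.
Qed.

Lemma horizon_fibre s y : horizon s -> av (y - fe 0) <= s ^+ n ->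
  av y < 1 /\ forall i, av (z y i) <= s.
Proof.
move=> hb ys; have [s0 s1 hs] := hb; have z1 : av 0 < 1 by rewrite (av0 hav) ltr01.
have b0 : prof av f z 0 s = s ^+ n by apply: horizon_prof => //; rewrite (av0 hav) ltW.
have y1 : av y < 1.
  rewrite -(subrK (fe 0) y); apply: le_lt_trans (umD hum _ _) _.
  rewrite gt_max (feval_disc hav ff z1) andbT (le_lt_trans ys) // -b0.
  exact: (prof_lt1 hav ff hz z1 (ltW s0) s1).
split=> // i.
have := push_gauss_maxprod hav hz z1 (ltW s0) s1 y1.
rewrite (push_gauss hav ff hz) ?(ltW s0) // (gauss_XsubC hav) ?prof_ge0 ?(ltW s0) //.
rewrite b0 max_l; last by rewrite (umBC hum).
rewrite /maxprod /dists big_map => /esym e.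
have sz : n = size (index_enum 'I_n) by rewrite -[LHS]card_ord cardE enumT; congr size; rewrite unlock.
rewrite -(umN hum) -sub0r.
apply: (@prod_max_le _ s s0 _ (fun i => av (0 - z y i)) (index_enum 'I_n)) => [j _||].
- exact: av_ge0 hav _.
- by rewrite e -sz.
- exact: mem_index_enum.
Qed.

(** Above the radius [s0], profiles are computed by the Taylor coefficients of
    one partial sum [P] ([prof_partial]).  As functions of the centre, these are
    polynomials, which reach their maximum on the disc of radius [s] at the
    points at distance [s] from all their roots in the disc.  Choosing [y] at maximal
    distance from the images of these roots ([generic_point]) makes all the points
    over [y] such points at the same time. *)
Theorem generic_fibre (s s0 : R) b : horizon s -> s = av b -> 0 < s0 -> s0 <= s ->
  exists y, [/\ av y < 1, forall i, av (z y i) <= s &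
    forall i x t, av x <= s -> s0 <= t -> t <= s ->
      prof av f z x t <= prof av f z (z y i) t].
Proof.
move=> hb sb s00 s0s; have [sp s1 hs] := hb.
have s01 : 0 < s < 1 by rewrite sp.
have z1 : av 0 < 1 by rewrite (av0 hav) ltr01.
have z1s : av 0 <= s by rewrite (av0 hav) ltW.
have [M hM] := prof_partial hav ff hz s01 (exprn_gt0 n s00).
pose P := partial f M.
have eP x t : av x <= s -> s0 <= t -> t <= s ->
    gauss av x t (P - (P.[x])%:P) = prof av f z x t.
  move=> xs s0t ts; apply: hM => //; first exact: le_trans (ltW s00) s0t.
  apply: le_trans (prof_pow_le x (le_trans (ltW s00) s0t)).
  by rewrite lerXn2r // nnegrE ?(le_trans _ s0t) // ltW.
have /choice[rs hrs] : forall l, exists rs : seq k,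
    P^`N(l) = lead_coef P^`N(l) *: \prod_(a <- rs) ('X - a%:P).
  by move=> l; apply: poly_split.
(* [0] ensures that the list is not empty *)
pose alphas := 0 :: [seq a <- flatten [seq rs l | l <- iota 0 (size P)] | av a <= s].
have has a : a \in alphas -> av a <= s.
  by rewrite inE => /orP[/eqP -> //|]; rewrite mem_filter => /andP[].
have b0 : b ^+ n != 0 by rewrite expf_neq0 // -(av_gt0 hav) -sb.
have eb : av (b ^+ n) = s ^+ n by rewrite (umX hum) -sb.
have nasl : [seq fe a | a <- alphas] != [::] by [].
have [|y []] := @generic_point [seq fe a | a <- alphas] (fe 0) _ b0 nasl.
  move=> _ /mapP[a /has ha ->]; rewrite eb (umBC hum).
  have a1 : av a < 1 := le_lt_trans ha s1.
  have ha0 : av (0 - a) <= s by rewrite sub0r (umN hum).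
  have [_ h] := prof_near hav ff hz z1 a1 (ltW sp) s1 ha0.
  by apply: le_trans h _; rewrite horizon_prof.
rewrite eb => yf0 hy; have [y1 hzy] := horizon_fibre hb yf0.
exists y; split=> // i x t xs s0t ts; set w := z y i.
have ws : av w <= s := hzy i.
have w1 : av w < 1 := le_lt_trans ws s1.
(* if [w] were close to a root, [y = f w] would be close to its image *)
have far a : a \in alphas -> av (w - a) = s.
  move=> aas; have ha := has a aas; have a1 : av a < 1 := le_lt_trans ha s1.
  have le : av (w - a) <= s by apply: le_trans (umB hum _ _) _; rewrite ge_max ws.
  apply/eqP; rewrite eq_le le leNgt; apply/negP => lt.
  have := hy (fe a) (map_f _ aas); apply/eqP; rewrite lt_eqF //.
  have -> : y = fe w by rewrite /fe /w (feval_fibre hav ff hz).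
  have u0 := av_ge0 hav (w - a).
  have [_ h] := prof_near hav ff hz w1 a1 u0 (lt_trans lt s1) (lexx _).
  apply: le_lt_trans h _; rewrite -(horizon_prof hb ws).
  exact: (prof_lt hav ff hz w1 u0 lt).
have t0 : 0 <= t := le_trans (ltW s00) s0t.
rewrite -!eP //; apply: gauss0_le => [|l]; first exact: um_ge0 (gauss_um hav t0 w) _.
apply: le_trans (gauss0_coef hav t _ l); rewrite ler_wpM2r ?exprn_ge0 //.
rewrite !coef_gauss_sub; case: eqP => [_|_]; first exact: lexx.
have [lP|Pl] := ltnP l (size P); last first.
  rewrite (_ : P^`N(l) = 0) ?horner0 ?(av_ge0 hav) //.
  by apply/polyP => j; rewrite coef_nderivn nth_default ?coef0 ?mul0rn // (leq_trans Pl) ?leq_addr.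
have ev v : av (P^`N(l)).[v] = av (lead_coef P^`N(l)) * \prod_(a <- rs l) av (v - a).
  rewrite {1}(hrs l) hornerZ (umM hum) horner_prod (um_prod hum); congr (_ * _).
  by apply: eq_bigr => a _; rewrite hornerXsubC.
rewrite !ev ler_wpM2l ?(av_ge0 hav) //.
apply: ler_prod_seq => a ars; rewrite (av_ge0 hav) /=.
have [as1|sa] := leP (av a) s.
  rewrite far; first by apply: le_trans (umB hum _ _) _; rewrite ge_max xs.
  rewrite inE mem_filter as1 /=; apply/orP; right; apply/flattenP; exists (rs l) => //.
  by rewrite map_f // mem_iota.
rewrite (umBC hum) (umBC hum w) !(um_isoB hum) //; exact: le_lt_trans sa.
Qed.

End Generic.

(** * Radial morphisms *)

Section Radial.
Variables (R : realType) (k : closedFieldType) (p : nat) (av : k -> R).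
Hypothesis hp : prime p.
Hypothesis hav : complete_padic_av p av.
Let hum := av_um hav.

Definition all_dists n (c : 'I_n -> k) : seq R :=
  flatten [seq mutual_dists av c i | i <- index_enum 'I_n].

Lemma gap_dists n (c : 'I_n -> k) cs (t s : R) i :
  {subset all_dists c <= cs} -> gap cs t s -> gap (mutual_dists av c i) t s.
Proof.
move=> sub hg d hd; apply: hg; apply: sub; apply/flattenP.
by exists (mutual_dists av c i) => //; rewrite map_f // mem_index_enum.
Qed.

Section TwoFibres.
Variables (f f' : nat -> k) (n : nat) (z z' : k -> 'I_n -> k).
Hypotheses (ff : finite_morphism av f) (ff' : finite_morphism av f').
Hypotheses (hz : fibre_family av f z) (hz' : fibre_family av f' z').
Hypothesis n0 : (0 < n)%N.
Variable N : R -> nat.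
Hypotheses (hN : fibre_count av f N) (hN' : fibre_count av f' N).

(** Over the point of radius [r], each component of the preimage around the fibre
    of [y'] has a radius in the interval from [t] to [s], where there is no
    break point; hence [card_fibre] applies with the same [t] to both fibres. *)
Lemma fibre_count_step y y' (t s r S : R) : av y < 1 -> av y' < 1 -> 0 < t -> t < s -> s < 1 ->
  (forall i, gap (mutual_dists av (z y) i) t s) -> (forall i, gap (mutual_dists av (z' y') i) t s) ->
  (forall i, prof av f z (z y i) s = S) -> (forall i, prof av f' z' (z' y' i) s = S) ->
  (forall i, prof av f z (z y i) t = r) -> (forall i, prof av f' z' (z' y' i) t <= r) ->
  forall i, prof av f' z' (z' y' i) t = r.
Proof.
move=> y1 y'1 t0 ts s1 g g' eS eS' er ler i.
have tge0 := ltW t0; have t1 : t < 1 := lt_trans ts s1.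
pose i0 := Ordinal n0.
have d0 : av (z y i0) < 1 := fibre_disc hz i0 y1.
have d' j : av (z' y' j) < 1 := fibre_disc hz' j y'1.
have rS : r < S by rewrite -(er i0) -(eS i0); apply: (prof_lt hav ff hz).
have r01 : 0 <= r < 1.
  by rewrite -(er i0) prof_ge0 //=; apply: (prof_lt1 hav ff hz).
have eN : nclasses av (z y) t = nclasses av (z' y') t.
  have c1 : ([set x | berk_disc av x /\ push f x = zeta av y r]
      #= `I_(nclasses av (z y) t))%card.
    by apply: (card_fibre hav ff hz n0) => // j; exists t; split.
  have c2 : ([set x | berk_disc av x /\ push f' x = zeta av y' r]
      #= `I_(nclasses av (z' y') t))%card.
    apply: (card_fibre hav ff' hz' n0) => // j.
    have [u /andP[u0 u1] eu] := prof_surj hav ff' hz' (d' j) r01.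
    exists u; split=> //.
      rewrite leNgt; apply/negP => ut; have := prof_lt hav ff' hz' (d' j) u0 ut.
      by rewrite eu ltNge ler.
    move=> l hl; have := g' j (av (z' y' j - z' y' l)); case=> // [|sd].
      by apply: map_f; rewrite mem_index_enum.
    have := prof_le_mono f' z' (d' j) (ltW (lt_trans t0 ts)) (le_trans sd hl).
    by rewrite eu eS' leNgt rS.
  have h1 := (hN r01).2 y y1; have h2 := (hN' r01).2 y' y'1.
  have e1 : N r = nclasses av (z y) t.
    by apply/card_eq_II; apply: card_eq_trans c1; rewrite card_eq_sym.
  have e2 : N r = nclasses av (z' y') t.
    by apply/card_eq_II; apply: card_eq_trans c2; rewrite card_eq_sym.
  by rewrite -e1.
rewrite (prof_fibre hav ff' hz') //.
apply: (class_count_step hav n0 t0 ts g g' (S := S)) eN i => j.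
- by rewrite -(prof_fibre hav ff hz).
- by rewrite -(prof_fibre hav ff' hz').
- by rewrite -(prof_fibre hav ff hz).
- by rewrite -(prof_fibre hav ff' hz').
Qed.

End TwoFibres.

Section OneMorphism.
Variable f : nat -> k.
Hypothesis ff : finite_morphism av f.
Variables (n : nat) (z : k -> 'I_n -> k).
Hypothesis hz : fibre_family av f z.
Hypothesis n0 : (0 < n)%N.
Let fe a := feval av f a.

Definition same_profile := forall a b (t : R), av a < 1 -> av b < 1 -> 0 <= t -> t < 1 ->
  prof av f z a t = prof av f z b t.

Lemma radial_same_profile : radial av f <-> same_profile.
Proof.
split=> [h a b t a1 b1|h a b a1 b1 l l0]; last first.
  rewrite !(val_polygonE hav ff hz) //; congr (- ln _)%:E.
  by apply: h => //; rewrite -expR0 ltr_expR oppr_lt0.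
rewrite le_eqVlt => /orP[/eqP <- _|t0 t1].
  by rewrite !(prof0 hav ff hz).
have l0 : 0 < - ln t by rewrite oppr_gt0 ln_lt0 // t0.
have := h a b a1 b1 _ l0; rewrite !(val_polygonE hav ff hz) // opprK lnK ?posrE //.
by move=> [] /oppr_inj; apply: ln_inj; rewrite posrE; apply: maxprod_gt0.
Qed.

(** The size of a class is the exponent of the common profile, by [ncount_eq]. *)
Lemma same_profile_count : same_profile -> exists N, fibre_count av f N.
Proof.
move=> h; have z1 : av 0 < 1 by rewrite (av0 hav) ltr01.
have /choice[N hN] : forall r : R, exists m, 0 <= r < 1 -> (0 < m)%N /\
    forall y, kdisc av y -> ([set x | berk_disc av x /\ push f x = zeta av y r] #= `I_m)%card.
  move=> r; have [r01|nr] := boolP (0 <= r < 1); last by exists 0%N.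
  have [t /andP[t0 t1] et] := prof_surj hav ff hz z1 r01.
  have tv : t < (t + 1) / 2 by rewrite midf_lt.
  have v1 : (t + 1) / 2 < 1 by rewrite midf_lt.
  pose i0 := Ordinal n0; pose m := ncount (mutual_dists av (z 0) i0) t.
  have hm y i : av y < 1 -> #|ball_class av (z y) t i| = m.
    move=> y1; rewrite card_ball_class.
    apply: (@ncount_eq _ _ _ 1 1 _ _ t0 tv) => // u /andP[tu uv].
    rewrite !mul1r -!(prof_fibre hav ff hz) //.
    by apply: h; [exact: (fibre_disc hz i y1)|exact: (fibre_disc hz i0 z1)|
      exact: le_trans tu|exact: le_lt_trans v1].
  have eN y : av y < 1 -> (nclasses av (z y) t * m)%N = n.
    by move=> y1; apply: (uniform_classes hav t0) => i; apply: hm.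
  have m0 : (0 < m)%N by have := eN 0 z1; case: (m) => // e; move: n0; rewrite -e muln0.
  exists (nclasses av (z 0) t) => _; split; first exact: nclasses_gt0.
  move=> y y1; have -> : nclasses av (z 0) t = nclasses av (z y) t.
    by apply/eqP; rewrite -(eqn_pmul2r m0) !eN.
  apply: (card_fibre hav ff hz n0) => // i; exists t; split=> //.
  by rewrite -et; apply: h => //; exact: (fibre_disc hz i y1).
by exists N => r /hN.
Qed.

(** Both given points are compared with a generic fibre, by descent from a
    radius [s] at which all profiles are equal to [s ^+ n]. *)
Lemma count_same_profile N : fibre_count av f N -> same_profile.
Proof.
move=> hN a b t a1 b1; rewrite le_eqVlt => /orP[/eqP <- _|t0 t1].
  by rewrite !(prof0 hav ff hz).
have z1 : av 0 < 1 by rewrite (av0 hav) ltr01.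
pose q := \big[Num.max/Num.max t (Num.max (av a) (av b))]_i av (z (fe 0) i).
have fe01 : av (fe 0) < 1 := feval_disc hav ff z1.
have q1 : q < 1.
  by apply: bigmax_lt => [|i _]; rewrite ?gt_max ?t1 ?a1 //; apply: (fibre_disc hz i fe01).
have qge : Num.max t (Num.max (av a) (av b)) <= q by apply: bigmax_ge_id.
move: (qge); rewrite !ge_max => /andP[tq /andP[aq bq]].
have q0 : 0 <= q := le_trans (ltW t0) tq.
have [c /andP[qc c1]] := value_near1 hp hav q0 q1.
set s := av c in qc c1.
have hb : horizon av f z s.
  split=> // [|i]; first exact: le_lt_trans q0 qc.
  apply: le_trans (ltW qc); exact: (le_bigmax _ (fun i => av (z (fe 0) i))).
have ts : t <= s := le_trans tq (ltW qc).
have [y [y1 ys dom]] := generic_fibre hav ff hz hb (erefl s) t0 ts.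
pose i0 := Ordinal n0.
have same i u : t <= u -> u <= s -> prof av f z (z y i) u = prof av f z (z y i0) u.
  by move=> tu us; apply/eqP; rewrite eq_le !dom ?ys.
suff key x : av x <= s -> prof av f z x t = prof av f z (z y i0) t.
  by rewrite (key a) ?(key b) // (le_trans _ (ltW qc)).
move=> xs; have x1 : av x < 1 := le_lt_trans xs c1.
have s0 : 0 < s := lt_le_trans t0 ts.
have x0 : av (x - 0) <= s by rewrite subr0.
have [_ hy'] := prof_near hav ff hz x1 z1 (ltW s0) c1 x0.
rewrite (horizon_prof hav ff hz hb xs) in hy'.
set y' := feval av f x in hy'.
have [y'1 ys'] := horizon_fibre hav ff hz hb hy'.
have [j ->] := fibreP hav ff hz x1 y'1 erefl; move: j.
pose cs := all_dists (z y) ++ all_dists (z y').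
pose Q u := forall j, prof av f z (z y' j) u = prof av f z (z y i0) u.
apply: (@break_point_ind _ cs Q t s _ _ t (lexx t) ts).
  by move=> j; rewrite !(horizon_prof hav ff hz hb).
move=> u v tu uv vs hg Qv.
have us : u <= s := le_trans (ltW uv) vs; have tv : t <= v := le_trans tu (ltW uv).
apply: (fibre_count_step ff ff hz hz n0 hN hN y1 y'1 (lt_le_trans t0 tu) uv (le_lt_trans vs c1)
   (S := prof av f z (z y i0) v)) => i.
- by apply: gap_dists hg => d; rewrite mem_cat => ->.
- by apply: gap_dists hg => d; rewrite mem_cat orbC => ->.
- exact: same.
- exact: Qv.
- exact: same.
- exact: dom.
Qed.

Hypothesis zinj : forall y, av y < 1 -> injective (z y).

(** At radius zero the classes are singletons, the points being distinct. *)
Lemma count0 N : fibre_count av f N -> N 0 = n.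
Proof.
move=> hN; have z1 : av 0 < 1 by rewrite (av0 hav) ltr01.
have r01 : 0 <= (0 : R) < 1 by rewrite lexx ltr01.
have c1 : ([set x | berk_disc av x /\ push f x = zeta av 0 0]
      #= `I_(nclasses av (z 0) 0))%card.
  apply: (card_fibre hav ff hz n0) => // i; exists 0; split=> //.
  by apply: (prof0 hav ff hz); apply: (fibre_disc hz i z1).
have h1 := (hN 0 r01).2 0 z1.
have -> : N 0 = nclasses av (z 0) 0.
  by apply/card_eq_II; apply: card_eq_trans c1; rewrite card_eq_sym.
rewrite -[LHS]muln1; apply: (uniform_classes hav (lexx 0)) => i.
apply/eqP/cards1P; exists i; apply/setP => j; rewrite !inE.
rewrite eq_sym -(inj_eq (zinj z1)) -subr_eq0 -[RHS]negbK -(av_gt0 hav) -leNgt.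
by rewrite (umBC hum).
Qed.

(** Translated to the origin, the set of radii in the definition of [profile]
    depends on the morphism and on the centre through [prof] only. *)
Lemma profileE a (r : R) : av a < 1 -> 0 < r -> r < 1 ->
  profile av f a r =
  xget 0 [set r' | 0 <= r' <= 1 /\ kcdisc av 0 (prof av f z a r) = kcdisc av 0 r'].
Proof.
move=> a1 r0 r1; rewrite /profile gt_eqF // lt_eqF //; congr (xget _ _).
apply/funext => r'; apply/propext.
rewrite /= (feval_image hav ff hz a1 (ltW r0) r1).
have shift (u v : R) b : kcdisc av 0 u = kcdisc av 0 v -> kcdisc av b u = kcdisc av b v.
  move=> e; apply/funext => x; have := congr1 (fun S => S (x - b)) e.
  by rewrite /kcdisc /= subr0.
split=> -[h1 h2]; split=> //; last exact: shift.
apply/funext => x; have := congr1 (fun S => S (x + feval av f a)) h2.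
by rewrite /kcdisc /= addrK subr0.
Qed.

End OneMorphism.

(** At each radius one of the two profiles is at most the other, and
    [fibre_count_step] applies with the roles chosen accordingly. *)
Theorem profile_unique f g n n' (z : k -> 'I_n -> k) (z' : k -> 'I_n' -> k) N :
  finite_morphism av f -> finite_morphism av g ->
  fibre_family av f z -> fibre_family av g z' -> (0 < n)%N -> (0 < n')%N ->
  (forall y, av y < 1 -> injective (z y)) -> (forall y, av y < 1 -> injective (z' y)) ->
  same_profile f z -> same_profile g z' -> fibre_count av f N -> fibre_count av g N ->
  forall a b t, av a < 1 -> av b < 1 -> 0 <= t -> t < 1 ->
    prof av f z a t = prof av g z' b t.
Proof.
move=> ff gg hz hz' n0 n0' zi zi' sp sp' hN hN' a b t a1 b1 t0 t1.
have en : n' = n by rewrite -(count0 ff hz n0 zi hN) -(count0 gg hz' n0' zi' hN').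
subst n'; move: t0; rewrite le_eqVlt => /orP[/eqP <-|t0].
  by rewrite (prof0 hav ff hz) // (prof0 hav gg hz').
have z1 : av 0 < 1 by rewrite (av0 hav) ltr01.
pose i0 := Ordinal n0.
have d i : av (z 0 i) < 1 := fibre_disc hz i z1.
have d' i : av (z' 0 i) < 1 := fibre_disc hz' i z1.
pose cs := all_dists (z 0) ++ all_dists (z' 0).
have cs1 c : c \in cs -> c < 1.
  rewrite mem_cat => /orP[] /flattenP[_ /mapP[i _ ->] /mapP[j _ ->]];
    apply: le_lt_trans (umB hum _ _) _; by rewrite gt_max ?d ?d'.
(* a radius at which all points of either fibre are equivalent *)
pose v := \big[Num.max/t]_(c <- cs) c.
have v1 : v < 1 by rewrite /v big_seq; apply: bigmax_lt.
have tv : t <= v by apply: bigmax_ge_id.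
have v0 : 0 < v := lt_le_trans t0 tv.
have top m (c : 'I_m -> k) i : {subset all_dists c <= cs} -> maxprod (mutual_dists av c i) v = v ^+ m.
  move=> sub; rewrite /maxprod big_map (eq_bigr (fun=> v)) ?prodr_const ?card_ord // => j _.
  apply: max_l; apply: (le_bigmax_seq _ _ xpredT id) => //; apply: sub; apply/flattenP.
  by exists (mutual_dists av c i); rewrite map_f // mem_index_enum.
have sub1 : {subset all_dists (z 0) <= cs} by move=> c; rewrite mem_cat => ->.
have sub2 : {subset all_dists (z' 0) <= cs} by move=> c; rewrite mem_cat orbC => ->.
rewrite (sp a (z 0 i0)) ?(sp' b (z' 0 i0)) ?(ltW t0) //.
pose Q u := prof av f z (z 0 i0) u = prof av g z' (z' 0 i0) u.
apply: (@break_point_ind _ cs Q t v _ _ t (lexx t) tv).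
  by rewrite /Q (prof_fibre hav ff hz) // (prof_fibre hav gg hz') // !top.
move=> u w tu uw wv hg Qw.
have u0 : 0 < u := lt_le_trans t0 tu; have w1 : w < 1 := le_lt_trans wv v1.
have u1 : u < 1 := lt_trans uw w1; have w0 := lt_trans u0 uw.
have g1 i := gap_dists (i := i) sub1 hg; have g2 i := gap_dists (i := i) sub2 hg.
case/orP: (le_total (prof av g z' (z' 0 i0) u) (prof av f z (z 0 i0) u)) => le.
  apply/esym; apply: (fibre_count_step ff gg hz hz' n0 hN hN' z1 z1 u0 uw w1 g1 g2
    (S := prof av f z (z 0 i0) w)) => i.
  - by apply: sp; rewrite ?ltW.
  - by rewrite Qw; apply: sp'; rewrite ?ltW.
  - by apply: sp; rewrite ?ltW.
  - by rewrite (sp' _ _ _ (d' i) (d' i0) (ltW u0) u1).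
apply: (fibre_count_step gg ff hz' hz n0 hN' hN z1 z1 u0 uw w1 g2 g1
    (S := prof av g z' (z' 0 i0) w)) => i.
- by apply: sp'; rewrite ?ltW.
- by rewrite -Qw; apply: sp; rewrite ?ltW.
- by apply: sp'; rewrite ?ltW.
- by rewrite (sp _ _ _ (d i) (d i0) (ltW u0) u1).
Qed.

Lemma etale_fibres f d : finite_etale av f d -> exists n (z : k -> 'I_n -> k),
  [/\ (0 < n)%N, fibre_family av f z & forall y, av y < 1 -> injective (z y)].
Proof.
move=> fet; have [n [z [n0 hz]]] := fibres hav (finite_etale_morphism fet).
by exists n, z; split=> // y; apply: (etale_fibre_inj hp hav fet).
Qed.

End Radial.

Theorem theorem2p17 (R : realType) (k : closedFieldType) (p : nat)
    (av : k -> R) (hp : prime p) (hav : complete_padic_av p av) :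
  (forall (f : nat -> k) (d : nat), finite_etale av f d ->
     (radial av f <-> exists N : R -> nat, fibre_count av f N)) /\
  (forall (f g : nat -> k) (d d' : nat) (N : R -> nat),
     finite_etale av f d -> finite_etale av g d' ->
     radial av f -> radial av g ->
     fibre_count av f N -> fibre_count av g N ->
     forall (a b : k) (rho : R), kdisc av a -> kdisc av b ->
       0 <= rho <= 1 -> profile av f a rho = profile av g b rho).
Proof.
split=> [f d fet|f g d d' N fet get rf rg hN hN' a b r a1 b1 /andP[r0 r1]].
  have ff := finite_etale_morphism fet.
  have [n [z [n0 hz _]]] := etale_fibres hp hav fet.
  rewrite (radial_same_profile hav ff hz); split; first exact: (same_profile_count hav ff hz n0).
  by move=> [N hN]; apply: (count_same_profile hp hav ff hz n0 hN).
have ff := finite_etale_morphism fet; have gg := finite_etale_morphism get.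
have [n [z [n0 hz zi]]] := etale_fibres hp hav fet.
have [n' [z' [n0' hz' zi']]] := etale_fibres hp hav get.
have sp := (radial_same_profile hav ff hz).1 rf.
have sp' := (radial_same_profile hav gg hz').1 rg.
have [->|r0'] := eqVneq r 0; first by rewrite /profile eqxx.
have [->|r1'] := eqVneq r 1; first by rewrite /profile eqxx.
have rp : 0 < r by rewrite lt_neqAle eq_sym r0'.
have rl : r < 1 by rewrite lt_neqAle r1'.
rewrite (profileE hav ff hz a1 rp rl) (profileE hav gg hz' b1 rp rl).
by rewrite (profile_unique hav ff gg hz hz' n0 n0' zi zi' sp sp' hN hN' a1 b1).
Qed.
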